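(* Let $X$ be a simply connected complex manifold, let $L$ be a holomorphic line bundle on $X$ that is holomorphically non-trivial, and let $U\subset\mathrm{Tot}_L$ be a neighborhood of the zero section such that, for any $x\in X$, the intersection $L_x\cap U$ is biholomorphic to the unit disc $D\subset\mathbb{C}$. Then the natural projection $p\colon U\to X$ is not holomorphically locally trivial.
   Context: $D=\{z\in\mathbb{C}: |z|<1\}$. For a line bundle $L$ over $X$, $\mathrm{Tot}_L$ denotes its total space and $L_x\subset\mathrm{Tot}_L$ its fiber over $x\in X$. Neighborhoods are open, and simply connected manifolds are connected. The natural projection $p\colon U\to X$ is the restriction to $U$ of the bundle projection $\mathrm{Tot}_L\to X$. A surjective holomorphic submersion $p\colon Y\to X$ whose fibers are all biholomorphic to a complex manifold $F$ is called holomorphically locally trivial if for any $x\in X$ there exist a neighborhood $V\ni x$ and a biholomorphism $\varphi\colon p^{-1}(V)\to F\times V$ such that $\mathrm{pr}_V\circ\varphi=p|_{p^{-1}(V)}$. *)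

(* Defs.v *)
From HB Require Import structures.
From mathcomp Require Import all_boot all_order all_algebra.
From mathcomp Require Import complex lra.
From mathcomp Require Import all_classical all_reals all_analysis.

Set Implicit Arguments.
Unset Strict Implicit.
Unset Printing Implicit Defensive.

Import Order.TTheory GRing.Theory Num.Theory numFieldNormedType.Exports.

Local Open Scope classical_set_scope.
Local Open Scope ring_scope.

(* [chart_map] and [chart_inv] are total functions; only their restrictions to
   [chart_dom] and to [chart_map @` chart_dom] are meaningful. *)
Record chart (R : realType) (E : normedModType R[i]) (T : topologicalType) :=
  Chart {
    chart_dom : set T;
    chart_map : T -> E;
    chart_inv : E -> T;
    chart_dom_open : open chart_dom;
    chart_codom_open : open (chart_map @` chart_dom);
    chart_map_continuous : forall x, chart_dom x ->
      {for x, continuous chart_map};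
    chart_inv_continuous : forall x, chart_dom x ->
      {for chart_map x, continuous chart_inv};
    chart_mapK : forall x, chart_dom x -> chart_inv (chart_map x) = x }.

(* [E] is the model space: an n-dimensional manifold has E = 'rV[R[i]]_n.
   The transition maps are defined on the open sets
   [chart_map c @` (chart_dom c `&` chart_dom d)], where holomorphy is Frechet
   differentiability over R[i] at every point. *)
Record complex_manifold (R : realType) (E : normedModType R[i]) :=
  ComplexManifold {
    space :> topologicalType;
    atlas : set (chart E space);
    space_hausdorff : hausdorff_space space;
    space_second_countable : @second_countable space;
    atlas_cover : forall x, exists2 c, atlas c & chart_dom c x;
    atlas_holomorphic : forall c d x, atlas c -> atlas d ->
      chart_dom c x -> chart_dom d x ->
      differentiable (chart_map d \o chart_inv c) (chart_map c x) }.

Section HolomorphicMaps.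
Variables (R : realType) (E E' : normedModType R[i]).
Variables (M : complex_manifold E) (N : complex_manifold E').

(* Complex differentiability at the single point [x], read in charts. *)
Definition complex_differentiable_at (f : M -> N) (x : M) :=
  {for x, continuous f} /\
  forall (c : chart E M) (d : chart E' N), atlas c -> atlas d ->
    chart_dom c x -> chart_dom d (f x) ->
    differentiable (chart_map d \o f \o chart_inv c) (chart_map c x).

(* Only the restriction of [f] to [S] matters: locally it has to be the
   restriction of a holomorphic map defined on an open subset of [M].  For [S]
   open this is holomorphy of [f] on [S]; for [S] a complex submanifold, such as
   a fiber of a submersion, it is holomorphy for the induced structure on [S].
   Open subsets and fibers are thus handled as subsets of the ambient
   manifold. *)
Definition holomorphic_on (S : set M) (f : M -> N) :=
  forall x, S x -> exists g : M -> N,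
    (\forall y \near x, complex_differentiable_at g y) /\
    (\forall y \near x, S y -> f y = g y).

End HolomorphicMaps.

(* The restriction of [f] is a biholomorphism from [S] onto [S']. *)
Definition biholomorphism (R : realType) (E E' : normedModType R[i])
    (M : complex_manifold E) (N : complex_manifold E')
    (S : set M) (S' : set N) (f : M -> N) :=
  exists g : N -> M,
    [/\ holomorphic_on S f, holomorphic_on S' g,
        forall x, S x -> S' (f x) /\ g (f x) = x &
        forall y, S' y -> S (g y) /\ f (g y) = y].

Definition biholomorphic (R : realType) (E E' : normedModType R[i])
    (M : complex_manifold E) (N : complex_manifold E')
    (S : set M) (S' : set N) :=
  exists f : M -> N, biholomorphism S S' f.

Section ProductTopology.
Variables T T' : topologicalType.

Lemma open_setX (A : set T) (B : set T') : open A -> open B -> open (A `*` B).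
Proof.
move=> oA oB; rewrite openE => -[x y] [/= Ax By].
by exists (A, B) => //=; split; apply: open_nbhs_nbhs.
Qed.

Lemma prod_hausdorff :
  hausdorff_space T -> hausdorff_space T' -> hausdorff_space (T * T')%type.
Proof.
move=> hT hT' [x x'] [y y'] xy.
congr (_, _).
  apply: hT => A B Ax By.
  have [] := xy (A `*` setT) (B `*` setT).
  - by exists (A, setT) => //=; split=> //; exact: filterT.
  - by exists (B, setT) => //=; split=> //; exact: filterT.
  - by move=> [u v] [[/= Au _] [/= Bu _]]; exists u.
apply: hT' => A B Ax By.
have [] := xy (setT `*` A) (setT `*` B).
- by exists (setT, A) => //=; split=> //; exact: filterT.
- by exists (setT, B) => //=; split=> //; exact: filterT.
- by move=> [u v] [[/= _ Au] [/= _ Bu]]; exists v.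
Qed.

Lemma prod_second_countable :
  @second_countable T -> @second_countable T' ->
  @second_countable (T * T')%type.
Proof.
move=> [B cB [oB bB]] [B' cB' [oB' bB']].
exists ((fun z => z.1 `*` z.2) @` (B `*` B')).
  exact: sub_countable (card_image_le _ _) (countableX cB cB').
split=> [_ [[U V] [/= BU BV] <-]|[x y] W [[P Q] /= [Px Qy] PQ]].
  by apply: open_setX; [exact: oB|exact: oB'].
have [U [BU Ux] UP] := bB x P Px.
have [V [BV Vy] VQ] := bB' y Q Qy.
exists (U `*` V) => /=.
  by split=> //; exists (U, V).
by move=> [a b] [/= Ua Vb]; apply: PQ; split; [exact: UP|exact: VQ].
Qed.

End ProductTopology.

Section ProductManifold.
Variables (R : realType) (E E' : normedModType R[i]).

Section ProductChart.
Variables (T T' : topologicalType) (c : chart E T) (d : chart E' T').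

Definition prod_chart_dom := chart_dom c `*` chart_dom d.
Definition prod_chart_map (z : T * T') : (E * E')%type := (chart_map c z.1, chart_map d z.2).
Definition prod_chart_inv (w : E * E') : (T * T')%type := (chart_inv c w.1, chart_inv d w.2).

Lemma prod_map_continuous (U U' V V' : topologicalType) (f : U -> V) (g : U' -> V')
    (z : U * U') :
  {for z.1, continuous f} -> {for z.2, continuous g} ->
  {for z, continuous (fun z : U * U' => (f z.1, g z.2))}.
Proof.
case: z => x y /= cf cg; apply: cvg_pair.
  by apply: (@cvg_comp _ _ _ fst f _ (nbhs x)) => //; exact: cvg_fst.
by apply: (@cvg_comp _ _ _ snd g _ (nbhs y)) => //; exact: cvg_snd.
Qed.

Lemma prod_chart_dom_open : open prod_chart_dom.
Proof. by apply: open_setX; exact: chart_dom_open. Qed.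

Lemma prod_chart_codom_open : open (prod_chart_map @` prod_chart_dom).
Proof.
suff -> : prod_chart_map @` prod_chart_dom =
    (chart_map c @` chart_dom c) `*` (chart_map d @` chart_dom d).
  by apply: open_setX; exact: chart_codom_open.
apply/seteqP; split=> [_ [[x y] [/= cx dy] <-]|[_ _] [/= [x cx <-] [y dy <-]]].
  by split; [exists x|exists y].
by exists (x, y).
Qed.

Lemma prod_chart_map_continuous z : prod_chart_dom z -> {for z, continuous prod_chart_map}.
Proof.
by move=> [cz dz]; apply: prod_map_continuous; exact: chart_map_continuous.
Qed.

Lemma prod_chart_inv_continuous z : prod_chart_dom z -> {for prod_chart_map z, continuous prod_chart_inv}.
Proof.
by move=> [cz dz]; apply: prod_map_continuous; exact: chart_inv_continuous.
Qed.

Lemma prod_chart_mapK z : prod_chart_dom z -> prod_chart_inv (prod_chart_map z) = z.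
Proof. by case: z => x y [/= cx dy]; rewrite /prod_chart_inv /= !chart_mapK. Qed.

Definition prod_chart : chart (E * E')%type (T * T')%type :=
  Chart prod_chart_dom_open prod_chart_codom_open prod_chart_map_continuous prod_chart_inv_continuous prod_chart_mapK.

End ProductChart.

Lemma differentiable_fst (z : E * E') :
  differentiable (fst : E * E' -> E) z.
Proof.
have lin : linear (fst : E * E' -> E) by [].
pose f : {linear (E * E')%type -> E} := HB.pack (fst : E * E' -> E)
  (GRing.isLinear.Build R[i] (E * E')%type E *:%R fst lin).
by apply: (@linear_differentiable _ _ _ f) => -[x y]; exact: cvg_fst.
Qed.

Lemma differentiable_snd (z : E * E') :
  differentiable (snd : E * E' -> E') z.
Proof.
have lin : linear (snd : E * E' -> E') by [].
pose f : {linear (E * E')%type -> E'} := HB.pack (snd : E * E' -> E')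
  (GRing.isLinear.Build R[i] (E * E')%type E' *:%R snd lin).
by apply: (@linear_differentiable _ _ _ f) => -[x y]; exact: cvg_snd.
Qed.

Variables (M : complex_manifold E) (N : complex_manifold E').

Definition prod_atlas : set (chart (E * E')%type (M * N)%type) :=
  [set b | exists c d, [/\ atlas c, atlas d & b = prod_chart c d]].

Lemma prod_atlas_cover (z : M * N) : exists2 b, prod_atlas b & chart_dom b z.
Proof.
case: z => x y.
have [c Ac cx] := atlas_cover x; have [d Ad dy] := atlas_cover y.
by exists (prod_chart c d) => //; exists c, d.
Qed.

Lemma prod_atlas_holomorphic (b b' : chart (E * E')%type (M * N)%type) (z : M * N) :
  prod_atlas b -> prod_atlas b' -> chart_dom b z -> chart_dom b' z ->
  differentiable (chart_map b' \o chart_inv b) (chart_map b z).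
Proof.
move=> [c [d [Ac Ad ->]]] [c' [d' [Ac' Ad' ->]]].
case: z => x y [/= cx dy] [/= cx' dy'].
apply: (@differentiable_pair _ _ _ _
  (fun w : E * E' => chart_map c' (chart_inv c w.1))
  (fun w : E * E' => chart_map d' (chart_inv d w.2))).
- apply: (@differentiable_comp _ _ _ _ fst (chart_map c' \o chart_inv c)).
    exact: differentiable_fst.
  exact: atlas_holomorphic.
- apply: (@differentiable_comp _ _ _ _ snd (chart_map d' \o chart_inv d)).
    exact: differentiable_snd.
  exact: atlas_holomorphic.
Qed.

Definition prod_manifold : complex_manifold (E * E')%type :=
  ComplexManifold
    (prod_hausdorff (@space_hausdorff _ _ M) (@space_hausdorff _ _ N))
    (prod_second_countable (@space_second_countable _ _ M)
                           (@space_second_countable _ _ N))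
    prod_atlas_cover prod_atlas_holomorphic.

End ProductManifold.

Section ComplexLine.
Variable R : realType.

Lemma line_chart_open : open (id @` [set: R[i]^o]).
Proof. by rewrite image_id; exact: openT. Qed.

Lemma line_chart_continuous (x : R[i]^o) :
  [set: R[i]^o] x -> {for x, continuous (id : R[i]^o -> R[i]^o)}.
Proof. by move=> _; exact: cvg_id. Qed.

Definition line_chart : chart R[i]^o R[i]^o :=
  Chart openT line_chart_open line_chart_continuous line_chart_continuous
    (fun x _ => erefl).

Lemma line_second_countable : @second_countable R[i]^o.
Proof.
pose B (q : rat * rat * rat) : set R[i]^o :=
  ball ((ratr q.1.1 +i* ratr q.1.2)%C : R[i]^o) ((ratr q.2)%:C)%C.
exists (range B); first exact: sub_countable (card_image_le _ _) (countableP _).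
split=> [_ [q _ <-]|x P /nbhs_ballP[e /= e0 eP]]; first exact: ball_open.
case: e e0 eP => e e'; rewrite ltcE/= => /andP[/eqP -> e0] eP.
have e8 : 0 < e / 8 by rewrite divr_gt0.
have [q1] := @rat_in_itvoo R (complex.Re x - e / 8) (complex.Re x + e / 8)
  ltac:(lra).
have [q2] := @rat_in_itvoo R (complex.Im x - e / 8) (complex.Im x + e / 8)
  ltac:(lra).
have [r] := @rat_in_itvoo R (e / 4) (e / 2) ltac:(lra).
rewrite !in_itv/= => /andP[r1 r2] /andP[b1 b2] /andP[a1 a2].
pose y : R[i]^o := (ratr q1 +i* ratr q2)%C.
have xy : `|y - x| < ((e / 4)%:C)%C.
  case: x @y a1 a2 b1 b2 {eP} => u v /= a1 a2 b1 b2.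
  have -> : e / 4 = Num.sqrt ((e / 4) ^+ 2).
    by rewrite sqrtr_sqr gtr0_norm //; lra.
  rewrite normc_def /= ltcR ltr_sqrt; nra.
exists (B (q1, q2, r)); rewrite /B /=.
  split; first by exists (q1, q2, r).
  rewrite -ball_normE /ball_ /= (lt_trans xy)// ltcR; lra.
move=> z; rewrite -ball_normE /ball_ /= => yz; apply: eP.
rewrite -ball_normE /ball_ /=.
have -> : x - z = (y - z) - (y - x) by rewrite opprB [RHS]addrC addrA subrK.
apply: (le_lt_trans (ler_normB _ _)).
apply: (lt_trans (ltrD yz xy)).
rewrite -(rmorphD (real_complex R)) ltcR; lra.
Qed.

Lemma line_hausdorff : hausdorff_space R[i]^o.
Proof. exact: norm_hausdorff. Qed.

Lemma line_atlas_cover (x : R[i]^o) : exists2 c, [set line_chart] c & chart_dom c x.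
Proof. by exists line_chart. Qed.

Lemma line_atlas_holomorphic (c d : chart R[i]^o R[i]^o) (x : R[i]^o) :
  [set line_chart] c -> [set line_chart] d -> chart_dom c x -> chart_dom d x ->
  differentiable (chart_map d \o chart_inv c) (chart_map c x).
Proof. by move=> -> -> _ _; exact: ex_diff. Qed.

Definition complex_line : complex_manifold R[i]^o :=
  ComplexManifold line_hausdorff line_second_countable
    line_atlas_cover line_atlas_holomorphic.

Definition unit_disc : set complex_line := [set z : R[i] | `|z| < 1].

End ComplexLine.

(* Connected, and every loop is homotopic to a constant loop relative to its
   base point. *)
Definition simply_connected (R : realType) (T : topologicalType) :=
  connected [set: T] /\
  forall gamma : R -> T, {within `[0, 1], continuous gamma} ->
    gamma 0 = gamma 1 ->
    exists H : R * R -> T,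
      [/\ {within `[0, 1] `*` `[0, 1], continuous H},
          forall t, t \in `[0, 1] ->
            H (0, t) = gamma t /\ H (1, t) = gamma 0 &
          forall s, s \in `[0, 1] ->
            H (s, 0) = gamma 0 /\ H (s, 1) = gamma 0].

Section LineBundles.
Variables (R : realType) (E : normedModType R[i]) (X : complex_manifold E).

(* [vec x] is the inclusion of the vector space [F x] in the total space, so
   that [snd \o psi \o vec x] is [psi] restricted to the fiber over [x]. *)
Definition trivialization_on (Y : complex_manifold (E * R[i]^o)%type)
    (p : Y -> X) (F : X -> lmodType R[i]) (vec : forall x, F x -> Y)
    (V : set X) (psi : Y -> prod_manifold X (complex_line R)) :=
  [/\ biholomorphism (p @^-1` V)
        (V `*` setT : set (prod_manifold X (complex_line R))) psi,
      forall u, V (p u) -> (psi u).1 = p u &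
      forall x, V x -> linear (fun v : F x => (psi (vec x v)).2 : R[i]^o)].

(* The fibers [fiber L x] are vector spaces identified by [vec] with the fibers
   of [bundle_proj]; local triviality forces them to have dimension 1. *)
Record line_bundle := LineBundle {
  total_space : complex_manifold (E * R[i]^o)%type;
  bundle_proj : total_space -> X;
  fiber : X -> lmodType R[i];
  vec : forall x, fiber x -> total_space;
  vec_inj : forall x, injective (@vec x);
  vec_range : forall x, range (@vec x) = bundle_proj @^-1` [set x];
  locally_trivial : forall x, exists2 V, open_nbhs x V &
    exists psi, trivialization_on bundle_proj vec V psi }.

Definition trivial_bundle (L : line_bundle) :=
  exists psi, trivialization_on (@bundle_proj L) (@vec L) setT psi.

End LineBundles.

Arguments total_space {R E X} l.
Arguments bundle_proj {R E X} l _.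
Arguments fiber {R E X} l x.
Arguments vec {R E X} l x v.

(* [Y] and [F] are open subsets of [M] and [N], and the map considered is the
   restriction of [p] to [Y].  The notion is meant for a surjective holomorphic
   submersion with fibers biholomorphic to [F]; these prerequisites are not part
   of the condition. *)
Definition holomorphically_locally_trivial (R : realType)
    (E0 E1 E2 : normedModType R[i]) (X : complex_manifold E0)
    (M : complex_manifold E1) (N : complex_manifold E2)
    (F : set N) (Y : set M) (p : M -> X) :=
  forall x : X, exists2 V, open_nbhs x V &
    exists2 phi : M -> prod_manifold N X,
      biholomorphism (Y `&` p @^-1` V)
        (F `*` V : set (prod_manifold N X)) phi &
      forall y, Y y -> V (p y) -> (phi y).2 = p y.

(* Main.v *)
Require Import Defs.
From HB Require Import structures.
From mathcomp Require Import all_boot all_order all_algebra.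
From mathcomp Require Import complex ring lra.
From mathcomp Require Import all_classical all_reals all_analysis.

(** Suppose that [U] is holomorphically locally trivial with the disc as fiber.
    The local trivializations differ by holomorphic families of automorphisms of
    the disc, and such families are locally constant: [U] is a flat disc bundle.
    Since [X] is simply connected, the bundle is trivial, that is, there is a
    holomorphic function [F] on [U] that maps each fiber of [U] biholomorphically
    onto the disc.  The derivative of [F] along the fibers at the zero section is
    then a linear form on each fiber of the line bundle, it is not zero because
    [F] is biholomorphic on the fiber, and it depends holomorphically on the base
    point.  So it trivializes the line bundle, which is a contradiction.

    Local constancy ([automorphism_family_constant]) reduces to this: if
    [th (t, _)] are self-maps of the disc, holomorphic in all variables, with
    [th (0, _)] the identity, then the derivative in [t] vanishes at [0].  Indeed
    the [N]-fold iterates of these maps form another such family, with [N] times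
    the derivative, and Cauchy's estimate bounds it independently of [N].

    The triviality of the flat bundle is a monodromy theorem, stated for abstract
    local sections with unique continuation ([monodromy]): a contraction of a
    loop is lifted to the square by bisection.  That the derivative along the
    fibers is holomorphic ([fiber_derivative_differentiable]) follows from
    Weierstrass' theorem on uniform limits, applied to difference quotients.

    Holomorphy means differentiability at every point, so the estimates of
    one-variable theory are derived from Goursat's lemma.  No integral is needed
    for them: the trapezoid sums [seg] are additive under bisection and exact on
    affine functions, so that Goursat's bisection argument applies to them.  This
    gives Cauchy's formula up to a constant ([cauchy_crude]), and raising
    functions to powers removes the constant ([cauchy_max]).  The maximum
    principle for difference quotients then yields the Lipschitz and Taylor
    estimates ([cauchy_lipschitz], [cauchy_taylor]).

    Finally, a trivialization of the line bundle over an open set [V] is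
    holomorphic on the preimage of [V] in a sense that does not include the
    openness of this preimage.  Openness holds because an injective holomorphic
    map with a local holomorphic left inverse is open when the dimensions agree
    ([left_inverse_near]). *)

Set Implicit Arguments.
Unset Strict Implicit.
Unset Printing Implicit Defensive.

Import Order.TTheory GRing.Theory Num.Theory numFieldNormedType.Exports.

Local Open Scope classical_set_scope.
Local Open Scope ring_scope.

(** * Real-valued norms over the complex numbers *)

Section Nm.
Variable R : realType.
Implicit Types V W : normedModType R[i].

(** The library norm of a module over [R[i]] takes its values in [R[i]]; its
    real part is the norm as a real number, to which [lra] and [nra] apply. *)
Definition nm V (x : V) : R := complex.Re `|x|.

Lemma nmE V (x : V) : `|x| = ((nm x)%:C)%C.
Proof. by rewrite /nm RRe_real // normr_real. Qed.

Lemma nm_ge0 V (x : V) : 0 <= nm x.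
Proof. by rewrite -lecR -nmE normr_ge0. Qed.

Lemma nm0 V : nm (0 : V) = 0.
Proof. by rewrite /nm normr0. Qed.

Lemma nm_le0 V (x : V) : nm x <= 0 -> x = 0.
Proof. by rewrite -lecR -nmE normr_le0 => /eqP. Qed.

Lemma nm_gt0 V (x : V) : x != 0 -> 0 < nm x.
Proof. by move=> x0; rewrite ltNge; apply/negP => /nm_le0 /eqP; exact/negP. Qed.

Lemma nmN V (x : V) : nm (- x) = nm x.
Proof. by rewrite /nm normrN. Qed.

Lemma nmBC V (x y : V) : nm (x - y) = nm (y - x).
Proof. by rewrite /nm distrC. Qed.

Lemma nmD V (x y : V) : nm (x + y) <= nm x + nm y.
Proof.
by rewrite -lecR (rmorphD (real_complex R)) /= -!nmE ler_normD.
Qed.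

Lemma nmB V (x y : V) : nm (x - y) <= nm x + nm y.
Proof. by rewrite -(nmN y) nmD. Qed.

Lemma nmZ V (k : R[i]^o) (x : V) : nm (k *: x) = nm k * nm x.
Proof.
by apply: complexI; rewrite (rmorphM (real_complex R)) /= -!nmE normrZ.
Qed.

Lemma nmM (x y : R[i]^o) : nm (x * y : R[i]^o) = nm x * nm y.
Proof. exact: (nmZ x y). Qed.

Lemma nm1 : nm (1 : R[i]^o) = 1.
Proof. by rewrite /nm normr1. Qed.

Lemma nmX (x : R[i]^o) n : nm (x ^+ n : R[i]^o) = nm x ^+ n.
Proof. by elim: n => [|n IH]; rewrite ?expr0 ?nm1 // !exprS nmM IH. Qed.

Lemma nmV (x : R[i]^o) : nm (x^-1 : R[i]^o) = (nm x)^-1.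
Proof.
by apply: complexI; rewrite (fmorphV (real_complex R)) /= -!nmE normfV.
Qed.

Lemma nmR (x : R) : nm ((x%:C)%C : R[i]^o) = `|x|.
Proof. by rewrite /nm normc_def /= expr0n addr0 sqrtr_sqr. Qed.

Lemma nmC (x : R[i]^o) :
  nm x ^+ 2 = complex.Re x ^+ 2 + complex.Im x ^+ 2.
Proof.
rewrite /nm normc_def /= sqr_sqrtr // addr_ge0 ?sqr_ge0 //.
Qed.

Lemma Re_le_nm (x : R[i]^o) : `|complex.Re x| <= nm x.
Proof.
rewrite -(ler_pXn2r (ltn0Sn 1)) ?nnegrE ?nm_ge0 // nmC real_normK ?num_real //.
by rewrite lerDl sqr_ge0.
Qed.

Lemma Im_le_nm (x : R[i]^o) : `|complex.Im x| <= nm x.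
Proof.
rewrite -(ler_pXn2r (ltn0Sn 1)) ?nnegrE ?nm_ge0 // nmC real_normK ?num_real //.
by rewrite lerDr sqr_ge0.
Qed.

Lemma nm_le (x : R[i]^o) : nm x <= `|complex.Re x| + `|complex.Im x|.
Proof.
rewrite -(ler_pXn2r (ltn0Sn 1)) ?nnegrE ?nm_ge0 ?addr_ge0 // nmC.
have := normr_ge0 (complex.Re x); have := normr_ge0 (complex.Im x).
rewrite -(real_normK (num_real (complex.Re x))).
rewrite -(real_normK (num_real (complex.Im x))); nra.
Qed.

Lemma nbhs_nm V (x : V) (A : set V) :
  nbhs x A <-> exists2 d : R, 0 < d & forall y, nm (y - x) < d -> A y.
Proof.
split=> [/nbhs_normP[e /= e0 eA]|[d d0 dA]].
  move: e0; case: e eA => a b eA; rewrite ltcE /= => /andP[/eqP b0 a0].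
  exists a => // y xy; apply: eA; rewrite /ball_ /= distrC nmE b0.
  by rewrite ltcR.
apply/nbhs_normP; exists ((d%:C)%C); first by rewrite /= ltcR.
by move=> y; rewrite /ball_ /= distrC nmE ltcR; exact: dA.
Qed.

Lemma near_ball V (x : V) (d : R) : 0 < d -> \forall y \near x, nm (y - x) < d.
Proof. by move=> d0; apply/nbhs_nm; exists d. Qed.

Lemma continuous_nm V W (f : V -> W) (x : V) :
  {for x, continuous f} <->
  forall e : R, 0 < e -> exists2 d : R, 0 < d &
    forall y, nm (y - x) < d -> nm (f y - f x) < e.
Proof.
split=> [cf e e0|H].
  by have /nbhs_nm := cf _ (near_ball (f x) e0).
move=> A /nbhs_nm [e e0 eA]; have [d d0 dH] := H e e0.
by apply/(@nbhs_nm _ x (f @^-1` A)); exists d => // y /dH /eA.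
Qed.

Lemma differentiable_nm V W (f : V -> W) (x : V) : differentiable f x ->
  forall e : R, 0 < e -> exists2 d : R, 0 < d & forall y, nm (y - x) < d ->
    nm (f y - f x - 'd f x (y - x)) <= e * nm (y - x).
Proof.
move=> /diff_locallyP [_ /eqaddoP H] e e0.
have e1 : 0 < (e%:C)%C :> R[i] by rewrite ltcR.
have /nbhs_nm [d d0 dH] := H _ e1; exists d => // y yx.
have := dH (y - x); rewrite subr0 => /(_ yx).
rewrite !fctE /= subrK !nmE -(rmorphM (real_complex R)) lecR.
by rewrite opprD addrA.
Qed.

Lemma nm_differentiable V W (f : V -> W) (x : V) (L : {linear V -> W}) :
  continuous L ->
  (forall e : R, 0 < e -> exists2 d : R, 0 < d & forall y, nm (y - x) < d ->
    nm (f y - f x - L (y - x)) <= e * nm (y - x)) ->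
  differentiable f x /\ 'd f x = L :> (V -> W).
Proof.
move=> cL H.
have E : f \o shift x = cst (f x) + L +o_ 0 id.
  apply/eqaddoP => e; case: e => a b; rewrite ltcE /= => /andP[/eqP -> a0].
  have [d d0 dH] := H a a0; apply/nbhs_nm; exists d => // h.
  rewrite subr0 => hd; have := dH (h + x); rewrite addrK => /(_ hd).
  rewrite !fctE /= !nmE -[Complex a 0]/((a%:C)%C).
  by rewrite -(rmorphM (real_complex R)) lecR opprD addrA.
have D := diff_unique cL E.
by split=> //; apply/diff_locallyP; rewrite D; split.
Qed.

Lemma near_diff V W (f g : V -> W) (x : V) :
  (\forall y \near x, f y = g y) -> differentiable f x ->
  differentiable g x /\ 'd g x = 'd f x :> (V -> W).
Proof.
move=> /[dup] /nbhs_singleton fgx /nbhs_nm [d1 d10 fg] df.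
apply: (nm_differentiable (diff_continuous df)) => e e0.
have [d d0 dH] := differentiable_nm df e0.
exists (Num.min d d1); first by rewrite lt_min d0.
move=> y; rewrite lt_min => /andP[yd yd1].
by rewrite -(fg _ yd1) -fgx; exact: dH.
Qed.

Lemma near_differentiable V W (f g : V -> W) (x : V) :
  (\forall y \near x, f y = g y) -> differentiable f x -> differentiable g x.
Proof. by move=> fg df; case: (near_diff fg df). Qed.

End Nm.

(** * Bisection *)

Section Bisection.
Variable R : realType.

Lemma nested_intervals (x l : nat -> R) :
  (forall n, 0 <= l n) -> (forall n, x n <= x n.+1) ->
  (forall n, x n.+1 + l n.+1 <= x n + l n) ->
  exists a, forall n, x n <= a <= x n + l n.
Proof.
move=> l0 xS lS.
have xD n m : x n <= x (n + m)%N.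
  by elim: m => [|m IH]; rewrite ?addn0 // addnS (le_trans IH).
have lD n m : x (n + m)%N + l (n + m)%N <= x n + l n.
  by elim: m => [|m IH]; rewrite ?addn0 // addnS (le_trans _ IH).
have ub m : ubound (range x) (x m + l m).
  move=> _ [n _ <-]; rewrite (le_trans (xD n m)) // addnC.
  by rewrite (le_trans _ (lD m n)) // lerDl.
have ne : range x !=set0 by exists (x 0%N), 0%N.
exists (sup (range x)) => n; apply/andP; split.
  by apply: ub_le_sup; [exists (x 0%N + l 0%N); exact: ub|exists n].
exact: ge_sup.
Qed.

Lemma exists_halving (l d : R) : 0 < l -> 0 < d -> exists n, l / 2 ^+ n < d.
Proof.
move=> l0 d0; pose n := (Num.trunc (l / d)).+1; exists n.
rewrite ltr_pdivrMr ?exprn_gt0 // mulrC -ltr_pdivrMr //.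
apply: (@lt_trans _ _ n%:R).
  by have := truncn_itv (divr_ge0 (ltW l0) (ltW d0)) => /andP[].
by rewrite -natrX ltr_nat ltn_expl.
Qed.

(** If the property failed for the big square, it would fail for a nested
    sequence of squares shrinking to a point, where it holds locally. *)
Lemma square_bisection (P : R -> R -> R -> Prop) (x0 y0 l0 : R) :
  0 < l0 ->
  (forall x y l, 0 < l ->
     P x y (l / 2) -> P (x + l / 2) y (l / 2) ->
     P x (y + l / 2) (l / 2) -> P (x + l / 2) (y + l / 2) (l / 2) ->
     P x y l) ->
  (forall a b, x0 <= a <= x0 + l0 -> y0 <= b <= y0 + l0 ->
     exists2 d : R, 0 < d & forall x y l, 0 < l < d ->
       x <= a <= x + l -> y <= b <= y + l ->
       x0 <= x -> x + l <= x0 + l0 -> y0 <= y -> y + l <= y0 + l0 ->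
       P x y l) ->
  P x0 y0 l0.
Proof.
move=> l00 Psplit Ploc; apply: contrapT => nP0.
pose bad (s : R * R * R) := 0 < s.2 /\ ~ P s.1.1 s.1.2 s.2.
pose child (s t : R * R * R) := [/\ s.1.1 <= t.1.1 <= s.1.1 + s.2 / 2,
  s.1.2 <= t.1.2 <= s.1.2 + s.2 / 2 & t.2 = s.2 / 2].
have ex s : exists t, bad s -> bad t /\ child s t.
  case: (pselect (bad s)) => [|nb]; last by exists s.
  case: s => [[x y] l] [/= lp nP].
  have lp2 : 0 < l / 2 by rewrite divr_gt0.
  case: (pselect (P x y (l / 2))) => [P1|nP1]; last first.
    by exists (x, y, l / 2); split=> //; split=> //=; lra.
  case: (pselect (P (x + l / 2) y (l / 2))) => [P2|nP2]; last first.
    by exists (x + l / 2, y, l / 2); split=> //; split=> //=; lra.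
  case: (pselect (P x (y + l / 2) (l / 2))) => [P3|nP3]; last first.
    by exists (x, y + l / 2, l / 2); split=> //; split=> //=; lra.
  case: (pselect (P (x + l / 2) (y + l / 2) (l / 2))) => [P4|nP4]; last first.
    by exists (x + l / 2, y + l / 2, l / 2); split=> //; split=> //=; lra.
  by case: nP; exact: Psplit.
have [nxt nxtP] := choice ex.
pose s n := iter n nxt (x0, y0, l0).
have sbad n : bad (s n).
  by elim: n => [|n IH]; [split|rewrite /s iterS; case: (nxtP _ IH)].
have sch n : child (s n) (s n.+1).
  by rewrite /s iterS; case: (nxtP _ (sbad n)).
have sl n : (s n).2 = l0 / 2 ^+ n.
  elim: n => [|n IH]; first by rewrite expr0 divr1.
  by case: (sch n) => _ _ ->; rewrite IH exprSr invfM mulrA.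
have sl0 n : 0 <= (s n).2 by rewrite ltW //; case: (sbad n).
have [a aP] : exists a, forall n, (s n).1.1 <= a <= (s n).1.1 + (s n).2.
  apply: (@nested_intervals (fun n => (s n).1.1) (fun n => (s n).2)) => // n.
    by case: (sch n) => /andP[].
  by case: (sch n) => /andP[_ ?] _ ->; have := sl0 n; lra.
have [b bP] : exists a, forall n, (s n).1.2 <= a <= (s n).1.2 + (s n).2.
  apply: (@nested_intervals (fun n => (s n).1.2) (fun n => (s n).2)) => // n.
    by case: (sch n) => _ /andP[].
  by case: (sch n) => _ /andP[_ ?] ->; have := sl0 n; lra.
have sin n : [/\ x0 <= (s n).1.1, (s n).1.1 + (s n).2 <= x0 + l0,
    y0 <= (s n).1.2 & (s n).1.2 + (s n).2 <= y0 + l0].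
  elim: n => [|n [i1 i2 i3 i4]]; first by [].
  by case: (sch n) => c1 c2 ->; have := sl0 n; split; lra.
have [d d0 dP] := Ploc a b (aP 0%N) (bP 0%N).
have [n nd] := exists_halving l00 d0.
have [sn0 nPn] := sbad n; case: (sin n) => i1 i2 i3 i4.
by apply: nPn; apply: dP => //; rewrite sn0 sl.
Qed.

Lemma interval_bisection (P : R -> R -> Prop) (a0 b0 : R) :
  a0 < b0 ->
  (forall a b, a < b -> P a ((a + b) / 2) -> P ((a + b) / 2) b -> P a b) ->
  (forall t, a0 <= t <= b0 ->
     exists2 d : R, 0 < d & forall a b, a < b -> b - a < d ->
       a <= t <= b -> a0 <= a -> b <= b0 -> P a b) ->
  P a0 b0.
Proof.
move=> ab Psplit Ploc.
have -> : b0 = a0 + (b0 - a0) by rewrite addrC subrK.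
apply: (@square_bisection (fun x _ l => P x (x + l)) a0 0 (b0 - a0)).
- by rewrite subr_gt0.
- move=> x y l l0 P1 P2 P3 P4; apply: Psplit; first by rewrite ltrDl.
    by have -> : (x + (x + l)) / 2 = x + l / 2 by lra.
  have <- : x + l / 2 + l / 2 = x + l by lra.
  by have -> : (x + (x + l / 2 + l / 2)) / 2 = x + l / 2 by lra.
- move=> a b ta _; have [|d d0 dP] := Ploc a; first by lra.
  by exists d => // x y l ld tx ty ? ? ? ?; apply: dP; lra.
Qed.

End Bisection.

(** * Trapezoid sums over segments and squares *)

Section Goursat.
Variable R : realType.
Local Notation K := (R[i]^o).
Implicit Types (g h : K -> K) (a b c z w : K).

(** The trapezoid rule for the integral of [g] from [a] to [b], with [2 ^ n]
    subintervals.  It is additive under bisection by construction and exact on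
    affine functions, which is all that Goursat's argument uses of an
    integral. *)
Fixpoint seg g (n : nat) a b : K :=
  if n is n'.+1 then seg g n' a ((a + b) / 2) + seg g n' ((a + b) / 2) b
  else (g a + g b) / 2 * (b - a).

Definition mid_closed (S : set K) := forall a b, S a -> S b -> S ((a + b) / 2).

Lemma seg_rev g n a b : seg g n b a = - seg g n a b.
Proof.
elim: n a b => [|n IH] a b /=; first by field.
by rewrite (addrC b) IH (IH a) opprD [LHS]addrC.
Qed.

Lemma seg_ext (S : set K) g h n a b : mid_closed S -> S a -> S b ->
  (forall z, S z -> g z = h z) -> seg g n a b = seg h n a b.
Proof.
move=> Sm Sa Sb gh; elim: n a b Sa Sb => [|n IH] a b Sa Sb /=.
  by rewrite !gh.
by rewrite !IH //; exact: Sm.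
Qed.

Lemma segBZ g h (k : K) n a b :
  seg (fun z => g z - k * h z) n a b = seg g n a b - k * seg h n a b.
Proof.
elim: n a b => [|n IH] a b /=; first by field.
by rewrite !IH; ring.
Qed.

Lemma seg_affine (c m : K) n a b :
  seg (fun z => c + m * z) n a b = c * (b - a) + m * (b ^+ 2 - a ^+ 2) / 2.
Proof.
elim: n a b => [|n IH] a b /=; first by field.
by rewrite !IH; field.
Qed.

Lemma nm_half (z : K) : nm (z / 2 : K) = nm z / 2.
Proof.
rewrite nmM nmV; congr (_ / _).
by rewrite -(normr_nat R 2) -nmR (rmorph_nat (real_complex R)).
Qed.

Lemma seg_bound (S : set K) g (M : R) n a b : mid_closed S -> S a -> S b ->
  (forall z, S z -> nm (g z) <= M) -> nm (seg g n a b) <= M * nm (b - a).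
Proof.
move=> Sm Sa Sb gM; elim: n a b Sa Sb => [|n IH] a b Sa Sb /=.
  rewrite nmM ler_wpM2r ?nm_ge0 // nm_half.
  have := nmD (g a) (g b); have := gM a Sa; have := gM b Sb; lra.
have Sc := Sm _ _ Sa Sb.
apply: (le_trans (nmD _ _)).
apply: (le_trans (lerD (IH _ _ Sa Sc) (IH _ _ Sc Sb))).
have -> : (a + b) / 2 - a = (b - a) / 2 by field.
have -> : b - (a + b) / 2 = (b - a) / 2 by field.
by rewrite nm_half; lra.
Qed.

(** [u] is the direction of the segment and [t] its length; the lemma bounds
    the sum of [1 / (z - w)] around [w] away from [0]. *)
Lemma seg_Im_ge (S : set K) g (k : R) (u : K) n a b (t : R) :
  mid_closed S -> S a -> S b -> b - a = (t%:C)%C * u -> 0 <= t ->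
  (forall z, S z -> k <= complex.Im (g z * u)) ->
  k * t <= complex.Im (seg g n a b).
Proof.
move=> Sm Sa Sb E t0 gk; elim: n a b t Sa Sb E t0 => [|n IH] a b t Sa Sb E t0 /=.
  rewrite E.
  have -> : (g a + g b) / 2 * ((t%:C)%C * u) =
            ((t / 2)%:C)%C * (g a * u + g b * u).
    by rewrite (rmorphM (real_complex R)) fmorphV rmorph_nat /=; field.
  have := gk a Sa; have := gk b Sb.
  case: (g a * u) => p q; case: (g b * u) => r s /=.
  by rewrite mul0r addr0; nra.
have Sc := Sm _ _ Sa Sb.
have E2 : ((t / 2)%:C)%C * u = (b - a) / 2 :> K.
  by rewrite E (rmorphM (real_complex R)) fmorphV rmorph_nat /=; field.
have E3 : (a + b) / 2 - a = ((t / 2)%:C)%C * u by rewrite E2; field.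
have E4 : b - (a + b) / 2 = ((t / 2)%:C)%C * u by rewrite E2; field.
have t2 : 0 <= t / 2 by rewrite divr_ge0.
have := IH _ _ _ Sa Sc E3 t2; have := IH _ _ _ Sc Sb E4 t2.
case: (seg g n a _) => p q; case: (seg g n _ b) => r s /=; lra.
Qed.

Definition cc (x y : R) : K := (x +i* y)%C.

Lemma mid_cc x y x' y' : (cc x y + cc x' y') / 2 = cc ((x + x') / 2) ((y + y') / 2).
Proof.
have E (p q : K) : p = q + q -> p / 2 = q by move=> ->; field.
by apply: E; rewrite /cc; simpc; congr (_ +i* _)%C; lra.
Qed.

Lemma ReB (z w : K) : complex.Re (z - w) = complex.Re z - complex.Re w.
Proof. by case: z w => [? ?] [? ?]. Qed.

Lemma ImB (z w : K) : complex.Im (z - w) = complex.Im z - complex.Im w.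
Proof. by case: z w => [? ?] [? ?]. Qed.

Lemma Re_mid a b :
  complex.Re ((a + b) / 2 : K) = (complex.Re a + complex.Re b) / 2.
Proof. by case: a b => [x y] [x' y']; rewrite -/(cc x y) -/(cc x' y') mid_cc. Qed.

Lemma Im_mid a b :
  complex.Im ((a + b) / 2 : K) = (complex.Im a + complex.Im b) / 2.
Proof. by case: a b => [x y] [x' y']; rewrite -/(cc x y) -/(cc x' y') mid_cc. Qed.

Definition rect (x x' y y' : R) : set K :=
  [set z | x <= complex.Re z <= x' /\ y <= complex.Im z <= y'].

Lemma rect_mid_closed x x' y y' : mid_closed (rect x x' y y').
Proof.
move=> a b [a1 a2] [b1 b2]; rewrite /rect /= Re_mid Im_mid; split; lra.
Qed.

Definition bd g n x y l : K :=
  seg g n (cc x y) (cc (x + l) y) + seg g n (cc (x + l) y) (cc (x + l) (y + l))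
  + seg g n (cc (x + l) (y + l)) (cc x (y + l)) + seg g n (cc x (y + l)) (cc x y).

Lemma bd_split g n x y l :
  bd g n.+1 x y l = bd g n x y (l / 2) + bd g n (x + l / 2) y (l / 2) +
    bd g n x (y + l / 2) (l / 2) + bd g n (x + l / 2) (y + l / 2) (l / 2).
Proof.
have E1 (t : R) : (t + t) / 2 = t by lra.
have E2 (t : R) : (t + (t + l)) / 2 = t + l / 2 by lra.
have E3 (t : R) : (t + l + t) / 2 = t + l / 2 by lra.
have E4 (t : R) : t + l / 2 + l / 2 = t + l by lra.
rewrite /bd /= !mid_cc !E1 !E2 !E3 !E4.
rewrite (seg_rev g n (cc (x + l / 2) y) (cc (x + l / 2) (y + l / 2))).
rewrite (seg_rev g n (cc x (y + l / 2)) (cc (x + l / 2) (y + l / 2))).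
rewrite (seg_rev g n (cc (x + l / 2) (y + l / 2)) (cc (x + l / 2) (y + l))).
rewrite (seg_rev g n (cc (x + l / 2) (y + l / 2)) (cc (x + l) (y + l / 2))).
by ring.
Qed.

Lemma bd_corners x y l : 0 <= l ->
  [/\ rect x (x + l) y (y + l) (cc x y),
      rect x (x + l) y (y + l) (cc (x + l) y),
      rect x (x + l) y (y + l) (cc (x + l) (y + l)) &
      rect x (x + l) y (y + l) (cc x (y + l))].
Proof. by move=> l0; rewrite /rect /=; split; split; lra. Qed.

Lemma bdBZ g h (k : K) n x y l :
  bd (fun z => g z - k * h z) n x y l = bd g n x y l - k * bd h n x y l.
Proof. by rewrite /bd !segBZ; ring. Qed.

Lemma nm_side x y x' y' : nm (cc x' y' - cc x y) <= `|x' - x| + `|y' - y|.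
Proof. exact: nm_le. Qed.

(** Affine functions have zero sum, so only the distance of [g] to an affine
    function counts. *)
Lemma bd_affine_bound g (p m : K) (M : R) n x y l : 0 <= l ->
  (forall w, rect x (x + l) y (y + l) w -> nm (g w - (p + m * w)) <= M) ->
  nm (bd g n x y l) <= 4 * l * M.
Proof.
move=> l0 gM.
have -> : bd g n x y l = bd (fun w => g w - 1 * (p + m * w)) n x y l.
  by rewrite bdBZ /bd !seg_affine; field.
have gM' w : rect x (x + l) y (y + l) w -> nm (g w - 1 * (p + m * w)) <= M.
  by rewrite mul1r; exact: gM.
case: (bd_corners x y l0) => c1 c2 c3 c4.
have M0 : 0 <= M by apply: le_trans (gM _ c1); exact: nm_ge0.
have S := @rect_mid_closed x (x + l) y (y + l).
have B a b : rect x (x + l) y (y + l) a -> rect x (x + l) y (y + l) b ->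
    nm (b - a) <= l -> nm (seg (fun w => g w - 1 * (p + m * w)) n a b) <= M * l.
  move=> Sa Sb ab; apply: (le_trans (seg_bound n S Sa Sb gM')).
  by rewrite ler_wpM2l.
have d1 t : `|t + l - t| = l by rewrite (addrC t) addrK ger0_norm.
have d2 t : `|t - (t + l)| = l by rewrite distrC d1.
have d0 (t : R) : `|t - t| = 0 by rewrite subrr normr0.
have s1 := B _ _ c1 c2 (le_trans (nm_side _ _ _ _) _).
have s2 := B _ _ c2 c3 (le_trans (nm_side _ _ _ _) _).
have s3 := B _ _ c3 c4 (le_trans (nm_side _ _ _ _) _).
have s4 := B _ _ c4 c1 (le_trans (nm_side _ _ _ _) _).
have {}s1 := s1 ltac:(rewrite ?d1 ?d2 ?d0; lra).
have {}s2 := s2 ltac:(rewrite ?d1 ?d2 ?d0; lra).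
have {}s3 := s3 ltac:(rewrite ?d1 ?d2 ?d0; lra).
have {}s4 := s4 ltac:(rewrite ?d1 ?d2 ?d0; lra).
rewrite /bd; set A1 := seg _ _ _ _; set A2 := seg _ _ _ _.
set A3 := seg _ _ _ _; set A4 := seg _ _ _ _.
have := nmD (A1 + A2 + A3) A4; have := nmD (A1 + A2) A3; have := nmD A1 A2.
move: s1 s2 s3 s4; rewrite -/A1 -/A2 -/A3 -/A4; lra.
Qed.

End Goursat.

(** * Goursat's lemma and the estimates it gives *)

Section Cauchy.
Variable R : realType.
Local Notation K := (R[i]^o).
Implicit Types (f g : K -> K) (z w p : K).

(** An odd increasing function with infinite slope at [0].  The product of its
    increments along the two sides of a square is additive under bisection and
    is at least the side length when the square contains the origin: it weighs
    the error made in Goursat's argument around a point where the function is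
    only continuous. *)
Definition rt (t : R) := Num.sqrt t - Num.sqrt (- t).

Lemma rt_homo (s t : R) : s <= t -> rt s <= rt t.
Proof. by move=> st; rewrite /rt lerB // ler_wsqrtr // lerN2. Qed.

Lemma rt_gap (s l : R) : 0 <= l -> s <= 0 <= s + l ->
  Num.sqrt l <= rt (s + l) - rt s.
Proof.
move=> l0 /andP[s0 sl0]; rewrite /rt.
rewrite (ler0_sqrtr s0) (@ler0_sqrtr _ (- (s + l))) ?oppr_le0 //.
rewrite subr0 sub0r opprK.
rewrite -(ler_pXn2r (ltn0Sn 1)) ?nnegrE ?addr_ge0 ?sqrtr_ge0 //.
rewrite sqr_sqrtr // sqrrD !sqr_sqrtr ?oppr_ge0 //.
have := sqrtr_ge0 (s + l); have := sqrtr_ge0 (- s); nra.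
Qed.

Lemma nm_cc_le x x' y y' (l : R) z w : x' = x + l -> y' = y + l ->
  rect x x' y y' z -> rect x x' y y' w -> nm (w - z) <= 2 * l.
Proof.
move=> -> -> [z1 z2] [w1 w2]; apply: (le_trans (nm_le _)).
rewrite ReB ImB.
have : `|complex.Re w - complex.Re z| <= l by rewrite ler_norml; lra.
have : `|complex.Im w - complex.Im z| <= l by rewrite ler_norml; lra.
lra.
Qed.

(** On a small square of side [l] around a point of differentiability the affine
    part of [g] sums to zero and the rest is [o(l ^ 2)], an error that bisection
    adds up to at most [e] times the area.  Around [p] the error is only [o(l)];
    the weight [mu] makes up for it. *)
Lemma goursat g x0 y0 (l0 : R) p : 0 < l0 ->
  (forall z, rect x0 (x0 + l0) y0 (y0 + l0) z -> z != p ->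
     differentiable g z) ->
  {for p, continuous g} ->
  forall e : R, 0 < e ->
  exists N, forall n, (N <= n)%N -> nm (bd g n x0 y0 l0) <= e.
Proof.
move=> l00 dg /continuous_nm cg e' e'0.
pose mu x y l := (rt (x + l - complex.Re p) - rt (x - complex.Re p)) *
  (rt (y + l - complex.Im p) - rt (y - complex.Im p)).
have mu0 x y l : 0 <= l -> 0 <= mu x y l.
  by move=> lp; rewrite mulr_ge0 // subr_ge0 rt_homo // lerB // lerDl.
pose W := l0 ^+ 2 + mu x0 y0 l0.
have W0 : 0 < W by have := mu0 x0 y0 l0 (ltW l00); rewrite /W; nra.
pose e := e' / W; have e0 : 0 < e by rewrite divr_gt0.
have -> : e' = e * (l0 ^+ 2 + mu x0 y0 l0) by rewrite /e -/W divfK // gt_eqF.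
apply: (@square_bisection _ (fun x y l => exists N, forall n, (N <= n)%N ->
  nm (bd g n x y l) <= e * (l ^+ 2 + mu x y l))) => //.
  move=> x y l lp [N1 P1] [N2 P2] [N3 P3] [N4 P4].
  exists (maxn (maxn N1 N2) (maxn N3 N4)).+1 => -[//|n].
  rewrite ltnS !geq_max => /andP[/andP[n1 n2] /andP[n3 n4]].
  rewrite bd_split.
  set A1 := bd _ _ _ _ _; set A2 := bd _ _ _ _ _.
  set A3 := bd _ _ _ _ _; set A4 := bd _ _ _ _ _.
  have := nmD (A1 + A2 + A3) A4; have := nmD (A1 + A2) A3; have := nmD A1 A2.
  have := P1 _ n1; have := P2 _ n2; have := P3 _ n3; have := P4 _ n4.
  rewrite -/A1 -/A2 -/A3 -/A4.
  suff -> : mu x y l = mu x y (l / 2) + mu (x + l / 2) y (l / 2) +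
      mu x (y + l / 2) (l / 2) + mu (x + l / 2) (y + l / 2) (l / 2).
    by nra.
  rewrite /mu.
  have E4 (t : R) : t + l / 2 + l / 2 = t + l by lra.
  by rewrite !E4; ring.
move=> a b ab1 ab2.
have rab : rect x0 (x0 + l0) y0 (y0 + l0) (cc a b) by [].
have [abp|abp] := eqVneq (cc a b) p.
  have e4 : 0 < e / 4 by rewrite divr_gt0.
  have [d d0 dH] := cg _ e4; exists (d / 2); first by rewrite divr_gt0.
  move=> x y l /andP[lp ld] ax by' _ _ _ _; exists 0%N => n _.
  have rp : rect x (x + l) y (y + l) p by rewrite -abp.
  apply: (le_trans (@bd_affine_bound _ g (g p) 0 (e / 4) n x y l (ltW lp) _)).
    move=> w rw; rewrite mul0r addr0 ltW //; apply: dH.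
    by apply: (le_lt_trans (nm_cc_le erefl erefl rp rw)); lra.
  have mul : l <= mu x y l.
    have lE : l = Num.sqrt l * Num.sqrt l by rewrite -expr2 sqr_sqrtr // ltW.
    rewrite [leLHS]lE /mu ler_pM ?sqrtr_ge0 //.
      have -> : x + l - complex.Re p = x - complex.Re p + l by lra.
      by apply: rt_gap; [exact: ltW|rewrite -abp /=; lra].
    have -> : y + l - complex.Im p = y - complex.Im p + l by lra.
    by apply: rt_gap; [exact: ltW|rewrite -abp /=; lra].
  by have := sqr_ge0 l; nra.
have e8 : 0 < e / 8 by rewrite divr_gt0.
have [d d0 dH] := differentiable_nm (dg _ rab abp) e8.
exists (d / 2); first by rewrite divr_gt0.
move=> x y l /andP[lp ld] ax by' _ _ _ _; exists 0%N => n _.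
have rp : rect x (x + l) y (y + l) (cc a b) by [].
pose m := 'd g (cc a b) 1.
apply: (le_trans (@bd_affine_bound _ g (g (cc a b) - m * cc a b) m
    (e / 8 * (2 * l)) n x y l (ltW lp) _)).
  move=> w rw.
  have wl := nm_cc_le erefl erefl rp rw.
  have := dH w (le_lt_trans wl _) => /(_ ltac:(lra)) H.
  apply: (@le_trans _ _ (e / 8 * nm (w - cc a b))); last by rewrite ler_wpM2l // ltW.
  apply: le_trans H; rewrite le_eqVlt; apply/orP; left; apply/eqP; congr nm.
  have -> : 'd g (cc a b) (w - cc a b) = (w - cc a b) * m.
    by rewrite -[X in 'd g _ X]mulr1 -[X in 'd g _ X]/((w - cc a b) *: (1 : K)) linearZ.
  by ring.
by have := mu0 x y l (ltW lp); nra.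
Qed.

Lemma cderiv_differentiable f p (a : K) :
  (forall e : R, 0 < e -> exists2 d : R, 0 < d & forall y, nm (y - p) < d ->
    nm (f y - f p - a * (y - p) : K) <= e * nm (y - p)) ->
  differentiable f p /\ 'd f p (1 : K) = a.
Proof.
move=> H; pose L : {linear K -> K} := *:%R a.
have cL : continuous L.
  have D := is_diff_scaler a (0 : K).
  have -> : (L : K -> K) = 'd ( *:%R a : K -> K) (0 : K) by rewrite diff_val.
  exact: (diff_continuous (ex_diff (is_diff_def := D))).
have [df ->] := nm_differentiable cL H; split=> //.
exact: mulr1.
Qed.

Lemma diffE1 f p (h : K) : 'd f p h = h * 'd f p (1 : K).
Proof. by rewrite -[in LHS](mulr1 h) -[h * 1]/(h *: (1 : K)) linearZ. Qed.

Definition slope f p z : K :=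
  if z == p then 'd f p (1 : K) else (f z - f p) / (z - p).

Lemma slopeM f p z : slope f p z * (z - p) = f z - f p.
Proof.
rewrite /slope; case: eqVneq => [->|zp]; first by rewrite !subrr mulr0.
by rewrite divfK // subr_eq0.
Qed.

Lemma slope_continuous f p : differentiable f p ->
  {for p, continuous (slope f p)}.
Proof.
move=> df; apply/continuous_nm => e e0.
have e2 : 0 < e / 2 by rewrite divr_gt0.
have [d d0 dH] := differentiable_nm df e2; exists d => // y yd.
have [->|yp] := eqVneq y p; first by rewrite subrr nm0.
have yp0 : 0 < nm (y - p) by rewrite nm_gt0 // subr_eq0.
have := dH y yd; rewrite -slopeM diffE1 mulrC -mulrBr nmM mulrC.
have sp : slope f p p = 'd f p (1 : K) by rewrite /slope eqxx.
by rewrite ler_pM2r // sp => H; lra.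
Qed.

Lemma differentiable_sub (p z : K) : differentiable (fun z : K => z - p) z.
Proof. by apply: differentiableB => //; exact: ex_diff. Qed.

Lemma slope_differentiable f p z : z != p -> differentiable f z ->
  differentiable (slope f p) z.
Proof.
move=> zp df.
apply: (@near_differentiable _ _ _ (fun z : K => (f z - f p) * (z - p)^-1)).
  have zp0 : 0 < nm (z - p) by rewrite nm_gt0 // subr_eq0.
  apply/nbhs_nm; exists (nm (z - p)) => // y yz; rewrite /slope.
  by case: eqVneq yz => // ->; rewrite nmBC ltxx.
have d1 : differentiable (fun z : K => f z - f p) z.
  by apply: differentiableB => //; exact: ex_diff.
apply: (@differentiableM _ _ (fun z : K => f z - f p)
  (fun z : K => (z - p)^-1)) => //.
apply: (@differentiableV _ _ (fun z : K => z - p)).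
  exact: differentiable_sub.
by rewrite subr_eq0.
Qed.

Lemma Im_invM (v u : K) : complex.Im (v^-1 * u : K) =
  (complex.Re v * complex.Im u - complex.Im v * complex.Re u) /
  (complex.Re v ^+ 2 + complex.Im v ^+ 2).
Proof.
case: v u => a b [c d].
have -> : (a +i* b)%C^-1 = (a / (a ^+ 2 + b ^+ 2) +i* (- (b / (a ^+ 2 + b ^+ 2))))%C.
  by [].
by rewrite /=; ring.
Qed.

Definition edge x y (l : R) z := rect x (x + l) y (y + l) z /\
  [\/ complex.Re z = x, complex.Re z = x + l, complex.Im z = y |
      complex.Im z = y + l].

(** On a side, the sum of the slope splits into a part controlled by the values
    of [f] there and [f w] times the sum of [1 / (z - w)], whose imaginary part
    is positive because [w] lies to the left of the side. *)
Lemma edge_estimate f w (M d k l : R) (S : set K) (a b u : K) :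
  mid_closed S -> S a -> S b -> b - a = (l%:C)%C * u -> nm u = 1 -> 0 <= l ->
  0 < d -> (forall z, S z -> [/\ nm (f z) <= M, d <= nm (z - w) &
    k <= complex.Im ((z - w)^-1 * u)]) ->
  forall n, exists A J : K, [/\ seg (slope f w) n a b = A - f w * J,
    nm A <= M / d * l & k * l <= complex.Im J].
Proof.
move=> Sm Sa Sb ab u1 l0 d0 H n.
exists (seg (fun z => f z / (z - w)) n a b), (seg (fun z => (z - w)^-1) n a b).
have M0 : 0 <= M by have [] := H a Sa => ? _ _; apply: le_trans (nm_ge0 (f a)) _.
split.
- rewrite -segBZ; apply: (seg_ext n Sm) => // z Sz.
  have [_ dz _] := H z Sz; rewrite /slope.
  case: eqVneq dz => [->|_ _]; first by rewrite subrr nm0 leNgt d0.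
  by rewrite mulrBl.
- have -> : l = nm (b - a) by rewrite ab nmM u1 mulr1 nmR ger0_norm.
  apply: (seg_bound n Sm) => // z Sz; have [fM dz _] := H z Sz.
  rewrite nmM nmV ler_pM ?nm_ge0 ?invr_ge0 ?nm_ge0 //.
  by rewrite lef_pV2 // posrE ?d0 // (lt_le_trans d0).
- by apply: (seg_Im_ge n Sm Sa Sb ab l0) => z Sz; have [] := H z Sz.
Qed.

(** Cauchy's formula up to a constant: the boundary sums of the slope of [f] at
    [w] tend to zero by [goursat], while those of [1 / (z - w)] stay away from
    zero.  The value of the constant does not matter, since it disappears when
    [f] is raised to powers. *)
Lemma cauchy_crude f x y (l d M : R) w : 0 < l -> 0 < d ->
  x + d <= complex.Re w <= x + l - d -> y + d <= complex.Im w <= y + l - d ->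
  (forall z, rect x (x + l) y (y + l) z -> differentiable f z) ->
  (forall z, edge x y l z -> nm (f z) <= M) ->
  nm (f w) <= 2 * l ^+ 2 / d ^+ 2 * M.
Proof.
move=> l0 d0 w1 w2 df fM.
pose k := d / (2 * l ^+ 2).
have l2 : 0 < 2 * l ^+ 2 by rewrite mulr_gt0 // exprn_gt0.
have k0 : 0 < k by rewrite divr_gt0.
(* A lower bound for the imaginary part of [u / (z - w)] on a side. *)
have kP (c n2 : R) : d <= c / l * l -> 0 < n2 <= 2 * l ^+ 2 -> k <= c / n2.
  rewrite divfK ?gt_eqF // => dc /andP[n0 n2l].
  by apply: ler_pM => //; [exact: ltW|rewrite invr_ge0 ltW|rewrite lef_pV2 ?posrE].
have kE z u : rect x (x + l) y (y + l) z ->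
    d <= complex.Re (z - w) * complex.Im u - complex.Im (z - w) * complex.Re u ->
    k <= complex.Im ((z - w)^-1 * u).
  move=> [z1 z2] H; rewrite Im_invM; apply: kP.
    by rewrite divfK // gt_eqF.
  rewrite lt_neqAle eq_sym addr_ge0 ?sqr_ge0 // andbT.
  apply/andP; split.
    apply/negP => /eqP E0; move: H.
    have : complex.Re (z - w) ^+ 2 = 0.
      by have := sqr_ge0 (complex.Re (z - w)); have := sqr_ge0 (complex.Im (z - w)); lra.
    have : complex.Im (z - w) ^+ 2 = 0.
      by have := sqr_ge0 (complex.Re (z - w)); have := sqr_ge0 (complex.Im (z - w)); lra.
    move=> /eqP; rewrite sqrf_eq0 => /eqP ->; move=> /eqP; rewrite sqrf_eq0 => /eqP ->.
    by rewrite !mul0r subrr; lra.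
  by rewrite ReB ImB; nra.
have dz z : complex.Re z = x \/ complex.Re z = x + l \/ complex.Im z = y \/
    complex.Im z = y + l -> d <= nm (z - w).
  move=> H; have := Re_le_nm (z - w); have := Im_le_nm (z - w).
  rewrite ReB ImB !ler_norml; case: H => [->|[->|[->|->]]]; lra.
have [c1 c2 c3 c4] := bd_corners x y (ltW l0).
have i1 : nm (-1 : K) = 1 by rewrite nmN nm1.
have ii : nm ('i%C : K) = 1.
  by rewrite /nm normc_def /= expr0n expr1n add0r sqrtr1.
have ini : nm (- 'i%C : K) = 1 by rewrite nmN.
have est n : exists A J : K, [/\ bd (slope f w) n x y l = A - f w * J,
    nm A <= 4 * (M / d * l) & 4 * (k * l) <= complex.Im J].
  have [] := @edge_estimate f w M d k l (rect x (x + l) y y) (cc x y)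
      (cc (x + l) y) 1 (@rect_mid_closed _ _ _ _ _) _ _ _ (nm1 _) (ltW l0) d0 _ n.
  - by rewrite /rect /=; split; lra.
  - by rewrite /rect /=; split; lra.
  - by rewrite mulr1 /cc; simpc; congr (_ +i* _)%C; ring.
  - move=> z [z1 z2]; have zy : complex.Im z = y by lra.
    have zr : rect x (x + l) y (y + l) z by split; lra.
    split; [by apply: fM; split=> //; constructor 3|by apply: dz; tauto|].
    by apply: kE => //; rewrite ReB ImB /=; lra.
  move=> A1 [J1 [E1 HA1 HJ1]].
  have [] := @edge_estimate f w M d k l (rect (x + l) (x + l) y (y + l))
      (cc (x + l) y) (cc (x + l) (y + l)) 'i%C (@rect_mid_closed _ _ _ _ _)
      _ _ _ ii (ltW l0) d0 _ n.
  - by rewrite /rect /=; split; lra.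
  - by rewrite /rect /=; split; lra.
  - by rewrite /cc; simpc; congr (_ +i* _)%C; ring.
  - move=> z [z1 z2]; have zy : complex.Re z = x + l by lra.
    have zr : rect x (x + l) y (y + l) z by split; lra.
    split; [by apply: fM; split=> //; constructor 2|by apply: dz; tauto|].
    by apply: kE => //; rewrite ReB ImB /=; lra.
  move=> A2 [J2 [E2 HA2 HJ2]].
  have [] := @edge_estimate f w M d k l (rect x (x + l) (y + l) (y + l))
      (cc (x + l) (y + l)) (cc x (y + l)) (-1) (@rect_mid_closed _ _ _ _ _)
      _ _ _ i1 (ltW l0) d0 _ n.
  - by rewrite /rect /=; split; lra.
  - by rewrite /rect /=; split; lra.
  - by rewrite mulrN1 /cc; simpc; congr (_ +i* _)%C; ring.
  - move=> z [z1 z2]; have zy : complex.Im z = y + l by lra.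
    have zr : rect x (x + l) y (y + l) z by split; lra.
    split; [by apply: fM; split=> //; constructor 4|by apply: dz; tauto|].
    by apply: kE => //; rewrite ReB ImB /= oppr0; lra.
  move=> A3 [J3 [E3 HA3 HJ3]].
  have [] := @edge_estimate f w M d k l (rect x x y (y + l))
      (cc x (y + l)) (cc x y) (- 'i%C) (@rect_mid_closed _ _ _ _ _)
      _ _ _ ini (ltW l0) d0 _ n.
  - by rewrite /rect /=; split; lra.
  - by rewrite /rect /=; split; lra.
  - by rewrite /cc; simpc; congr (_ +i* _)%C; ring.
  - move=> z [z1 z2]; have zy : complex.Re z = x by lra.
    have zr : rect x (x + l) y (y + l) z by split; lra.
    split; [by apply: fM; split=> //; constructor 1|by apply: dz; tauto|].
    by apply: kE => //; rewrite ReB ImB /= oppr0; lra.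
  move=> A4 [J4 [E4 HA4 HJ4]].
  exists (A1 + A2 + A3 + A4), (J1 + J2 + J3 + J4); split.
  - by rewrite /bd E1 E2 E3 E4; ring.
  - have := nmD (A1 + A2 + A3) A4; have := nmD (A1 + A2) A3.
    by have := nmD A1 A2; lra.
  - have ImD (p q : K) : complex.Im (p + q) = complex.Im p + complex.Im q.
      by case: p q => [? ?] [? ?].
    by rewrite !ImD; lra.
have wr : rect x (x + l) y (y + l) w by split; lra.
have main : nm (f w) * (4 * (k * l)) <= 4 * (M / d * l).
  apply/ler_addgt0Pr => e e0.
  have [||N NH] := @goursat (slope f w) x y l w l0 _ _ e e0.
  - by move=> z rz zw; apply: slope_differentiable => //; exact: df.
  - by apply: slope_continuous; exact: df.
  have [A [J [E HA HJ]]] := est N; have := NH N (leqnn _); rewrite E => AJ.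
  have := nmD (A - f w * J) (- A); rewrite addrAC subrr sub0r !nmN nmM => H.
  have := ler_wpM2l (nm_ge0 (f w)) (le_trans HJ (le_trans (ler_norm _) (Im_le_nm J))).
  by lra.
have kl : 0 < 4 * (k * l) by rewrite mulr_gt0 // mulr_gt0.
move: main; rewrite -ler_pdivlMr // => H; apply: (le_trans H).
rewrite le_eqVlt; apply/orP; left; apply/eqP; rewrite /k; field.
by rewrite (gt_eqF l0) (gt_eqF d0).
Qed.

End Cauchy.
Section CauchyEstimates.
Variable R : realType.
Local Notation K := (R[i]^o).
Implicit Types (f g : K -> K) (z w p : K).

Lemma pow_squeeze (a b x y : R) : 0 < a -> 0 <= y ->
  (forall n, a * x ^+ n <= b * y ^+ n) -> x <= y.
Proof.
move=> a0 y0 H; rewrite leNgt; apply/negP => yx.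
have [y00|yn0] := eqVneq y 0.
  by have := H 1%N; rewrite !expr1 y00 mulr0; nra.
have yp : 0 < y by rewrite lt_neqAle eq_sym yn0.
pose q := x / y - 1; have q0 : 0 < q by rewrite subr_gt0 ltr_pdivlMr // mul1r.
have bern n : 1 + n%:R * q <= (x / y) ^+ n.
  elim: n => [|n IH]; first by rewrite mul0r addr0 expr0.
  rewrite exprS -addn1 natrD.
  have -> : x / y = 1 + q by rewrite /q addrC subrK.
  have n0 : 0 <= n%:R :> R by [].
  have := ler_wpM2l (ltW (ltr_pwDl ltr01 (ltW q0))) IH.
  by have -> : x / y = 1 + q by [rewrite /q addrC subrK]; nra.
have bd n : (x / y) ^+ n <= b / a.
  rewrite expr_div_n ler_pdivrMr ?exprn_gt0 // mulrAC ler_pdivlMr //.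
  by rewrite mulrC.
have ba : 0 <= b / a by apply: le_trans (bd 0%N); rewrite expr0.
pose n := (Num.trunc (b / a / q)).+1.
have /andP[_ nP] := truncn_itv (divr_ge0 ba (ltW q0)).
rewrite -/n ltr_pdivrMr // in nP.
by have := bern n; have := bd n; lra.
Qed.

Lemma differentiable_pow f n z : differentiable f z ->
  differentiable (fun z => f z ^+ n : K) z.
Proof.
case: n => [|n] df.
  have -> : (fun z => f z ^+ 0 : K) = cst 1 by apply/funext => u; rewrite expr0.
  exact: differentiable_cst.
have -> : (fun z => f z ^+ n.+1) = f ^+ n.+1.
  by apply/funext => u; rewrite exprfctE.
exact: differentiableX.
Qed.

(** The maximum principle on a square, with one point of mere continuity
    removed by the factor [z - p], whose weight vanishes for large powers. *)
Lemma cauchy_max f x y (l M : R) w p : 0 < l ->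
  x < complex.Re w < x + l -> y < complex.Im w < y + l -> w != p ->
  (forall z, rect x (x + l) y (y + l) z -> z != p -> differentiable f z) ->
  {for p, continuous f} -> rect x (x + l) y (y + l) p ->
  (forall z, edge x y l z -> nm (f z) <= M) ->
  nm (f w) <= M.
Proof.
move=> l0 w1 w2 wp df cf rp fM.
have [d d0 [dw1 dw2]] : exists2 d, 0 < d & x + d <= complex.Re w <= x + l - d /\
    y + d <= complex.Im w <= y + l - d.
  exists (Num.min (Num.min (complex.Re w - x) (x + l - complex.Re w))
    (Num.min (complex.Im w - y) (y + l - complex.Im w))).
    by rewrite !lt_min !subr_gt0; lra.
  set m := Num.min _ _.
  have : m <= m by []; rewrite {2}/m !le_min.
  by move=> /andP[/andP[m1 m2] /andP[m3 m4]]; split; lra.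
have [c1 _ _ _] := bd_corners x y (ltW l0).
have M0 : 0 <= M by apply: le_trans (fM (cc x y) _); [exact: nm_ge0|split=> //; constructor 1].
have wp0 : 0 < nm (w - p) by rewrite nm_gt0 // subr_eq0.
apply: (@pow_squeeze (nm (w - p)) (2 * l ^+ 2 / d ^+ 2 * (2 * l))) => // N.
have := @cauchy_crude _ (fun z => (z - p) * f z ^+ N) x y l d (2 * l * M ^+ N) w
  l0 d0 dw1 dw2.
rewrite nmM nmX mulrA; apply.
  move=> z rz; have [->|zp] := eqVneq z p; last first.
    apply: (@differentiableM _ _ (fun z : K => z - p) (fun z => f z ^+ N)).
      exact: differentiable_sub.
    by apply: differentiable_pow; exact: df.
  apply: (proj1 (@cderiv_differentiable _ _ p (f p ^+ N) _)) => e e0.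
  have /continuous_nm /(_ e e0) [d1 d10 dH] :
      {for p, continuous (fun z : K => f z ^+ N)}.
    apply: (@continuous_comp _ _ _ f (fun u : K => u ^+ N) p cf).
    apply: differentiable_continuous; apply: differentiable_pow.
    exact: ex_diff.
  exists d1 => // v vp; rewrite subrr mul0r subr0 (mulrC (f p ^+ N)) -mulrBr.
  by rewrite nmM mulrC ler_wpM2r ?nm_ge0 // ltW // dH.
move=> z ez; rewrite nmM nmX ler_pM ?nm_ge0 ?exprn_ge0 ?nm_ge0 //.
  by apply: (nm_cc_le erefl erefl rp); case: ez.
by rewrite lerXn2r ?nnegrE ?nm_ge0 // fM.
Qed.

(** The maximum principle bounds the slope of [f] at [p] by its values on the
    boundary of a concentric square; off that square the bound is trivial. *)
Lemma cauchy_lipschitz f p (r M : R) : 0 < r ->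
  (forall z, nm (z - p) < r -> differentiable f z) ->
  (forall z, nm (z - p) < r -> nm (f z) <= M) ->
  forall w, nm (w - p) < r -> nm (f w - f p) <= 4 * M / r * nm (w - p).
Proof.
move=> r0 df fM w wr.
have M0 : 0 <= M by apply: le_trans (fM p _); rewrite ?nm_ge0 // subrr nm0.
have [->|wp] := eqVneq w p; first by rewrite !subrr !nm0 mulr0.
have fwp : nm (f w - f p) <= 2 * M.
  apply: (le_trans (nmB _ _)); have := fM _ wr.
  by have := fM p; rewrite subrr nm0 => /(_ r0); lra.
have far (v : K) : r / 2 <= nm (v - p) -> 2 * M <= 4 * M / r * nm (v - p).
  move=> rv; have := ler_wpM2l (divr_ge0 (mulr_ge0 (ler0n R 4) M0) (ltW r0)) rv.
  suff -> : 4 * M / r * (r / 2) = 2 * M by [].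
  by field; rewrite gt_eqF.
have [rw|rw] := leP (r / 2) (nm (w - p)); first by apply: le_trans fwp _; exact: far.
pose x := complex.Re p - r / 2; pose y := complex.Im p - r / 2.
have inr (z : K) : rect x (x + r) y (y + r) z -> nm (z - p) < r.
  move=> [z1 z2]; rewrite -(ltr_pXn2r (ltn0Sn 1)) ?nnegrE ?nm_ge0 ?ltW // nmC.
  by rewrite ReB ImB; rewrite /x /y in z1 z2; nra.
have w1 := le_lt_trans (Re_le_nm (w - p)) rw.
have w2 := le_lt_trans (Im_le_nm (w - p)) rw.
rewrite ReB ltr_norml in w1; rewrite ImB ltr_norml in w2.
rewrite -slopeM nmM ler_wpM2r ?nm_ge0 //.
apply: (@cauchy_max (slope f p) x y r _ w p) => //.
- by rewrite /x; lra.
- by rewrite /y; lra.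
- by move=> z rz zp; apply: slope_differentiable => //; apply: df; exact: inr.
- by apply: slope_continuous; apply: df; rewrite subrr nm0.
- by rewrite /rect /= /x /y; split; lra.
move=> z [rz ez].
have zp : r / 2 <= nm (z - p).
  have := Re_le_nm (z - p); have := Im_le_nm (z - p).
  rewrite ReB ImB !ler_norml /x /y in ez *; case: ez => ->; lra.
have zp0 : 0 < nm (z - p) by apply: lt_le_trans zp; rewrite divr_gt0.
rewrite -(ler_pM2r zp0) -nmM slopeM; apply: le_trans (far _ zp).
apply: (le_trans (nmB _ _)); have := fM _ (inr _ rz).
by have := fM p; rewrite subrr nm0 => /(_ r0); lra.
Qed.

Lemma cauchy_deriv f p (r M : R) : 0 < r ->
  (forall z, nm (z - p) < r -> differentiable f z) ->
  (forall z, nm (z - p) < r -> nm (f z) <= M) ->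
  nm ('d f p (1 : K)) <= 4 * M / r.
Proof.
move=> r0 df fM; apply/ler_addgt0Pr => e e0.
have dfp : differentiable f p by apply: df; rewrite subrr nm0.
have [d d0 dH] := differentiable_nm dfp e0.
pose t := Num.min r d / 2; have m0 : 0 < Num.min r d by rewrite lt_min r0.
have tm : t < Num.min r d by rewrite /t ltr_pdivrMr // ltr_pMr // ltr1n.
have t0 : 0 < t by rewrite divr_gt0.
have [tr td] : t < r /\ t < d by move: tm; rewrite lt_min => /andP[].
pose h : K := (t%:C)%C.
have nh : nm h = t by rewrite nmR ger0_norm // ltW.
have := dH (p + h); have := cauchy_lipschitz r0 df fM (w := p + h).
rewrite (addrC p) addrK nh => /(_ tr) H1 /(_ td); rewrite (diffE1 f p h) => H2.
rewrite -(ler_pM2l t0); set D := 'd f p (1 : K) in H2 *.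
have nD : nm (h * D) = t * nm D by rewrite nmM nh.
set A := f (h + p) - f p in H1 H2.
have := nmB A (A - h * D); rewrite subKr nD; nra.
Qed.

(** Second-order Taylor estimate: the first-order bound applied twice controls
    the second difference, which is then summed over [v], [v/2], [v/4], etc. *)
Lemma cauchy_taylor f p (r M : R) : 0 < r ->
  (forall z, nm (z - p) < r -> differentiable f z) ->
  (forall z, nm (z - p) < r -> nm (f z) <= M) ->
  forall v, nm v < r / 2 ->
  nm (f (p + v) - f p - 'd f p v) <= 32 * M / r ^+ 2 * nm v ^+ 2.
Proof.
move=> r0 df fM.
have r2 : 0 < r / 2 by rewrite divr_gt0.
have diff1 (a z : K) : nm a < r / 2 -> nm (z - p) < r / 2 ->
    nm (f (z + a) - f z) <= 8 * M / r * nm a.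
  move=> ar zr.
  have sub (u : K) : nm (u - z) < r / 2 -> nm (u - p) < r.
    by move=> uz; have := nmD (u - z) (z - p); rewrite addrA subrK; lra.
  have := @cauchy_lipschitz f z (r / 2) M r2 (fun u uz => df u (sub u uz))
    (fun u uz => fM u (sub u uz)) (z + a).
  rewrite (addrC z) addrK => /(_ ar).
  by have -> : 4 * M / (r / 2) = 8 * M / r by field; rewrite gt_eqF.
pose D (v : K) : K := f (p + v) - f p - 'd f p v.
have step v : nm v < r / 2 ->
    nm (D v - 2 * D (v / 2)) <= 16 * M / r ^+ 2 * nm v ^+ 2.
  move=> vr; pose a := v / 2.
  have ar : nm a < r / 2 by rewrite /a nm_half; have := nm_ge0 v; lra.
  have E : f (p + a + a) - f (p + a) - (f (p + a) - f p) = D v - 2 * D (v / 2).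
    rewrite /D -/a (diffE1 f p v) (diffE1 f p a).
    have -> : p + a + a = p + v by rewrite /a; field.
    by rewrite /a; field.
  have := @cauchy_lipschitz (fun z => f (z + a) - f z) p (r / 2)
    (8 * M / r * nm a) r2 _ _ (p + a).
  have -> : p + a - p = a by ring.
  rewrite E.
  move=> H; apply: (le_trans (H _ _ ar)).
  - move=> z zr; apply: differentiableB.
      apply: (@differentiable_comp _ _ _ _ (fun z : K => z + a) f).
        by apply: differentiableD => //; exact: ex_diff.
      by apply: df; have := nmD (z - p) a; rewrite addrAC; lra.
    by apply: df; lra.
  - by move=> z zr; exact: diff1.
  rewrite le_eqVlt; apply/orP; left; apply/eqP; rewrite /a nm_half; field.
  by rewrite gt_eqF.
have M0 : 0 <= M by apply: le_trans (fM p _); rewrite ?nm_ge0 // subrr nm0.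
have A0 : 0 <= M / r ^+ 2 by rewrite divr_ge0 // exprn_ge0 // ltW.
have nm2 (z : K) : nm (2 * z : K) = 2 * nm z.
  by rewrite nmM -(rmorph_nat (real_complex R)) nmR normr_nat.
have iter n v : nm v < r / 2 ->
    nm (D v) <= 2 ^+ n * nm (D (v / 2 ^+ n)) + 32 * (M / r ^+ 2) * nm v ^+ 2.
  elim: n v => [|n IH] v vr.
    by rewrite !expr0 divr1 mul1r; have := sqr_ge0 (nm v); nra.
  have v2 : nm (v / 2 : K) < r / 2 by rewrite nm_half; have := nm_ge0 v; lra.
  have := IH _ v2; have := step _ vr.
  have := nmD (D v - 2 * D (v / 2)) (2 * D (v / 2)); rewrite subrK nm2.
  have -> : v / 2 ^+ n.+1 = v / 2 / 2 ^+ n by rewrite exprS invfM mulrA.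
  by rewrite nm_half (exprS 2 n); lra.
move=> v vr; apply/ler_addgt0Pr => e e0.
have [->|v0] := eqVneq v 0.
  by rewrite addr0 subrr linear0 subr0 nm0 expr0n mulr0 add0r ltW.
have nv : 0 < nm v by rewrite nm_gt0.
have dfp : differentiable f p by apply: df; rewrite subrr nm0.
have ev : 0 < e / nm v by rewrite divr_gt0.
have [d d0 dH] := differentiable_nm dfp ev.
have [n nd] := exists_halving nv d0.
have nvn : nm (v / 2 ^+ n : K) = nm v / 2 ^+ n.
  by rewrite nmM nmV nmX -(rmorph_nat (real_complex R)) nmR normr_nat.
have := dH (p + v / 2 ^+ n); rewrite (addrC p) addrK nvn => /(_ nd).
rewrite (addrC _ p) -/(D _) => H.
have := iter n v vr.
have n2 : 0 < 2 ^+ n :> R by rewrite exprn_gt0.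
have := ler_wpM2l (ltW n2) H.
have -> : 2 ^+ n * (e / nm v * (nm v / 2 ^+ n)) = e.
  by field; rewrite !gt_eqF.
by rewrite /D mulrA; lra.
Qed.

End CauchyEstimates.

(** * Several variables *)

Section SeveralVariables.
Variable R : realType.
Local Notation K := (R[i]^o).
Variables V W : normedModType R[i].

Lemma line_diff (h : V -> W) (a u : V) (z : K) :
  differentiable h (a + z *: u) ->
  differentiable (fun z : K => h (a + z *: u)) z /\
  'd (fun z : K => h (a + z *: u)) z (1 : K) = 'd h (a + z *: u) u.
Proof.
move=> dh; pose f : K -> V := cst a + *:%R^~ u.
have D : is_diff z f (0 + *:%R^~ u).
  by apply: is_diffD.
have df : differentiable f z by exact: ex_diff.
have fE : 'd f z = (0 + *:%R^~ u) :> (K -> V) by exact: diff_val.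
have E : (fun z : K => h (a + z *: u)) = h \o f by [].
rewrite E; split; first exact: differentiable_comp.
by rewrite diff_comp //= fE /= fctE /= add0r scale1r.
Qed.

End SeveralVariables.

Section Scalar.
Variable R : realType.
Local Notation K := (R[i]^o).
Variable V : normedModType R[i].
Implicit Types (h : V -> K) (a b u w : V).

Lemma line_ball w a b (r : R) (z : K) : nm (a - w) < r / 4 ->
  nm (z *: b) < r / 2 -> nm (a + z *: b - w) < r.
Proof.
move=> aw zb; have := nmD (a - w) (z *: b); rewrite addrAC.
by have := nm_ge0 (a - w); lra.
Qed.

(** The one-variable estimates, applied along the complex line through two
    points. *)
Lemma ball_lipschitz h w (r M : R) : 0 < r ->
  (forall y, nm (y - w) < r -> differentiable h y) ->
  (forall y, nm (y - w) < r -> nm (h y) <= M) ->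
  forall a b, nm (a - w) < r / 4 -> nm (b - w) < r / 4 ->
  nm (h b - h a) <= 8 * M / r * nm (b - a).
Proof.
move=> r0 dh hM a b aw bw.
have [->|ab] := eqVneq b a; first by rewrite !subrr !nm0 mulr0.
have u0 : 0 < nm (b - a) by rewrite nm_gt0 // subr_eq0.
have ur : nm (b - a) < r / 2.
  by have := nmD (b - w) (w - a); rewrite addrA subrK (nmBC w); lra.
pose rho := r / 2 / nm (b - a).
have rho0 : 0 < rho by rewrite !divr_gt0.
have inb (z : K) : nm (z - 0) < rho -> nm (a + z *: (b - a) - w) < r.
  by rewrite subr0 /rho ltr_pdivlMr // -nmZ => zr; exact: line_ball.
have := @cauchy_lipschitz _ (fun z : K => h (a + z *: (b - a))) 0 rho M rho0
  (fun z zr => proj1 (line_diff (dh _ (inb z zr)))) (fun z zr => hM _ (inb z zr)) 1.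
have ba : a + (b - a) = b by rewrite addrC subrK.
rewrite subr0 nm1 scale0r addr0 scale1r ba mulr1 => H.
apply: (le_trans (H _)); first by rewrite /rho ltr_pdivlMr // mul1r.
rewrite /rho le_eqVlt; apply/orP; left; apply/eqP; field.
by rewrite !gt_eqF.
Qed.

Lemma ball_deriv h w (r M : R) : 0 < r ->
  (forall y, nm (y - w) < r -> differentiable h y) ->
  (forall y, nm (y - w) < r -> nm (h y) <= M) ->
  forall u, nm ('d h w u) <= 4 * M / r * nm u.
Proof.
move=> r0 dh hM u.
have [->|u0] := eqVneq u 0; first by rewrite linear0 !nm0 mulr0.
have nu : 0 < nm u by rewrite nm_gt0.
have rho0 : 0 < r / nm u by rewrite divr_gt0.
have inb (z : K) : nm (z - 0) < r / nm u -> nm (w + z *: u - w) < r.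
  by rewrite subr0 ltr_pdivlMr // -nmZ addrAC subrr add0r.
have := @cauchy_deriv _ (fun z : K => h (w + z *: u)) 0 _ M rho0
  (fun z zr => proj1 (line_diff (dh _ (inb z zr)))) (fun z zr => hM _ (inb z zr)).
have dw : differentiable h (w + (0 : K) *: u).
  by rewrite scale0r addr0; apply: dh; rewrite subrr nm0.
rewrite (proj2 (line_diff dw)) scale0r addr0.
by rewrite invf_div mulrA (mulrAC _ (nm u)).
Qed.

Lemma ball_taylor h w (r M : R) : 0 < r ->
  (forall y, nm (y - w) < r -> differentiable h y) ->
  (forall y, nm (y - w) < r -> nm (h y) <= M) ->
  forall u, nm u < r / 2 ->
  nm (h (w + u) - h w - 'd h w u) <= 32 * M / r ^+ 2 * nm u ^+ 2.
Proof.
move=> r0 dh hM u ur.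
have [->|u0] := eqVneq u 0.
  by rewrite addr0 linear0 subrr subr0 !nm0 expr0n mulr0.
have nu : 0 < nm u by rewrite nm_gt0.
have rho0 : 0 < r / nm u by rewrite divr_gt0.
have inb (z : K) : nm (z - 0) < r / nm u -> nm (w + z *: u - w) < r.
  by rewrite subr0 ltr_pdivlMr // -nmZ addrAC subrr add0r.
have := @cauchy_taylor _ (fun z : K => h (w + z *: u)) 0 _ M rho0
  (fun z zr => proj1 (line_diff (dh _ (inb z zr)))) (fun z zr => hM _ (inb z zr)) 1.
have dw : differentiable h (w + (0 : K) *: u).
  by rewrite scale0r addr0; apply: dh; rewrite subrr nm0.
rewrite (proj2 (line_diff dw)) add0r scale1r scale0r addr0 nm1 => H.
apply: (le_trans (H _)).
  by rewrite ltr_pdivlMr // ltr_pdivlMr //; lra.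
rewrite le_eqVlt; apply/orP; left; apply/eqP; field.
by rewrite !gt_eqF.
Qed.

Lemma cauchy_complex (a : nat -> K) (C : R) :
  (forall n, nm (a n.+1 - a n) <= C / 2 ^+ n) ->
  exists l : K, forall n, nm (l - a n) <= 4 * C / 2 ^+ n.
Proof.
move=> aC.
have c2 n : C / 2 ^+ n.+1 = C / 2 ^+ n / 2 by rewrite exprSr invfM mulrA.
have c0 n : 0 <= C / 2 ^+ n by apply: le_trans (aC n); exact: nm_ge0.
have real (x : nat -> R) : (forall n, `|x n.+1 - x n| <= C / 2 ^+ n) ->
    exists l, forall n, `|l - x n| <= 2 * (C / 2 ^+ n).
  move=> xC.
  have [||n|l lP] := @nested_intervals R (fun n => x n - 2 * (C / 2 ^+ n))
      (fun n => 4 * (C / 2 ^+ n)).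
  - by move=> n; rewrite mulr_ge0.
  - by move=> n; have := xC n; rewrite ler_norml c2; lra.
  - by have := xC n; rewrite ler_norml c2; lra.
  by exists l => n; have := lP n; rewrite ler_norml; lra.
have [n|l lP] := real (fun n => complex.Re (a n)).
  by rewrite -ReB (le_trans (Re_le_nm _)).
have [n|l' lP'] := real (fun n => complex.Im (a n)).
  by rewrite -ImB (le_trans (Im_le_nm _)).
exists (l +i* l')%C => n; apply: (le_trans (nm_le _)).
by rewrite ReB ImB /=; have := lP n; have := lP' n; rewrite -mulrA; lra.
Qed.

Lemma le_geometric (x C : R) : (forall n, x <= C / 2 ^+ n) -> x <= 0.
Proof.
move=> H; rewrite leNgt; apply/negP => x0.
have C0 : 0 < C by have := H 0%N; rewrite expr0 divr1; lra.
by have [n nx] := exists_halving C0 x0; have := H n; lra.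
Qed.

Lemma limit_unique (a : nat -> K) (l l' : K) (C C' : R) :
  (forall n, nm (l - a n) <= C / 2 ^+ n) ->
  (forall n, nm (l' - a n) <= C' / 2 ^+ n) -> l = l'.
Proof.
move=> H H'; apply/subr0_eq/nm_le0; apply: (@le_geometric _ (C + C')) => n.
have := nmB (l - a n) (l' - a n); rewrite opprB addrA subrK.
by have := H n; have := H' n; rewrite mulrDl; lra.
Qed.

(** The derivatives of the [q k] at [w] form a Cauchy sequence by [ball_deriv],
    and their Taylor estimates, being uniform in [k], pass to the limit. *)
Lemma weierstrass (q : nat -> V -> K) (m : V -> K) w (r M C : R) : 0 < r ->
  (forall k y, nm (y - w) < r -> differentiable (q k) y) ->
  (forall k y, nm (y - w) < r -> nm (q k y) <= M) ->
  (forall k y, nm (y - w) < r -> nm (q k y - m y) <= C / 2 ^+ k) ->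
  differentiable m w.
Proof.
move=> r0 dq qM qm.
have C0 : 0 <= C.
  have := qm 0%N w; rewrite subrr nm0 => /(_ r0).
  by rewrite expr0 divr1; apply: le_trans; exact: nm_ge0.
have M0 : 0 <= M.
  by apply: le_trans (qM 0%N w _); rewrite ?nm_ge0 // subrr nm0.
have ww : nm (w - w) < r by rewrite subrr nm0.
have c2 n : C / 2 ^+ n.+1 = C / 2 ^+ n / 2 by rewrite exprSr invfM mulrA.
have c0 n : 0 <= C / 2 ^+ n by rewrite divr_ge0 // exprn_ge0.
have step k u : nm ('d (q k.+1) w u - 'd (q k) w u) <=
    (8 * C / r * nm u) / 2 ^+ k.
  have E : 'd (q k.+1 - q k) w u = 'd (q k.+1) w u - 'd (q k) w u.
    by have /(congr1 (@^~ u)) := diffB (dq k.+1 w ww) (dq k w ww).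
  rewrite -E.
  have := @ball_deriv (q k.+1 - q k) w r (2 * (C / 2 ^+ k)) r0 _ _ u.
  move=> H; apply: (le_trans (H _ _)).
  - by move=> y yr; apply: differentiableB; exact: dq.
  - move=> y yr; rewrite fctE.
    have := nmB (q k.+1 y - m y) (q k y - m y); rewrite opprB addrA subrK.
    by have := qm k y yr; have := qm k.+1 y yr; rewrite c2; have := c0 k; lra.
  rewrite le_eqVlt; apply/orP; left; apply/eqP; field.
  by rewrite (gt_eqF r0) expf_neq0.
have [L LP] := choice (fun u => cauchy_complex (fun k => step k u)).
have Llin : linear L.
  move=> c u v.
  suff H n : nm (c *: L u + L v - 'd (q n) w (c *: u + v)) <=
      (nm (c : K) * (4 * (8 * C / r * nm u)) + 4 * (8 * C / r * nm v)) / 2 ^+ n.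
    exact: (limit_unique (LP (c *: u + v)) H).
  rewrite linearP.
  have -> : c *: L u + L v - (c *: 'd (q n) w u + 'd (q n) w v) =
      c *: (L u - 'd (q n) w u) + (L v - 'd (q n) w v).
    by rewrite scalerBr opprD addrACA.
  apply: (le_trans (nmD _ _)); rewrite nmZ mulrDl lerD //.
  by rewrite -mulrA ler_wpM2l ?nm_ge0.
have Lbd u : nm (L u) <= (4 * M / r + 32 * C / r) * nm u.
  have := LP u 0%N; rewrite expr0 divr1.
  have := @ball_deriv (q 0%N) w r M r0 (dq 0%N) (qM 0%N) u.
  have := nmD (L u - 'd (q 0%N) w u) ('d (q 0%N) w u); rewrite subrK mulrDl.
  by lra.
pose Ll : {linear V -> K} := HB.pack L (GRing.isLinear.Build R[i] V K *:%R L Llin).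
have Lc : continuous Ll.
  move=> x; apply/continuous_nm => e e0.
  have B0 : 0 <= 4 * M / r + 32 * C / r.
    by rewrite addr_ge0 // divr_ge0 ?mulr_ge0 // ltW.
  exists (e / (4 * M / r + 32 * C / r + 1)); first by rewrite divr_gt0 // ltr_wpDl.
  move=> y; rewrite ltr_pdivlMr ?ltr_wpDl // => yx; rewrite -linearB.
  apply: le_lt_trans (Lbd _) _; apply: le_lt_trans yx.
  by rewrite mulrC ler_wpM2l ?nm_ge0 // lerDl.
apply: (proj1 (nm_differentiable Lc _)) => e e0.
pose B := 32 * M / r ^+ 2.
have B0 : 0 <= B.
  by apply: divr_ge0; [rewrite mulr_ge0|rewrite exprn_ge0 // ltW].
have taylor u : nm u < r / 2 -> nm (m (w + u) - m w - L u) <= B * nm u ^+ 2.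
  move=> ur; rewrite -subr_le0.
  apply: (@le_geometric _ (2 * C + 4 * (8 * C / r * nm u))) => n.
  have ub : nm (w + u - w) < r.
    by rewrite addrAC subrr add0r; have := nm_ge0 u; lra.
  have T := ball_taylor r0 (dq n) (qM n) ur.
  have E : m (w + u) - m w - L u = (q n (w + u) - q n w - 'd (q n) w u) -
      ((q n (w + u) - m (w + u)) - (q n w - m w)) - (L u - 'd (q n) w u).
    by ring.
  rewrite E lerBlDr (le_trans (nmB _ _)) //.
  have := nmB (q n (w + u) - q n w - 'd (q n) w u)
    ((q n (w + u) - m (w + u)) - (q n w - m w)).
  have := nmB (q n (w + u) - m (w + u)) (q n w - m w).
  have := LP u n; have := qm n _ ub; have := qm n _ ww.
  by rewrite -/B in T; lra.
exists (Num.min (r / 2) (e / (B + 1))).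
  by rewrite lt_min !divr_gt0 // ltr_wpDl.
move=> y; rewrite lt_min => /andP[y1 y2].
have wy : w + (y - w) = y by rewrite addrC subrK.
have := taylor _ y1; rewrite wy => H; apply: (le_trans H).
rewrite expr2 mulrA ler_wpM2r ?nm_ge0 //.
move: y2; rewrite ltr_pdivlMr ?ltr_wpDl // => y2.
by have := nm_ge0 (y - w); nra.
Qed.

End Scalar.

Section FiberDerivative.
Variable R : realType.
Local Notation K := (R[i]^o).
Variable E : normedModType R[i].
Implicit Types (F : (E * K)%type -> K) (x : E) (v : K).

Lemma differentiable_inl (W : normedModType R[i]) (F : (E * K)%type -> W) x v :
  differentiable F (x, v) -> differentiable (fun x => F (x, v)) x.
Proof.
by move=> dF; apply: (@differentiable_comp _ _ _ _ (fun x : E => (x, v)) F).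
Qed.

Lemma differentiable_inr (W : normedModType R[i]) (F : (E * K)%type -> W) x v :
  differentiable F (x, v) -> differentiable (fun v => F (x, v)) v.
Proof.
by move=> dF; apply: (@differentiable_comp _ _ _ _ (fun v : K => (x, v)) F).
Qed.

(** The derivative along the fiber is a uniform limit of difference
    quotients. *)
Lemma fiber_derivative_differentiable F x0 (r M : R) : 0 < r ->
  (forall x v, nm (x - x0) < r -> nm v < r -> differentiable F (x, v)) ->
  (forall x v, nm (x - x0) < r -> nm v < r -> nm (F (x, v)) <= M) ->
  differentiable (fun x => 'd (fun v : K => F (x, v)) 0 (1 : K) : K) x0.
Proof.
move=> r0 dF FM.
pose t k : R := r / 4 / 2 ^+ k.
have t0 k : 0 < t k by rewrite !divr_gt0 // exprn_gt0.
have tr k : t k <= r / 4.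
  have p1 : 1 <= 2 ^+ k :> R by rewrite exprn_ege1 // ler1n.
  by rewrite /t ler_pdivrMr ?exprn_gt0 //; nra.
pose s k : K := ((t k)%:C)%C.
have ns k : nm (s k) = t k by rewrite nmR ger0_norm // ltW.
have s0 k : s k != 0.
  by apply/eqP => /(congr1 (@nm R _)); rewrite ns nm0 => /eqP; rewrite gt_eqF.
have sr k : nm (s k) < r by rewrite ns (le_lt_trans (tr k)) //; lra.
have O0 : nm (0 : K) < r by rewrite nm0.
pose m x : K := 'd (fun v : K => F (x, v)) 0 (1 : K).
pose q k x : K := (s k)^-1 *: (F (x, s k) - F (x, 0)).
have fib x : nm (x - x0) < r -> forall v, nm (v - 0) < r ->
    differentiable (fun v : K => F (x, v)) v.
  by move=> xr v; rewrite subr0 => vr; apply: differentiable_inr; exact: dF.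
have fibM x : nm (x - x0) < r -> forall v, nm (v - 0) < r -> nm (F (x, v)) <= M.
  by move=> xr v; rewrite subr0 => vr; exact: FM.
have qE k x : nm (q k x) = nm (F (x, s k) - F (x, 0)) / t k.
  by rewrite /q nmZ nmV ns mulrC.
apply: (@weierstrass R E q m x0 r (4 * M / r) (8 * M / r) r0).
- move=> k y yr; apply: differentiableZ; apply: differentiableB.
    by apply: differentiable_inl; exact: dF.
  by apply: differentiable_inl; exact: dF.
- move=> k y yr; rewrite qE ler_pdivrMr //.
  have := cauchy_lipschitz r0 (fib y yr) (fibM y yr) (w := s k).
  by rewrite subr0 ns -ns; exact.
move=> k y yr.
have sr2 : nm (s k) < r / 2 by rewrite ns (le_lt_trans (tr k)) //; lra.
have := cauchy_taylor r0 (fib y yr) (fibM y yr) sr2.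
rewrite add0r (diffE1 _ 0 (s k)) -/(m y) ns => H0.
have -> : q k y - m y = (s k)^-1 *: (F (y, s k) - F (y, 0) - s k * m y).
  by rewrite /q [RHS]scalerBr -[_ *: (s k * m y)]/((s k)^-1 * (s k * m y)) mulKf.
rewrite nmZ nmV ns mulrC ler_pdivrMr //; apply: (le_trans H0).
rewrite le_eqVlt; apply/orP; left; apply/eqP; rewrite /t; field.
by rewrite (gt_eqF r0) expf_neq0.
Qed.

End FiberDerivative.

(** * Rigidity of holomorphic families of automorphisms of the disc *)

Section Rigidity.
Variable R : realType.
Local Notation K := (R[i]^o).
Implicit Types (t z : K).

(** The [N]-th iterates of the maps [th (t, _)] form a family of self-maps of
    the disc whose derivative in [t] is [N] times that of [th]; Cauchy's
    estimate bounds it independently of [N]. *)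
Lemma self_map_family_deriv (th : (K * K)%type -> K) (r : R) : 0 < r ->
  (forall t z, nm t < r -> nm z < 1 -> differentiable th (t, z)) ->
  (forall t z, nm t < r -> nm z < 1 -> nm (th (t, z)) < 1) ->
  (forall z, nm z < 1 -> th (0, z) = z) ->
  forall z, nm z < 1 -> 'd (fun t : K => th (t, z)) 0 (1 : K) = 0.
Proof.
move=> r0 dth th1 th0 z z1.
have O0 : nm (0 : K) < r by rewrite nm0.
pose a : K := 'd (fun t : K => th (t, z)) 0 (1 : K).
pose it N t : K := iter N (fun u => th (t, u)) z.
have it1 N t : nm t < r -> nm (it N t) < 1.
  by move=> tr; elim: N => [//|N IH]; rewrite /it iterS; exact: th1.
have it0 N : it N 0 = z.
  by elim: N => [//|N IH]; rewrite /it iterS -/(it N 0) IH th0.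
have itS N : it N.+1 = th \o (fun t => (t, it N t)).
  by apply/funext => t; rewrite /it iterS.
have dit N t : nm t < r -> differentiable (it N) t.
  elim: N => [|N IH] tr; first exact: differentiable_cst.
  rewrite itS; apply: differentiable_comp.
    by apply: differentiable_pair => //; exact: IH.
  by apply: dth => //; exact: it1.
have dth0 := dth _ _ O0 z1.
have thl (u : K * K) s : th ((0, z) + s *: u) = th (s * u.1, z + s * u.2).
  by rewrite -{1}[0]/(0 : K); congr (th (_, _)); rewrite /= add0r.
have th00 (u : K * K) : differentiable th ((0, z) + (0 : K) *: u).
  by rewrite scale0r addr0.
have part1 : 'd th (0, z) ((1 : K), (0 : K)) = a.
  have [_] := line_diff (th00 ((1 : K), (0 : K))).
  rewrite scale0r addr0 => <-; rewrite /a.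
  suff -> : (fun t : K => th (t, z)) =
    (fun s : K => th ((0, z) + s *: ((1 : K), (0 : K)))) by [].
  by apply/funext => s; rewrite thl /= mulr1 mulr0 addr0.
have part2 (h : K) : 'd th (0, z) ((0 : K), h) = h.
  have [dl] := line_diff (th00 ((0 : K), h)).
  rewrite scale0r addr0 => <-.
  have dh : differentiable (fun s : K => z + s *: h) 0 /\
      'd (fun s : K => z + s *: h) 0 (1 : K) = h.
    have [|d1 d2] := @line_diff _ _ _ (id : K -> K) z h 0; first exact: ex_diff.
    have did : 'd (id : K -> K) (z + (0 : K) *: h) = id :> (K -> K) by exact: diff_val.
    by split; [exact: d1|exact: etrans d2 (congr1 (@^~ h) did)].
  have [d d0 dH] : exists2 d : R, 0 < d & forall s : K, nm s < d -> nm (z + s *: h) < 1.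
    have h1 : 0 < nm h + 1 by rewrite ltr_wpDl ?nm_ge0.
    exists ((1 - nm z) / (nm h + 1)); first by rewrite divr_gt0 ?subr_gt0.
    move=> s; rewrite ltr_pdivlMr // => sd.
    apply: le_lt_trans (nmD _ _) _; rewrite nmZ.
    by have := nm_ge0 s; lra.
  have nearh : \forall s \near (0 : K),
      z + s *: h = th ((0, z) + s *: ((0 : K), h)).
    apply/nbhs_nm; exists d => // s; rewrite subr0 => sd.
    by rewrite thl /= mulr0 th0 //; exact: dH.
  have [_ e2] := near_diff nearh dh.1.
  by rewrite e2; exact: dh.2.
have itd N : 'd (it N) 0 (1 : K) = N%:R * a.
  elim: N => [|N IH].
    by have := diff_cst (z : K) (0 : K) => /(congr1 (@^~ (1 : K))); rewrite mul0r.
  have di := dit N _ O0; have did : differentiable (id : K -> K) 0 by exact: ex_diff.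
  have dp := differentiable_pair did di.
  have dth' : differentiable th (0, it N 0) by rewrite it0.
  have did1 : 'd (id : K -> K) 0 = id :> (K -> K) by exact: diff_val.
  have E1 : 'd (fun t : K => (t, it N t)) 0 (1 : K) = ((1 : K), (N%:R * a : K)).
    apply: (etrans (congr1 (@^~ (1 : K)) (diff_pair did di))).
    by congr (_, _); [exact: (congr1 (fun F : K -> K => F (1 : K)) did1)|exact: IH].
  rewrite itS (diff_comp dp dth') /= it0 E1.
  have -> : ((1 : K), (N%:R * a : K)) = (1, 0) + (0, N%:R * a).
    by congr (_, _); rewrite /= ?addr0 ?add0r.
  by rewrite linearD part1 part2 -natr1 mulrDl mul1r addrC.
apply: nm_le0; apply/ler_addgt0Pr => e e0; rewrite add0r.
have bnd N : N%:R * nm a <= 4 / r.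
  have := @cauchy_deriv _ (it N) 0 r 1 r0 _ _.
  rewrite itd nmM mulr1.
  have -> : nm (N%:R : K) = N%:R.
    by rewrite -(rmorph_nat (real_complex R)) nmR normr_nat.
  by apply=> t; rewrite subr0 => tr; [exact: dit|rewrite ltW // it1].
pose n := (Num.trunc (4 / r / e)).+1.
have r4 : 0 <= 4 / r by rewrite divr_ge0 // ltW.
have /andP[_ nP] := truncn_itv (divr_ge0 r4 (ltW e0)).
rewrite -/n ltr_pdivrMr // in nP.
have n0 : 0 < n%:R :> R by rewrite ltr0n.
by rewrite -(ler_pM2l n0) (le_trans (bnd n)) // ltW.
Qed.

(** Composing the family with the inverse of its member at [t] makes it the
    identity at [t], so that [self_map_family_deriv] applies: the derivative
    vanishes at every parameter. *)
Lemma automorphism_family_constant (phi psi : (K * K)%type -> K) (O : set K) :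
  (forall t, O t -> \forall t' \near t, O t') ->
  (forall t : R, 0 <= t <= 1 -> O ((t%:C)%C : K)) ->
  (forall t z, O t -> nm z < 1 ->
     differentiable phi (t, z) /\ differentiable psi (t, z)) ->
  (forall t z, O t -> nm z < 1 -> nm (phi (t, z)) < 1 /\ nm (psi (t, z)) < 1) ->
  (forall t z, O t -> nm z < 1 ->
     phi (t, psi (t, z)) = z /\ psi (t, phi (t, z)) = z) ->
  forall z, nm z < 1 -> phi (1, z) = phi (0, z).
Proof.
move=> Oop O01 dphi phi1 phiK z z1.
pose u (t : K) : K := phi (t, z).
have du t : O t -> differentiable u t /\ 'd u t (1 : K) = 0.
  move=> Ot; have /nbhs_nm [r r0 rO] := Oop t Ot.
  pose th (p : K * K) : K := phi (t + p.1, psi (t, p.2)).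
  have tO (s : K) : nm s < r -> O (t + s).
    by move=> sr; apply: rO; rewrite addrAC subrr add0r.
  have psi1 v : nm v < 1 -> nm (psi (t, v)) < 1.
    by move=> v1; case: (phi1 t v Ot v1).
  have dth s v : nm s < r -> nm v < 1 -> differentiable th (s, v).
    move=> sr v1.
    apply: (@differentiable_comp _ _ _ _
      (fun p : K * K => (t + p.1, psi (t, p.2))) phi).
      apply: differentiable_pair.
        apply: differentiableD; first exact: differentiable_cst.
        exact: differentiable_fst.
      apply: (@differentiable_comp _ _ _ _ snd (fun v => psi (t, v))).
        exact: differentiable_snd.
      by apply: differentiable_inr; case: (dphi t v Ot v1).
    by case: (dphi (t + s) (psi (t, v)) (tO s sr) (psi1 v v1)).
  have th1 s v : nm s < r -> nm v < 1 -> nm (th (s, v)) < 1.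
    move=> sr v1.
    by case: (phi1 (t + s) (psi (t, v)) (tO s sr) (psi1 v v1)).
  have th0 v : nm v < 1 -> th (0, v) = v.
    by move=> v1; rewrite /th addr0; case: (phiK t v Ot v1).
  have w1 : nm (u t) < 1 by case: (phi1 t z Ot z1).
  have d0 := self_map_family_deriv r0 dth th1 th0 w1.
  have dut : differentiable u t.
    by apply: differentiable_inl; case: (dphi t z Ot z1).
  split; first exact: dut.
  apply: (etrans _ d0).
  have E : (fun s : K => th (s, u t)) = (fun s : K => u (t + s *: (1 : K))).
    apply/funext => s; rewrite /th /u /=; case: (phiK t z Ot z1) => _ ->.
    by rewrite -[s *: _]/(s * 1) mulr1.
  have t0 : t + (0 : K) *: (1 : K) = t by rewrite scale0r addr0.
  have dut' : differentiable u (t + (0 : K) *: (1 : K)) by rewrite t0.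
  have := proj2 (line_diff dut'); rewrite t0 => e1.
  exact: (etrans (esym e1) (congr1 (fun f : K -> K => 'd f 0 (1 : K)) (esym E))).
suff key (e : R) : 0 < e -> nm (u 1 - u 0) <= e.
  apply: (subr0_eq (x := u 1)); apply: nm_le0; apply/ler_addgt0Pr => e e0.
  by rewrite add0r; exact: key.
move=> e0.
have := @interval_bisection R (fun a b =>
  nm (u (b%:C)%C - u (a%:C)%C) <= e * (b - a)) 0 1 ltr01.
rewrite subr0 mulr1; apply.
  move=> a b ab H1 H2.
  have := nmD (u (b%:C)%C - u (((a + b) / 2)%:C)%C)
    (u (((a + b) / 2)%:C)%C - u (a%:C)%C).
  by rewrite addrA subrK; nra.
move=> t t01; have [dut ut0] := du _ (O01 t t01).
have [d d0 dH] := differentiable_nm dut e0; exists d => // a b ab abd atb _ _.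
have near (c : R) : `|c - t| < d ->
    nm (u (c%:C)%C - u (t%:C)%C) <= e * `|c - t|.
  have E : nm ((c%:C)%C - (t%:C)%C : K) = `|c - t|.
    by rewrite -(rmorphB (real_complex R)) nmR.
  by move=> ct; have := dH ((c%:C)%C); rewrite E diffE1 ut0 mulr0 subr0; apply.
have at0 : `|a - t| = t - a by rewrite distrC ger0_norm //; lra.
have bt0 : `|b - t| = b - t by rewrite ger0_norm //; lra.
have := near a; have := near b; rewrite at0 bt0 => /(_ ltac:(lra)) H1 /(_ ltac:(lra)) H2.
have := nmB (u (b%:C)%C - u (t%:C)%C) (u (a%:C)%C - u (t%:C)%C).
by rewrite opprB addrA subrK; lra.
Qed.

End Rigidity.

(** * Openness of the image of a holomorphic map with a holomorphic left inverse *)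

Section Retraction.
Variables (R : realType) (n : nat).
Local Notation K := (R[i]^o).
Local Notation E := ('rV[R[i]]_n : normedModType R[i]).
Local Notation V := ((E * K)%type : normedModType R[i]).

Lemma nm_row_le (x : E) (c : R) : 0 <= c -> (forall j, nm (x 0 j : K) <= c) ->
  nm x <= c.
Proof.
move=> c0 xc; have [x0|/mx_norm_neq0[[i j] /= xij]] := eqVneq (mx_norm x) 0.
  by rewrite (mx_norm_eq0 x0) nm0.
rewrite -lecR -nmE; have -> : `|x| = `|x i j| by exact: xij.
by have := xc j; rewrite -lecR -nmE (ord1 i).
Qed.

Lemma nm_coord (x : E) j : nm (x 0 j : K) <= nm x.
Proof.
rewrite -lecR -!nmE -[leLHS]nngE num_le.
exact: (@le_bigmax _ _ _ _ (fun i => `|x i.1 i.2|%:nng) (0, j)).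
Qed.

Lemma nm_pair_le (E1 E2 : normedModType R[i]) (x : (E1 * E2)%type) (c : R) :
  nm x <= c <-> nm x.1 <= c /\ nm x.2 <= c.
Proof.
rewrite -![nm _ <= c]lecR -!nmE prod_normE.
by rewrite comparable_ge_max ?real_comparable //; split=> [/andP|/andP].
Qed.

Lemma nm_coords (x : V) (c : R) : 0 <= c ->
  (forall j, nm (x.1 0 j : K) <= c) -> nm x.2 <= c -> nm x <= c.
Proof. by move=> c0 x1 x2; apply/nm_pair_le; split=> //; exact: nm_row_le. Qed.

(** The map [s = r - id] is a contraction near [w], because it is [o(y - w)]
    and Cauchy's estimate turns this into a small Lipschitz constant; but
    [s (r y) - s y = - (r y - y)]. *)
Lemma idempotent_near_id (r : V -> V) (w : V) :
  (\forall y \near w, differentiable r y) -> r w = w ->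
  'd r w = id :> (V -> V) -> (\forall y \near w, r (r y) = r y) ->
  \forall y \near w, r y = y.
Proof.
move=> dr rw drw rr; pose s y := r y - y.
have drw1 : differentiable r w by exact: nbhs_singleton dr.
have e16 : 0 < (16%:R)^-1 :> R by rewrite invr_gt0.
have [d1 d10 H1] := differentiable_nm drw1 e16.
have {}H1 y : nm (y - w) < d1 -> nm (s y) <= 16^-1 * nm (y - w).
  move=> yw; have := H1 y yw; rewrite drw rw /s.
  by have -> : r y - w - id (y - w) = r y - y by rewrite /= opprB addrA subrK.
have [d2 d20 H2] : exists2 d2 : R, 0 < d2 & forall y, nm (y - w) < d2 ->
    differentiable r y by exact/nbhs_nm.
pose d := Num.min d1 d2; have d0 : 0 < d by rewrite lt_min d10.
have dd1 y : nm (y - w) < d -> nm (y - w) < d1.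
  by rewrite lt_min => /andP[].
have ds y : nm (y - w) < d -> differentiable s y.
  rewrite lt_min => /andP[_ yd2]; apply: differentiableB; first exact: H2.
  exact: ex_diff.
have sd y : nm (y - w) < d -> nm (s y) <= d / 16.
  by move=> yd; apply: (le_trans (H1 _ (dd1 _ yd))); rewrite mulrC ler_pM2r // ltW.
have lip a b : nm (a - w) < d / 4 -> nm (b - w) < d / 4 ->
    nm (s b - s a) <= 2^-1 * nm (b - a).
  move=> ad bd.
  have half : 8 * (d / 16) / d = 2^-1 by field; rewrite gt_eqF.
  have h0 : 0 <= 2^-1 * nm (b - a) by rewrite mulr_ge0 ?invr_ge0 ?nm_ge0.
  rewrite -half; apply: nm_coords; rewrite ?half //.
  - move=> j; have := @ball_lipschitz R V (fun y => (s y).1 0 j) w d (d / 16) d0 _ _ a b ad bd.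
    rewrite half !mxE; apply.
      move=> y yd.
      apply: (@differentiable_comp _ _ _ _ (fun y => (s y).1) (fun v : E => v 0 j : K)).
        apply: (@differentiable_comp _ _ _ _ s fst); first exact: ds.
        exact: differentiable_fst.
      exact: differentiable_coord.
    move=> y yd; apply: (le_trans (nm_coord _ _)).
    by have /nm_pair_le[] := sd y yd.
  - have := @ball_lipschitz R V (fun y => (s y).2) w d (d / 16) d0 _ _ a b ad bd.
    rewrite half; apply.
      move=> y yd.
      apply: (@differentiable_comp _ _ _ _ s snd); first exact: ds.
      exact: differentiable_snd.
    by move=> y yd; have /nm_pair_le[] := sd y yd.
have d40 : 0 < d / 4 by rewrite divr_gt0.
have cr : {for w, continuous r} by exact: differentiable_continuous.
have N1 : \forall y \near w, nm (r y - w) < d / 4.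
  by have := cr _ (near_ball (r w) d40); rewrite rw.
have N0 := near_ball w d40.
apply: filterS (filterI N0 (filterI N1 rr)) => y [y1 [y2 y3]].
have := lip y (r y) y1 y2; rewrite {1}/s y3 subrr sub0r nmN /s => H.
have H0 : nm (r y - y) <= 0 by lra.
exact: (subr0_eq (nm_le0 H0)).
Qed.

(** This is where the finite dimension of the model space enters. *)
Lemma linear_inverse_swap (f g : {linear V -> V}) :
  (forall x, f (g x) = x) -> forall x, g (f x) = x.
Proof.
move=> fg x; pose F : 'End(V) := linfun f; pose G : 'End(V) := linfun g.
have FE y : F y = f y by rewrite lfunE.
have GE y : G y = g y by rewrite lfunE.
have kG : lker G == 0%VS.
  by apply/lker0P => u v; rewrite !GE => /(congr1 f); rewrite !fg.
have GK := lker0_lfunVK kG.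
by have := GK x; rewrite GE => <-; rewrite fg.
Qed.

End Retraction.

(** * Monodromy *)

Section Monodromy.
Variables (R : realType) (X : topologicalType) (A : Type).
(** [flat V s]: the function [s] is a local section over [V]. *)
Variable flat : set X -> (X -> A) -> Prop.

(** The first two conditions say that [V] is evenly covered by the space of germs
    of sections; a germ is represented by its value. *)
Definition elementary (V : set X) :=
  [/\ forall s t y, flat V s -> flat V t -> V y -> s y = t y ->
        forall z, V z -> s z = t z,
      forall y W t, V y -> open W -> W y -> flat W t ->
        exists2 s, flat V s & s y = t y &
      forall y z, V y -> V z -> exists g : R -> X,
        [/\ continuous g, g 0 = y, g 1 = z & forall t, V (g t)]].

Hypothesis flat_sub : forall V V' s, flat V s -> V' `<=` V -> flat V' s.
Hypothesis flat_elementary : forall x W, open W -> W x ->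
  exists V, [/\ open V, V x, V `<=` W & elementary V].

Definition germ_value x a := exists W s, [/\ open W, W x, flat W s & s x = a].

Lemma flat_agree_near W W' s t x : open W -> open W' -> W x -> W' x ->
  flat W s -> flat W' t -> s x = t x -> \forall y \near x, s y = t y.
Proof.
move=> oW oW' Wx W'x fs ft st.
have [V [oV Vx VW [uniq _ _]]] := flat_elementary (openI oW oW') (conj Wx W'x).
have fs' : flat V s by apply: flat_sub fs _ => y /VW[].
have ft' : flat V t by apply: flat_sub ft _ => y /VW[].
have nV : nbhs x V by apply: open_nbhs_nbhs.
by apply: filterS nV => y Vy; exact: uniq st _ Vy.
Qed.

(** Lifts to the space of germs of sections, which stays implicit: continuity of
    the lift is expressed by local sections. *)
Definition lifts (Z : topologicalType) (D : set Z) (h : Z -> X) (v : Z -> A) :=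
  forall z, D z -> exists W s, [/\ open W, W (h z), flat W s &
    \forall z' \near z, D z' -> v z' = s (h z')].

Lemma lifts_value (Z : topologicalType) (D : set Z) h v z :
  lifts D h v -> D z -> germ_value (h z) (v z).
Proof.
move=> lv Dz; have [W [s [oW Wz fs vs]]] := lv z Dz.
by exists W, s; split=> //; rewrite (nbhs_singleton vs).
Qed.

Lemma lifts_comp (Z Z' : topologicalType) (D : set Z) (D' : set Z') h v
    (e : Z' -> Z) : continuous e -> (forall z, D' z -> D (e z)) ->
  lifts D h v -> lifts D' (h \o e) (v \o e).
Proof.
move=> ce De lv z D'z; have [W [s [oW Wz fs vs]]] := lv _ (De _ D'z).
exists W, s; split=> //.
have N : \forall z' \near z, D (e z') -> v (e z') = s (h (e z')) := ce z _ vs.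
by apply: filterS N => z' H /De; exact: H.
Qed.

Lemma lifts_eq (Z : topologicalType) (D : set Z) h h' v :
  (forall z, D z -> h z = h' z) -> lifts D h v -> lifts D h' v.
Proof.
move=> hh lv z Dz; have [W [s [oW Wz fs vs]]] := lv z Dz.
exists W, s; split=> //; first by rewrite -hh.
by apply: filterS vs => z' H Dz'; rewrite -hh //; exact: H.
Qed.

Lemma lifts_section (Z : topologicalType) (D : set Z) h V s :
  open V -> flat V s -> (forall z, D z -> V (h z)) -> lifts D h (s \o h).
Proof.
move=> oV fs DV z Dz; exists V, s; split=> //; first exact: DV.
by apply: filterE.
Qed.

(** The two local sections at a common point agree there, hence nearby. *)
Lemma lifts_glue (Z : topologicalType) (D1 D2 : set Z) h v1 v2 :
  continuous h -> closed D1 -> closed D2 -> lifts D1 h v1 -> lifts D2 h v2 ->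
  (forall z, D1 z -> D2 z -> v1 z = v2 z) ->
  lifts (D1 `|` D2) h (fun z => if pselect (D1 z) then v1 z else v2 z).
Proof.
move=> ch cD1 cD2 lv1 lv2 v12 z Dz.
have out (D : set Z) : closed D -> ~ D z -> \forall z' \near z, ~ D z'.
  by move=> cD nD; exact: (@open_nbhs_nbhs _ z (~` D) (conj (closed_openC cD) nD)).
have [D1z|nD1] := pselect (D1 z); have [D2z|nD2] := pselect (D2 z).
- have [W1 [s1 [oW1 W1z fs1 vs1]]] := lv1 z D1z.
  have [W2 [s2 [oW2 W2z fs2 vs2]]] := lv2 z D2z.
  have s12 : s1 (h z) = s2 (h z).
    by rewrite -(nbhs_singleton vs1) // -(nbhs_singleton vs2) // v12.
  have N : \forall z' \near z, s1 (h z') = s2 (h z') :=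
    ch z _ (flat_agree_near oW1 oW2 W1z W2z fs1 fs2 s12).
  exists W1, s1; split=> //.
  apply: filterS (filterI N (filterI vs1 vs2)) => z' [e [e1 e2]].
  by case: pselect => [D1z' _|nD1z' [//|D2z']]; [exact: e1|rewrite e2].
- have [W1 [s1 [oW1 W1z fs1 vs1]]] := lv1 z D1z.
  exists W1, s1; split=> //.
  apply: filterS (filterI (out _ cD2 nD2) vs1) => z' [nD2z' e1].
  by case: pselect => [D1z' _|nD1z' [?|?]]; [exact: e1|..].
- have [W2 [s2 [oW2 W2z fs2 vs2]]] := lv2 z D2z.
  exists W2, s2; split=> //.
  apply: filterS (filterI (out _ cD1 nD1) vs2) => z' [nD1z' e2].
  by case: pselect => [?|? [?|?]]; [..|exact: e2].
- by case: Dz.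
Qed.

Definition seg01 (a b : R) : set R := [set t | a <= t <= b].

Lemma near_real (t : R) (S : set R) : nbhs t S ->
  exists2 d : R, 0 < d & forall u, `|u - t| < d -> S u.
Proof.
move=> /(@nbhs_ballP R R)[d d0 dS]; exists d => // u ut; apply: dS.
by rewrite /ball /= distrC.
Qed.

Lemma near_plane (z : R * R) (S : set (R * R)) : nbhs z S ->
  exists2 d : R, 0 < d &
    forall u, `|u.1 - z.1| < d -> `|u.2 - z.2| < d -> S u.
Proof.
move=> /(@nbhs_ballP R (R * R)%type)[d d0 dS]; exists d => // u u1 u2; apply: dS.
by split; rewrite /ball /= distrC.
Qed.

Lemma seg01_closed a b : closed (seg01 a b).
Proof.
have -> : seg01 a b = [set t | a <= t] `&` [set t | t <= b].
  by apply/seteqP; split=> t /= => [/andP[]|[? ?]] //; exact/andP.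
by apply: closedI; [exact: closed_ge|exact: closed_le].
Qed.

Lemma lifts_unique (a b c : R) (g : R -> X) v1 v2 : continuous g ->
  lifts (seg01 a b) g v1 -> lifts (seg01 a b) g v2 -> seg01 a b c ->
  v1 c = v2 c -> forall t, seg01 a b t -> v1 t = v2 t.
Proof.
move=> cg l1 l2 cab v12.
have [ab|ba] := ltP a b; last first.
  by move=> t tab; have -> : t = c by move: tab cab; rewrite /seg01 /=; lra.
suff H : (exists2 c, a <= c <= b & v1 c = v2 c) ->
    forall t, a <= t <= b -> v1 t = v2 t by apply: H; exists c.
apply: (@interval_bisection R (fun a b => (exists2 c, a <= c <= b & v1 c = v2 c) ->
    forall t, a <= t <= b -> v1 t = v2 t)) => // [{cab c v12} p q pq P1 P2|t tab].
  set m := (p + q) / 2 in P1 P2 *.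
  have mpq : p <= m <= q by rewrite /m; lra.
  have both : v1 m = v2 m -> forall t, p <= t <= q -> v1 t = v2 t.
    move=> vm t tpq; have [tm|mt] := leP t m.
      by apply: P1; [exists m => //; lra|lra].
    by apply: P2; [exists m => //; lra|lra].
  move=> [c cpq vc]; apply: both; have [cm|mc] := leP c m.
    by apply: P1; [exists c => //; lra|lra].
  by apply: P2; [exists c => //; lra|lra].
have [W1 [s1 [oW1 W1t fs1 vs1]]] := l1 t tab.
have [W2 [s2 [oW2 W2t fs2 vs2]]] := l2 t tab.
have [V [oV Vt VW [uniq _ _]]] := flat_elementary (openI oW1 oW2) (conj W1t W2t).
have fs1' : flat V s1 by apply: flat_sub fs1 _ => y /VW[].
have fs2' : flat V s2 by apply: flat_sub fs2 _ => y /VW[].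
have nV : \forall u \near t, V (g u) by apply: cg; exact: open_nbhs_nbhs.
have [d d0 dH] := near_real (filterI nV (filterI vs1 vs2)).
exists d => // p q pq pqd tpq ap qb [u upq vu] w wpq.
have bl x : p <= x <= q -> `|x - t| < d.
  by move=> xpq; rewrite ltr_norml; lra.
have [Vu [e1 e2]] := dH u (bl u upq); have [Vw [e1' e2']] := dH w (bl w wpq).
rewrite e1' ?e2' /seg01 /=; [|lra|lra].
apply: (uniq _ _ (g u)) => //; rewrite -e1 -?e2 //; rewrite /seg01 /=; lra.
Qed.

Definition liftable (Z : topologicalType) (h : Z -> X) (D : set Z) :=
  forall z a, D z -> germ_value (h z) a -> exists2 v, lifts D h v & v z = a.

(** The two sets meet along the path [e], on which two lifts agree as soon as
    they agree at one point. *)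
Lemma liftable_union (Z : topologicalType) (h : Z -> X) (D1 D2 : set Z)
    (e : R -> Z) (c d : R) : continuous h -> continuous e -> c <= d ->
  closed D1 -> closed D2 ->
  (forall t, seg01 c d t -> D1 (e t) /\ D2 (e t)) ->
  (forall z, D1 z -> D2 z -> exists2 t, seg01 c d t & e t = z) ->
  liftable h D1 -> liftable h D2 -> liftable h (D1 `|` D2).
Proof.
move=> ch ce cd cD1 cD2 eD De L1 L2 z a Dz az.
have ccd : seg01 c d c by rewrite /seg01 /=; lra.
have [D1c D2c] := eD c ccd.
have che : continuous (h \o e) by move=> t; apply: continuous_comp; [exact: ce|exact: ch].
have agree v1 v2 : lifts D1 h v1 -> lifts D2 h v2 -> v1 (e c) = v2 (e c) ->
    forall z, D1 z -> D2 z -> v1 z = v2 z.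
  move=> l1 l2 v12 z' D1z D2z; have [t tcd <-] := De z' D1z D2z.
  apply: (@lifts_unique c d c (h \o e) (v1 \o e) (v2 \o e)) => //.
    by apply: lifts_comp l1 => // u /eD[].
  by apply: lifts_comp l2 => // u /eD[].
have [D1z|nD1] := pselect (D1 z).
  have [v1 l1 v1z] := L1 z a D1z az.
  have [v2 l2 v2c] := L2 (e c) (v1 (e c)) D2c (lifts_value l1 D1c).
  exists (fun z => if pselect (D1 z) then v1 z else v2 z).
    by apply: lifts_glue => //; exact: agree.
  by case: pselect.
have D2z : D2 z by case: Dz.
have [v2 l2 v2z] := L2 z a D2z az.
have [v1 l1 v1c] := L1 (e c) (v2 (e c)) D1c (lifts_value l2 D2c).
exists (fun z => if pselect (D1 z) then v1 z else v2 z).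
  by apply: lifts_glue => //; exact: agree.
by case: pselect.
Qed.

Definition box (a b c d : R) : set (R * R) :=
  [set z | a <= z.1 <= b /\ c <= z.2 <= d].

Lemma box_closed a b c d : closed (box a b c d).
Proof.
have -> : box a b c d = fst @^-1` seg01 a b `&` snd @^-1` seg01 c d by [].
have cf : continuous (fst : R * R -> R) by move=> z; exact: cvg_fst.
have cs : continuous (snd : R * R -> R) by move=> z; exact: cvg_snd.
apply: closedI; apply: closed_comp; try exact: seg01_closed.
  by move=> z _; exact: cf.
by move=> z _; exact: cs.
Qed.

Lemma continuous_pair (Z T T' : topologicalType) (f : Z -> T) (g : Z -> T') :
  continuous f -> continuous g -> continuous (fun z => (f z, g z)).
Proof. by move=> cf cg z; apply: cvg_pair; [exact: cf|exact: cg]. Qed.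

(** Small boxes are liftable; bisection is applied to one coordinate at a
    time. *)
Lemma liftable_square (h : R * R -> X) : continuous h ->
  liftable h (box 0 1 0 1).
Proof.
move=> ch.
have splitx a b c d : c <= d -> a < b -> liftable h (box a ((a + b) / 2) c d) ->
    liftable h (box ((a + b) / 2) b c d) -> liftable h (box a b c d).
  move=> cd ab; set m := (a + b) / 2 => L1 L2.
  have amb : a < m < b by rewrite /m; lra.
  have -> : box a b c d = box a m c d `|` box m b c d.
    apply/seteqP; split=> -[x y]; rewrite /box /=.
      by move=> [x1 y1]; have [xm|mx] := leP x m; [left|right]; split; lra.
    by move=> [[x1 y1]|[x1 y1]]; split; lra.
  apply: (@liftable_union _ h _ _ (fun t => (m, t)) c d) => //.
  - by apply: continuous_pair => t; [exact: cvg_cst|exact: cvg_id].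
  - exact: box_closed.
  - exact: box_closed.
  - by move=> t; rewrite /seg01 /box /= => tcd; split; split; lra.
  - move=> [x y]; rewrite /seg01 /box /= => -[x1 y1] [x2 y2]; exists y => //.
    by congr (_, _); lra.
have splity a b c d : a <= b -> c < d -> liftable h (box a b c ((c + d) / 2)) ->
    liftable h (box a b ((c + d) / 2) d) -> liftable h (box a b c d).
  move=> ab cd; set m := (c + d) / 2 => L1 L2.
  have cmd : c < m < d by rewrite /m; lra.
  have -> : box a b c d = box a b c m `|` box a b m d.
    apply/seteqP; split=> -[x y]; rewrite /box /=.
      by move=> [x1 y1]; have [ym|my] := leP y m; [left|right]; split; lra.
    by move=> [[x1 y1]|[x1 y1]]; split; lra.
  apply: (@liftable_union _ h _ _ (fun t => (t, m)) a b) => //.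
  - by apply: continuous_pair => t; [exact: cvg_id|exact: cvg_cst].
  - exact: box_closed.
  - exact: box_closed.
  - by move=> t; rewrite /seg01 /box /= => tcd; split; split; lra.
  - move=> [x y]; rewrite /seg01 /box /= => -[x1 y1] [x2 y2]; exists x => //.
    by congr (_, _); lra.
have local x y : exists2 e : R, 0 < e & forall a b c d, a <= x <= b ->
    c <= y <= d -> b - a < e -> d - c < e -> liftable h (box a b c d).
  have [V [oV Vz _ [_ ext _]]] := flat_elementary openT (I : setT (h (x, y))).
  have nV : nbhs (x, y) (h @^-1` V) by apply: ch; exact: open_nbhs_nbhs.
  have [e e0 eV] := near_plane nV.
  exists e => // a b c d xab ycd ba dc.
  have VB z : box a b c d z -> V (h z).
    case: z => u w [/= uab wcd]; by apply: eV; rewrite /= ltr_norml; lra.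
  move=> z al Bz [W [s [oW Wz fs sz]]].
  have [t ft tz] := ext (h z) W s (VB z Bz) oW Wz fs.
  by exists (t \o h); [exact: lifts_section ft VB|rewrite /= tz].
apply: (@interval_bisection R (fun a b => liftable h (box a b 0 1))) => //.
  by move=> a b ab; exact: splitx.
move=> x x01.
have := @interval_bisection R (fun c d => exists2 e : R, 0 < e &
  forall a b, a < b -> b - a < e -> a <= x <= b -> liftable h (box a b c d)) 0 1 ltr01.
case.
- move=> c d cd [e1 e10 L1] [e2 e20 L2]; exists (Num.min e1 e2).
    by rewrite lt_min e10.
  move=> a b ab; rewrite lt_min => /andP[b1 b2] xab.
  by apply: splity; [exact: ltW|exact: cd|exact: L1|exact: L2].
- move=> y y01; have [e e0 L] := local x y; exists e => // c d cd dce ycd _ _.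
  by exists e => // a b ab bae xab; exact: L.
by move=> e e0 L; exists e => // a b ab bae xab _ _; exact: L.
Qed.

(** The projection of the line onto the unit interval; it turns maps that are
    continuous on the interval or the square into globally continuous ones. *)
Definition clamp (t : R) : R := Num.max 0 (Num.min 1 t).

Lemma clamp_id t : 0 <= t <= 1 -> clamp t = t.
Proof. by move=> /andP[t0 t1]; rewrite /clamp min_r // max_r. Qed.

Lemma clamp01 t : 0 <= clamp t <= 1.
Proof. by rewrite /clamp le_max lexx /= ge_max ler01 ge_min lexx. Qed.

Lemma clamp_continuous : continuous clamp.
Proof.
move=> t; apply: (@continuous_max R R (cst 0) (cst 1 \min id) t).
  exact: cvg_cst.
by apply: continuous_min; [exact: cvg_cst|exact: cvg_id].
Qed.

Lemma continuous_within_comp (Z Z' : topologicalType) (D : set Z) (H : Z -> X)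
    (c : Z' -> Z) : {within D, continuous H} -> continuous c ->
  (forall z, D (c z)) -> continuous (H \o c).
Proof.
move=> /subspace_continuousP cH cc cD z P nP.
have N : \forall w \near c z, D w -> P (H w) := cH _ (cD z) P nP.
have N' : \forall u \near z, D (c u) -> P (H (c u)) := cc z _ N.
by apply: filterS N' => u; apply; exact: cD.
Qed.

Lemma continuous_glue (Z : topologicalType) (D1 D2 : set Z) (f1 f2 : Z -> X) :
  continuous f1 -> continuous f2 -> closed D1 -> closed D2 ->
  (forall z, D1 z \/ D2 z) -> (forall z, D1 z -> D2 z -> f1 z = f2 z) ->
  continuous (fun z => if pselect (D1 z) then f1 z else f2 z).
Proof.
move=> c1 c2 cD1 cD2 D12 f12 z P.
have out (D : set Z) : closed D -> ~ D z -> \forall z' \near z, ~ D z'.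
  by move=> cD nD; exact: (@open_nbhs_nbhs _ z (~` D) (conj (closed_openC cD) nD)).
have [D2z|nD2] := pselect (D2 z); last first.
  case: pselect => [D1z|nD1]; last by case: (D12 z).
  move=> nP; have N : \forall z' \near z, P (f1 z') := c1 z _ nP.
  apply: filterS (filterI N (out _ cD2 nD2)) => z' [Pz' nD2z'] /=.
  by case: pselect => // nD1z'; case: (D12 z').
case: pselect => [D1z|nD1] nP; last first.
  have N : \forall z' \near z, P (f2 z') := c2 z _ nP.
  apply: filterS (filterI N (out _ cD1 nD1)) => z' [Pz' nD1z'] /=.
  by case: pselect.
have N1 : \forall z' \near z, P (f1 z') := c1 z _ nP.
rewrite f12 // in nP.
have N2 : \forall z' \near z, P (f2 z') := c2 z _ nP.
by apply: filterS (filterI N1 N2) => z' [P1 P2] /=; case: pselect.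
Qed.

(** Continuation along paths, an equivalence relation on the space of germs. *)
Definition joined (x : X) (a : A) (y : X) (b : A) :=
  exists g v, [/\ continuous g, lifts (seg01 0 1) g v,
    g 0 = x /\ g 1 = y & v 0 = a /\ v 1 = b].

Lemma affine_continuous (p q : R) : continuous (fun t : R => p * t + q).
Proof.
move=> t; apply: cvgD; last exact: cvg_cst.
by apply: cvgM; [exact: cvg_cst|exact: cvg_id].
Qed.

Lemma joined_sym x a y b : joined x a y b -> joined y b x a.
Proof.
move=> [g [v [cg lv [g0 g1] [v0 v1]]]].
pose e (t : R) := -1 * t + 1; have ce : continuous e by exact: affine_continuous.
have e0 : e 0 = 1 by rewrite /e; lra.
have e1 : e 1 = 0 by rewrite /e; lra.
exists (g \o e), (v \o e); rewrite /= e0 e1; split=> //.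
  by move=> t; apply: continuous_comp; [exact: ce|exact: cg].
by apply: lifts_comp lv => // t; rewrite /seg01 /e /=; lra.
Qed.

Lemma joined_trans x a y b z c : joined x a y b -> joined y b z c ->
  joined x a z c.
Proof.
move=> [g [v [cg lv [g0 g1] [v0 v1]]]] [g' [v' [cg' lv' [g'0 g'1] [v'0 v'1]]]].
pose e (t : R) := 2 * t + 0; have ce : continuous e by exact: affine_continuous.
pose e' (t : R) := 2 * t + -1.
have ce' : continuous e' by exact: affine_continuous.
have eh (t : R) : t <= 2^-1 -> 2^-1 <= t -> e t = 1 /\ e' t = 0.
  by move=> t1 t2; rewrite /e /e'; split; lra.
have e0 : e 0 = 0 by rewrite /e; lra.
have e'1 : e' 1 = 1 by rewrite /e'; lra.
have half1 : 2^-1 < 1 :> R by rewrite invf_lt1 // ltr1n.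
have n12 : (1 <= 2^-1 :> R) -> False by rewrite leNgt half1.
pose D1 : set R := [set t | t <= 2^-1]; pose D2 : set R := [set t | 2^-1 <= t].
have cD1 : closed D1 by exact: closed_le.
have cD2 : closed D2 by exact: closed_ge.
pose k t := if pselect (D1 t) then g (e t) else g' (e' t).
have ck : continuous k.
  apply: (continuous_glue (f1 := g \o e) (f2 := g' \o e') _ _ cD1 cD2).
  - by move=> t; apply: continuous_comp; [exact: ce|exact: cg].
  - by move=> t; apply: continuous_comp; [exact: ce'|exact: cg'].
  - by move=> t; rewrite /D1 /D2 /=; case: (leP t 2^-1) => ?; [left|right; exact: ltW].
  - by move=> t t1 t2 /=; have [-> ->] := eh t t1 t2; rewrite g1 g'0.
have l1 : lifts (seg01 0 2^-1) k (v \o e).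
  apply: (@lifts_eq _ _ (g \o e)).
    by move=> t; rewrite /seg01 /k /D1 /= => /andP[_ th]; case: pselect.
  by apply: lifts_comp lv => // t; rewrite /seg01 /e /=; lra.
have l2 : lifts (seg01 2^-1 1) k (v' \o e').
  apply: (@lifts_eq _ _ (g' \o e')).
    move=> t; rewrite /seg01 /k /D1 /= => /andP[th _]; case: pselect => // th'.
    by have [-> ->] := eh t th' th; rewrite g1 g'0.
  by apply: lifts_comp lv' => // t; rewrite /seg01 /e' /=; lra.
have := lifts_glue ck (@seg01_closed _ _) (@seg01_closed _ _) l1 l2.
have -> : seg01 0 2^-1 `|` seg01 2^-1 1 = seg01 0 1.
  apply/seteqP; split=> t; rewrite /seg01 /=; first by case; lra.
  by move=> t01; have [th|th] := leP t 2^-1; [left|right]; lra.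
move=> lk; exists k, (fun t => if pselect (seg01 0 2^-1 t) then (v \o e) t else (v' \o e') t).
split=> //.
- apply: lk => t; rewrite /seg01 /= => /andP[_ t1] /andP[t2 _].
  by have [-> ->] := eh t t1 t2; rewrite v1 v'0.
- rewrite /k /D1 /=; split.
    by case: pselect => [?|]; [rewrite e0|rewrite invr_ge0].
  by case: pselect => [h|?]; [case: (n12 h)|rewrite e'1].
- rewrite /seg01 /=; split.
    by case: pselect => [?|]; [rewrite e0|rewrite lexx invr_ge0 ler0n].
  by case: pselect => [h|?]; [have /andP[_ /n12] := h|rewrite e'1].
Qed.

(** A contraction of the loop lifts to the square, and the lift is constant on
    the three sides of the square that are mapped to [x]. *)
Lemma joined_loop x a b : simply_connected R X -> joined x a x b -> a = b.
Proof.
move=> [_ sc] [g [v [cg lv [g0 g1] [v0 v1]]]].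
have in01 (t : R) : t \in `[0, 1] = (0 <= t <= 1) by rewrite in_itv.
have [|H [cH Hst Hs]] := sc g (continuous_subspaceT cg); first by rewrite g0 g1.
pose h (z : R * R) := H (clamp z.1, clamp z.2).
have ch : continuous h.
  apply: (continuous_within_comp cH (c := fun z : R * R => (clamp z.1, clamp z.2))).
    apply: continuous_pair => z.
      by apply: continuous_comp; [exact: cvg_fst|exact: clamp_continuous].
    by apply: continuous_comp; [exact: cvg_snd|exact: clamp_continuous].
  by move=> z; split; rewrite /= in_itv /=; exact: clamp01.
have c0 : clamp 0 = 0 by rewrite clamp_id // lexx ler01.
have c1 : clamp 1 = 1 by rewrite clamp_id // lexx ler01.
have hl t : seg01 0 1 t -> h (0, t) = g t.
  by move=> t01; rewrite /h /= c0 clamp_id //; case: (Hst t); rewrite ?in01.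
have hr t : seg01 0 1 t -> h (1, t) = x.
  by move=> t01; rewrite /h /= c1 clamp_id // -g0; case: (Hst t); rewrite ?in01.
have hb s : seg01 0 1 s -> h (s, 0) = x.
  by move=> s01; rewrite /h /= c0 clamp_id // -g0; case: (Hs s); rewrite ?in01.
have ht s : seg01 0 1 s -> h (s, 1) = x.
  by move=> s01; rewrite /h /= c1 clamp_id // -g0; case: (Hs s); rewrite ?in01.
have s0 : seg01 0 1 0 by rewrite /seg01 /= lexx ler01.
have s1 : seg01 0 1 1 by rewrite /seg01 /= lexx ler01.
have B00 : box 0 1 0 1 (0, 0) by [].
have [|w lw w00] := liftable_square ch (a := a) B00.
  by rewrite hl // -v0; exact: lifts_value lv s0.
have side (e : R -> R * R) : continuous e -> (forall t, seg01 0 1 t -> box 0 1 0 1 (e t)) ->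
    lifts (seg01 0 1) (h \o e) (w \o e).
  by move=> ce eB; exact: lifts_comp ce eB lw.
have ch1 t : continuous (fun s : R => (s, t) : R * R).
  by apply: continuous_pair => s; [exact: cvg_id|exact: cvg_cst].
have ch2 s : continuous (fun t : R => (s, t) : R * R).
  by apply: continuous_pair => t; [exact: cvg_cst|exact: cvg_id].
have const (e : R -> R * R) : continuous e ->
    (forall t, seg01 0 1 t -> box 0 1 0 1 (e t)) ->
    (forall t, seg01 0 1 t -> h (e t) = x) -> w (e 0) = w (e 1).
  move=> ce eB ex.
  have lc : lifts (seg01 0 1) (fun _ => x) (w \o e).
    by apply: lifts_eq (side e ce eB).
  have [W [s [oW Wx fs sx]]] := lifts_value lc s0.
  have l2 : lifts (seg01 0 1) (fun _ : R => x) (s \o (fun _ : R => x)).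
    exact: lifts_section oW fs _.
  have cx : continuous (fun _ : R => x) by move=> ?; exact: cvg_cst.
  have U := lifts_unique cx lc l2 s0.
  have {}U := U (esym sx).
  by rewrite -/((w \o e) 0) -/((w \o e) 1) U // U.
have E1 : w (0, 1) = b.
  have l : lifts (seg01 0 1) g (w \o (fun t => (0, t))).
    by apply: lifts_eq hl _; apply: side => // t t01; split.
  have := lifts_unique cg l lv s0; rewrite /= w00 v0 => /(_ erefl) U.
  by rewrite -v1; exact: U.
rewrite -w00 -E1.
transitivity (w (1, 0)).
  by apply: (const (fun s => (s, 0))) => // t t01; split.
transitivity (w (1, 1)).
  by apply: (const (fun s => (1, s))) => // t t01; split.
by apply/esym; apply: (const (fun s => (s, 1))) => // t t01; split.
Qed.

(** The points to which a germ at a base point can be continued form an open and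
    closed set, hence all of [X]; the result does not depend on the path by
    [joined_loop]. *)
Lemma monodromy : simply_connected R X ->
  (forall x, exists a, germ_value x a) ->
  exists sg : X -> A, forall x, exists V s,
    [/\ open V, V x, flat V s & forall y, V y -> sg y = s y].
Proof.
move=> sc ex.
have [[x0 _]|nX] := pselect (exists x : X, True); last first.
  have [sg _] := choice ex.
  by exists sg => x; case: nX; exists x.
have [a0 va0] := ex x0.
have cont V s y z : open V -> elementary V -> flat V s -> V y -> V z ->
    joined y (s y) z (s z).
  move=> oV [_ _ path] fs Vy Vz; have [g [cg g0 g1 gV]] := path y z Vy Vz.
  exists g, (s \o g); rewrite /= g0 g1; split=> //.
  by apply: lifts_section oV fs _ => t _; exact: gV.
have nbh x : exists V, [/\ open V, V x & elementary V].
  by have [V [oV Vx _ eV]] := flat_elementary openT (I : setT x); exists V.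
pose S : set X := [set x | exists2 a, germ_value x a & joined x0 a0 x a].
have spread x V a : open V -> V x -> elementary V -> germ_value x a ->
    joined x0 a0 x a -> exists s, [/\ flat V s, s x = a &
      forall y, V y -> joined x0 a0 y (s y)].
  move=> oV Vx eV [W [t [oW Wx ft ta]]] ja.
  have [_ ext _] := eV; have [s fs sx] := ext x W t Vx oW Wx ft.
  exists s; split=> //; first by rewrite sx.
  move=> y Vy; apply: joined_trans (cont V s x y oV eV fs Vx Vy).
  by rewrite sx ta.
have ST : S = setT.
  have [conn _] := sc; apply: conn.
  - exists x0, a0 => //.
    have [W [s [oW Wx fs sa]]] := va0.
    exists (fun _ => x0), (s \o (fun _ : R => x0)); split=> //.
      by move=> ?; exact: cvg_cst.
    exact: lifts_section oW fs _.
  - exists S; last by rewrite setTI.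
    rewrite openE => x [a va ja]; have [V [oV Vx eV]] := nbh x.
    have [s [fs sx js]] := spread x V a oV Vx eV va ja.
    have nV : nbhs x V by exact: open_nbhs_nbhs.
    apply: filterS nV => y Vy; exists (s y); last exact: js.
    by exists V, s.
  - exists S; last by rewrite setTI.
    rewrite -[S]setCK; apply: open_closedC; rewrite openE => x nSx.
    have [V [oV Vx eV]] := nbh x.
    have nV : nbhs x V by exact: open_nbhs_nbhs.
    apply: filterS nV => y Vy [a va ja]; apply: nSx.
    have [s [fs sy js]] := spread y V a oV Vy eV va ja.
    by exists (s x); [exists V, s|exact: js].
have all x : exists a, germ_value x a /\ joined x0 a0 x a.
  have [a va ja] : S x by rewrite ST.
  by exists a.
have [sg sgP] := choice all.
exists sg => x; have [V [oV Vx eV]] := nbh x.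
have [va ja] := sgP x.
have [s [fs sx js]] := spread x V (sg x) oV Vx eV va ja.
exists V, s; split=> // y Vy.
apply: (@joined_loop y) => //.
by apply: joined_trans (joined_sym (proj2 (sgP y))) (js y Vy).
Qed.

End Monodromy.

(** * Holomorphic maps between manifolds *)

Section Charts.
Variables (R : realType) (E : normedModType R[i]) (T : topologicalType).
Variable c : chart E T.

Lemma chart_dom_near x : chart_dom c x -> \forall y \near x, chart_dom c y.
Proof. by move=> cx; apply: open_nbhs_nbhs; split=> //; exact: chart_dom_open. Qed.

Lemma chart_near x (P : set T) : chart_dom c x -> (\forall y \near x, P y) ->
  \forall w \near chart_map c x, exists y, [/\ chart_dom c y, chart_map c y = w,
    chart_inv c w = y & P y].
Proof.
move=> cx nP.
have N1 : \forall w \near chart_map c x, (chart_map c @` chart_dom c) w.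
  by apply: open_nbhs_nbhs; split; [exact: chart_codom_open|exists x].
have N2 : \forall w \near chart_map c x, P (chart_inv c w).
  by apply: (chart_inv_continuous cx); rewrite /= chart_mapK.
apply: filterS (filterI N1 N2) => w [[y cy <-]]; rewrite chart_mapK // => Py.
by exists y; split=> //; rewrite chart_mapK.
Qed.

End Charts.

Section Holomorphy.
Variables (R : realType).
Local Notation K := (R[i]^o).
Local Notation cda := complex_differentiable_at.

Lemma cda_near (E E' : normedModType R[i]) (M : complex_manifold E)
    (N : complex_manifold E') (f g : M -> N) (x : M) :
  (\forall y \near x, f y = g y) -> cda f x -> cda g x.
Proof.
move=> fg [cf df]; have fgx := nbhs_singleton fg; split.
  move=> P; rewrite -fgx => nP; have NP : \forall y \near x, P (f y) := cf _ nP.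
  by apply: filterS (filterI fg NP) => y [e Py]; rewrite /= -e.
move=> c d Ac Ad cx dgx; rewrite -fgx in dgx.
apply: near_differentiable (df c d Ac Ad cx dgx).
apply: filterS (chart_near cx fg) => w [y [cy _ yw e]] /=.
by rewrite yw e.
Qed.

Lemma cda_comp (E E' E'' : normedModType R[i]) (M : complex_manifold E)
    (N : complex_manifold E') (P : complex_manifold E'') (f : M -> N)
    (g : N -> P) (x : M) : cda f x -> cda g (f x) -> cda (g \o f) x.
Proof.
move=> [cf df] [cg dg]; split.
  exact: (@continuous_comp _ _ _ f g x cf cg).
move=> c e Ac Ae cx egx.
have [d Ad dfx] := atlas_cover (f x).
have fx : chart_map d (f (chart_inv c (chart_map c x))) = chart_map d (f x).
  by rewrite chart_mapK.
have D1 := df c d Ac Ad cx dfx.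
have D2 : differentiable (chart_map e \o g \o chart_inv d)
    ((chart_map d \o f \o chart_inv c) (chart_map c x)).
  by rewrite /= fx; exact: dg.
apply: near_differentiable (differentiable_comp D1 D2).
have Nd : \forall y \near x, chart_dom d (f y) := cf _ (chart_dom_near dfx).
apply: filterS (chart_near cx Nd) => w [y [cy _ yw dy]] /=.
by rewrite yw chart_mapK.
Qed.

Lemma cda_pair (E E' E'' : normedModType R[i]) (M : complex_manifold E)
    (N : complex_manifold E') (P : complex_manifold E'') (f : M -> N)
    (g : M -> P) (x : M) : cda f x -> cda g x ->
  cda (fun y => (f y, g y) : prod_manifold N P) x.
Proof.
move=> [cf df] [cg dg]; split; first by apply: cvg_pair; [exact: cf|exact: cg].
move=> c _ Ac [d [e [Ad Ae ->]]] cx [/= dfx egx].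
by apply: (@differentiable_pair _ _ _ _ (chart_map d \o f \o chart_inv c)
  (chart_map e \o g \o chart_inv c)); [exact: df|exact: dg].
Qed.

Lemma cda_fst (E E' : normedModType R[i]) (M : complex_manifold E)
    (N : complex_manifold E') (z : prod_manifold M N) :
  cda (fst : prod_manifold M N -> M) z.
Proof.
split; first by case: z => x y; exact: cvg_fst.
move=> _ d [c [e [Ac Ae ->]]] Ad [/= cz ez] dz.
apply: (@differentiable_comp _ _ _ _ fst (chart_map d \o chart_inv c)).
  exact: differentiable_fst.
exact: atlas_holomorphic.
Qed.

Lemma cda_snd (E E' : normedModType R[i]) (M : complex_manifold E)
    (N : complex_manifold E') (z : prod_manifold M N) :
  cda (snd : prod_manifold M N -> N) z.
Proof.
split; first by case: z => x y; exact: cvg_snd.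
move=> _ d [c [e [Ac Ae ->]]] Ad [/= cz ez] dz.
apply: (@differentiable_comp _ _ _ _ snd (chart_map d \o chart_inv e)).
  exact: differentiable_snd.
exact: atlas_holomorphic.
Qed.

Lemma cda_id (E : normedModType R[i]) (M : complex_manifold E) (x : M) :
  cda (id : M -> M) x.
Proof. by split; [exact: cvg_id|move=> c d Ac Ad cx dx; exact: atlas_holomorphic]. Qed.

Lemma cda_cst (E E' : normedModType R[i]) (M : complex_manifold E)
    (N : complex_manifold E') (a : N) (x : M) : cda (fun _ : M => a) x.
Proof.
by split; [exact: cvg_cst|move=> c d Ac Ad cx dx; exact: differentiable_cst].
Qed.

Section ScalarFunctions.
Variables (E : normedModType R[i]) (M : complex_manifold E).
Implicit Types (f g : M -> complex_line R) (x : M).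

Lemma cda_scalarP f x : cda f x <->
  forall c, atlas c -> chart_dom c x ->
    differentiable (f \o chart_inv c : E -> K) (chart_map c x).
Proof.
split=> [[_ df] c Ac cx|df].
  exact: (df c (line_chart R) Ac erefl cx I).
split; last by move=> c _ Ac -> cx _; exact: df.
have [c Ac cx] := atlas_cover x.
have cd := differentiable_continuous (df c Ac cx).
have cc : {for x, continuous ((f \o chart_inv c : E -> K) \o chart_map c)}.
  by apply: continuous_comp; [exact: chart_map_continuous|exact: cd].
move=> P nP.
have N : \forall y \near x, P ((f \o chart_inv c) (chart_map c y)).
  by apply: cc; rewrite /= chart_mapK.
apply: filterS (filterI N (chart_dom_near cx)) => y [/= Py cy].
by rewrite chart_mapK in Py.
Qed.

Lemma cda_mul f g x : cda f x -> cda g x ->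
  cda (fun y => f y * g y : complex_line R) x.
Proof.
move=> /cda_scalarP df /cda_scalarP dg; apply/cda_scalarP => c Ac cx.
exact: (differentiableM (df c Ac cx) (dg c Ac cx)).
Qed.

Lemma cda_inv f x : cda f x -> f x != 0 -> cda (fun y => (f y)^-1 : complex_line R) x.
Proof.
move=> /cda_scalarP df fx; apply/cda_scalarP => c Ac cx.
by apply: (differentiableV (df c Ac cx)); rewrite /= chart_mapK.
Qed.

End ScalarFunctions.

Lemma cda_lineP (f : complex_line R -> complex_line R) (z : K) :
  cda f z <-> differentiable (f : K -> K) z.
Proof.
rewrite cda_scalarP; split=> [H|H c -> _]; last exact: H.
exact: (H (line_chart R) erefl I).
Qed.

(** On an open set the local extensions in [holomorphic_on] are the map
    itself. *)
Lemma holomorphic_on_cda (E E' : normedModType R[i]) (M : complex_manifold E)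
    (N : complex_manifold E') (S : set M) (f : M -> N) x :
  holomorphic_on S f -> S x -> (\forall y \near x, S y) -> cda f x.
Proof.
move=> hf Sx NS; have [g [dg fg]] := hf x Sx.
apply: cda_near (nbhs_singleton dg).
by apply: filterS (filterI NS fg) => y [Sy]; move=> ->.
Qed.

Lemma cda_holomorphic_on (E E' : normedModType R[i]) (M : complex_manifold E)
    (N : complex_manifold E') (S : set M) (f : M -> N) :
  (forall x, cda f x) -> holomorphic_on S f.
Proof. by move=> df x Sx; exists f; split; apply: filterE. Qed.

(** The two properties of finite-dimensional spaces that make
    [left_inverse_near] work, kept as hypotheses so that the model space stays
    abstract; [idempotent_near_id] and [linear_inverse_swap] prove them. *)
Definition idempotent_rigid (E : normedModType R[i]) :=
  forall (r : E -> E) (w : E), (\forall y \near w, differentiable r y) ->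
    r w = w -> 'd r w = id :> (E -> E) -> (\forall y \near w, r (r y) = r y) ->
    \forall y \near w, r y = y.

Definition linear_inverse_symmetric (E : normedModType R[i]) :=
  forall f g : {linear E -> E}, (forall x, f (g x) = x) ->
    forall x, g (f x) = x.

(** The map [G \o g] is idempotent, and its derivative at [x0] is the identity
    because a linear left inverse is also a right inverse; so it is the identity
    near [x0].  In particular [G] is onto a neighborhood of [x0]. *)
Lemma left_inverse_near (E : normedModType R[i]) (M N : complex_manifold E)
    (g : M -> N) (G : N -> M) (x0 : M) :
  idempotent_rigid E -> linear_inverse_symmetric E ->
  (\forall x \near x0, cda g x) ->
  (\forall y \near g x0, cda G y) -> G (g x0) = x0 ->
  (\forall y \near g x0, g (G y) = y) ->
  \forall x \near x0, G (g x) = x.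
Proof.
move=> idem swap dg dG Gx0 gG.
have [d Ad dx0] := atlas_cover x0; have [b Ab bx0] := atlas_cover (g x0).
have dg0 := nbhs_singleton dg; have dG0 := nbhs_singleton dG.
pose r' := G \o g.
have cr' : {for x0, continuous r'}.
  exact: (@continuous_comp _ _ _ g G x0 (proj1 dg0) (proj1 dG0)).
have Nd : \forall x \near x0, chart_dom d (r' x).
  by apply: cr'; rewrite /r' /= Gx0; exact: chart_dom_near.
have NG : \forall x \near x0, cda G (g x) := proj1 dg0 _ dG.
have NgG : \forall x \near x0, g (G (g x)) = g x := proj1 dg0 _ gG.
pose r := chart_map d \o r' \o chart_inv d.
pose A := chart_map b \o g \o chart_inv d.
pose B := chart_map d \o G \o chart_inv b.
have dA : differentiable A (chart_map d x0) by apply: (proj2 dg0).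
have A0 : A (chart_map d x0) = chart_map b (g x0) by rewrite /A /= chart_mapK.
have dB : differentiable B (A (chart_map d x0)).
  by rewrite A0; apply: (proj2 dG0) => //; rewrite Gx0.
have B0 : B (chart_map b (g x0)) = chart_map d x0.
  by rewrite /B /= chart_mapK // Gx0.
have Nb : \forall x \near x0, chart_dom b (g x).
  by apply: (proj1 dg0); exact: chart_dom_near.
have NBA : \forall w \near chart_map d x0, (B \o A) w = r w.
  apply: filterS (chart_near dx0 Nb) => w [x [_ _ xw bx]].
  by rewrite /B /A /r /= xw chart_mapK.
have NdG : \forall y \near g x0, chart_dom d (G y).
  by apply: (proj1 dG0); rewrite Gx0; exact: chart_dom_near.
have NAB : \forall w \near chart_map b (g x0), (A \o B) w = w.
  apply: filterS (chart_near bx0 (filterI gG NdG)) => w [y [_ yw wy [gy dy]]].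
  by rewrite /A /B /= wy chart_mapK // gy.
have dBb : differentiable B (chart_map b (g x0)) by rewrite -A0.
have dAb : differentiable A (B (chart_map b (g x0))) by rewrite B0.
have [dr rE] := near_diff NBA (differentiable_comp dA dB).
pose I : E -> E := id.
have app (F F' : E -> E) :
  F = F' -> forall v, F v = F' v by move=> ->.
have ABid v : 'd A (chart_map d x0) ('d B (chart_map b (g x0)) v) = v.
  have dI : differentiable I (chart_map b (g x0)) by exact: ex_diff.
  have IE : 'd I (chart_map b (g x0)) = I :> (_ -> _) by exact: diff_val.
  have NI : \forall w \near chart_map b (g x0), I w = (A \o B) w.
    by apply: filterS NAB => w ->.
  have [_ E1] := near_diff NI dI.
  have E2 := diff_comp dBb dAb; rewrite B0 in E2.
  exact: (etrans (esym (app _ _ E2 v)) (etrans (app _ _ E1 v) (app _ _ IE v))).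
have BAid := swap _ _ ABid.
have dr1 : 'd r (chart_map d x0) = id :> (_ -> _).
  apply/funext => v; apply: (etrans (app _ _ rE v)).
  apply: (etrans (app _ _ (diff_comp dA dB) v)).
  have key q : q = chart_map b (g x0) ->
      'd B q ('d A (chart_map d x0) v) = v by move=> ->; exact: BAid.
  exact: key.
have rw : r (chart_map d x0) = chart_map d x0.
  have r'x0 : r' x0 = x0 by exact: Gx0.
  by rewrite -[in RHS]r'x0 -{2}(chart_mapK dx0).
have Ndr : \forall w \near chart_map d x0, differentiable r w.
  have NN : \forall x \near x0, [/\ chart_dom d (r' x), cda g x & cda G (g x)].
    by apply: filterS (filterI Nd (filterI dg NG)) => x [h1 [h2 h3]]; exact: And3 h1 h2 h3.
  apply: filterS (chart_near dx0 NN) => w [x [dx wx _ [drx gx GGx]]].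
  have D := proj2 (cda_comp gx GGx) d d Ad Ad dx drx.
  by rewrite wx in D.
have Nrr : \forall w \near chart_map d x0, r (r w) = r w.
  have NN : \forall x \near x0, chart_dom d (r' x) /\ g (G (g x)) = g x.
    exact: (filterI Nd NgG).
  apply: filterS (chart_near dx0 NN) => w [x [dx _ wx [drx ggx]]].
  have rr' : r' (r' x) = r' x by rewrite /r' /= ggx.
  have rw1 : r w = chart_map d (r' x) by rewrite /r /= wx.
  by rewrite rw1 /r /= (chart_mapK drx) rr'.
have Nrid := idem _ _ Ndr rw dr1 Nrr.
have Nrid' : \forall x \near x0, r (chart_map d x) = chart_map d x.
  exact: (chart_map_continuous dx0 Nrid).
apply: filterS (filterI (chart_dom_near dx0) (filterI Nd Nrid')) => x [dx [drx]].
rewrite /r /= (chart_mapK dx) => /(congr1 (chart_inv d)).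
by rewrite (chart_mapK drx) (chart_mapK dx).
Qed.

End Holomorphy.

(** * Fiber charts *)

Section FiberCharts.
Variables (R : realType) (E E' : normedModType R[i]).
Variables (X : complex_manifold E) (Y : complex_manifold E').
Variables (p : Y -> X) (U : set Y).
Local Notation K := (R[i]^o).
Local Notation C := (complex_line R).
Local Notation cda := complex_differentiable_at.
Hypothesis p_continuous : continuous p.
Hypothesis U_open : open U.

(** A local trivialization of [U] over [W] with fiber the disc, reduced to its
    first component [f]; the second one is the projection, and [G] is the
    inverse. *)
Definition fiber_chart (W : set X) (f : Y -> C) (G : prod_manifold C X -> Y) :=
  (forall u, U u -> W (p u) -> [/\ nm (f u : K) < 1, G (f u, p u) = u & cda f u]) /\
  (forall x (z : K), W x -> nm z < 1 ->
     [/\ U (G (z, x)), p (G (z, x)) = x, f (G (z, x)) = z & cda G (z, x)]).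

Lemma unit_discE (z : C) : unit_disc z = (nm (z : K) < 1) :> Prop.
Proof.
have H : (`|z : K| < 1) = (nm (z : K) < 1) by rewrite nmE ltcR.
by rewrite -H.
Qed.

Lemma over_near W u : open W -> U u -> W (p u) ->
  \forall v \near u, U v /\ W (p v).
Proof.
move=> oW Uu Wu; apply: filterI; first exact: open_nbhs_nbhs.
by apply: p_continuous; exact: open_nbhs_nbhs.
Qed.

Lemma fiber_chart_exists x :
  holomorphically_locally_trivial (@unit_disc R) U p ->
  exists V f G, [/\ open V, V x & fiber_chart V f G].
Proof.
move=> hlt; have [V [oV Vx] [phi [g [hphi hg phiK gK]] phi2]] := hlt x.
have phiE u : U u -> V (p u) -> phi u = ((phi u).1, p u).
  by move=> Uu Vu; rewrite -(phi2 u Uu Vu); case: (phi u).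
exists V, (fst \o phi), g; split; [exact: oV|exact: Vx|split].
  move=> u Uu Vu; have [[D1 _] gu] := phiK u (conj Uu Vu).
  split; first by move: D1; rewrite unit_discE.
    by rewrite /= -phiE.
  apply: cda_comp; last exact: cda_fst.
  apply: holomorphic_on_cda hphi _ _; first by split.
  exact: (over_near oV Uu Vu).
move=> y z Vy z1.
have DV : (@unit_disc R `*` V) (z, y) by split=> //; rewrite unit_discE.
have [[Ug Vg] gz] := gK (z, y) DV.
split=> //.
- by rewrite -phi2 // gz.
- by rewrite /= gz.
apply: holomorphic_on_cda hg DV _.
have N1 : \forall q \near ((z, y) : prod_manifold C X), nm (q.1 : K) < 1.
  have oD : open (@unit_disc R).
    rewrite openE => w; rewrite unit_discE => w1; apply/(@nbhs_nm _ K).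
    exists (1 - nm (w : K)); first by rewrite subr_gt0.
    move=> v vw; rewrite unit_discE.
    by have := nmD (v - w : K) w; rewrite subrK; lra.
  have ND : nbhs z (@unit_disc R).
    by apply: open_nbhs_nbhs; split=> //; rewrite unit_discE.
  have N : \forall q \near ((z, y) : prod_manifold C X), unit_disc q.1 :=
    proj1 (cda_fst ((z, y) : prod_manifold C X)) _ ND.
  by apply: filterS N => q; rewrite unit_discE.
have N2 : \forall q \near ((z, y) : prod_manifold C X), V q.2.
  by apply: (proj1 (cda_snd ((z, y) : prod_manifold C X))); exact: open_nbhs_nbhs.
by apply: filterS (filterI N1 N2) => q [q1 q2]; split=> //; rewrite unit_discE.
Qed.

Lemma fiber_chart_sub V W f G : fiber_chart W f G -> V `<=` W ->
  fiber_chart V f G.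
Proof.
move=> [H1 H2] VW; split; first by move=> u Uu /VW; exact: H1.
by move=> x z /VW; exact: H2.
Qed.

Lemma cda_slice (G : prod_manifold C X -> Y) (z : C) x : cda G (z, x) ->
  cda (fun z : C => G (z, x)) z.
Proof.
move=> dG; apply: (@cda_comp _ _ _ _ _ _ _
  (fun z : C => (z, x) : prod_manifold C X) G) => //.
by apply: cda_pair; [exact: cda_id|exact: cda_cst].
Qed.

(** The transition between two fiber charts at a point is an automorphism of
    the disc; composing with it, the value at that point of one chart is
    extended over the domain of the other. *)
Lemma fiber_chart_extend V W f0 G0 f' G' y : fiber_chart V f0 G0 ->
  fiber_chart W f' G' -> V y -> W y ->
  exists f G, fiber_chart V f G /\ forall u, U u -> p u = y -> f u = f' u.
Proof.
move=> [H1 H2] [H1' H2'] Vy Wy.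
pose al (z : C) : C := f' (G0 (z, y)); pose be (z : C) : C := f0 (G' (z, y)).
have alP (z : K) : nm z < 1 -> [/\ nm (al z : K) < 1, be (al z) = z & cda al z].
  move=> z1; have [Uz pz fz dz] := H2 y z Vy z1.
  have [a1 a2 a3] := H1' (G0 (z, y)) Uz ltac:(by rewrite pz).
  split=> //; first by rewrite /be /al -{2}pz a2.
  by apply: (@cda_comp _ _ _ _ _ _ _ (fun z : C => G0 (z, y)) f'); [exact: cda_slice|].
have beP (z : K) : nm z < 1 -> [/\ nm (be z : K) < 1, al (be z) = z & cda be z].
  move=> z1; have [Uz pz fz dz] := H2' y z Wy z1.
  have [a1 a2 a3] := H1 (G' (z, y)) Uz ltac:(by rewrite pz).
  split=> //; first by rewrite /be /al -{2}pz a2.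
  by apply: (@cda_comp _ _ _ _ _ _ _ (fun z : C => G' (z, y)) f0); [exact: cda_slice|].
exists (al \o f0), (fun q => G0 (be q.1, q.2)); split; last first.
  move=> u Uu pu; have [_ Gu _] := H1 u Uu ltac:(by rewrite pu).
  by rewrite /= /al -pu Gu.
split.
  move=> u Uu Vu; have [f01 Gu df] := H1 u Uu Vu; have [a1 a2 a3] := alP _ f01.
  split=> //; first by rewrite /= a2.
  by apply: cda_comp.
move=> x z Vx z1; have [b1 b2 b3] := beP z z1; have [Ux px fx dx] := H2 x _ Vx b1.
split=> //; first by rewrite /= fx b2.
apply: (@cda_comp _ _ _ _ _ _ _
  (fun q : prod_manifold C X => (be q.1, q.2) : prod_manifold C X) G0) => //.
apply: cda_pair; last exact: cda_snd.
exact: (@cda_comp _ _ _ _ _ _ _ (fst : prod_manifold C X -> C) be (z, x)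
  (cda_fst _) b3).
Qed.

Definition chart_ball (c : chart E X) (w0 : E) (rho : R) : set X :=
  [set x | chart_dom c x /\ nm (chart_map c x - w0) < rho].

Definition ball_in_codom (c : chart E X) (w0 : E) (rho : R) :=
  forall w, nm (w - w0) < rho -> exists2 x, chart_dom c x & chart_map c x = w.

Lemma convex_ball (w0 a b : E) (rho t : R) : nm (a - w0) < rho ->
  nm (b - w0) < rho -> 0 <= t <= 1 ->
  nm (a + ((t%:C)%C : K) *: (b - a) - w0) < rho.
Proof.
move=> a1 b1 /andP[t0 t1]; set s : K := (t%:C)%C.
have ns : nm s = t by rewrite nmR ger0_norm.
have ns' : nm (1 - s) = 1 - t.
  have -> : 1 - s = ((1 - t)%:C)%C by rewrite (rmorphB (real_complex R)).
  by rewrite nmR ger0_norm // subr_ge0.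
have ba : b - a = (b - w0) - (a - w0) by rewrite opprB addrA subrK.
have -> : a + s *: (b - a) - w0 = (1 - s) *: (a - w0) + s *: (b - w0).
  by rewrite ba addrAC [s *: (_ - _)]scalerBr scalerBl scale1r addrA addrAC.
apply: le_lt_trans (nmD _ _) _; rewrite !nmZ ns ns'.
have mr : Num.max (nm (a - w0)) (nm (b - w0)) < rho by rewrite gt_max a1.
apply: le_lt_trans mr; set m := Num.max _ _.
have am : nm (a - w0) <= m by rewrite le_max lexx.
have bm : nm (b - w0) <= m by rewrite le_max lexx orbT.
nra.
Qed.

(** Along the complex line through two points of the ball, the transition maps
    from the first chart to the second form a holomorphic family of
    automorphisms of the disc, which is constant. *)
Lemma fiber_chart_unique (c : chart E X) (w0 : E) (rho : R) f1 G1 f2 G2 y z :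
  atlas c -> ball_in_codom c w0 rho ->
  fiber_chart (chart_ball c w0 rho) f1 G1 ->
  fiber_chart (chart_ball c w0 rho) f2 G2 ->
  chart_ball c w0 rho y -> chart_ball c w0 rho z ->
  (forall u, U u -> p u = y -> f1 u = f2 u) ->
  forall u, U u -> p u = z -> f1 u = f2 u.
Proof.
move=> Ac cod [A1 B1] [A2 B2] [cy yb] [cz zb] f12.
set W := chart_ball c w0 rho in A1 A2 B1 B2.
set a := chart_map c y in yb; set b := chart_map c z in zb.
pose line (t : K) : E := a + t *: (b - a).
pose xt (t : K) : X := chart_inv c (line t).
pose O : set K := [set t | nm (line t - w0) < rho].
have OP t : O t -> [/\ chart_dom c (xt t), chart_map c (xt t) = line t & W (xt t)].
  move=> Ot; have [x cx xl] := cod _ Ot.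
  have -> : xt t = x by rewrite /xt -xl chart_mapK.
  by split=> //; split=> //; rewrite xl.
have Wy : W y by split.
have Wz : W z by split.
have trans f G f' G' : fiber_chart W f G -> fiber_chart W f' G' ->
    let phi := fun q : K * K => f' (G (q.2, xt q.1)) : K in
    forall t v, O t -> nm v < 1 -> [/\ differentiable phi (t, v),
      nm (phi (t, v)) < 1 & f (G' (phi (t, v), xt t)) = v].
  move=> [H1 H2] [H1' H2'] phi t v Ot v1.
  have [cx xl Wx] := OP t Ot.
  have [Ug pg fg dg] := H2 (xt t) v Wx v1.
  have [f'1 G'f df'] := H1' _ Ug ltac:(by rewrite pg).
  split=> //; last by rewrite /phi /= -{2}pg G'f fg.
  have dPhi : cda (f' \o G) ((v, xt t) : prod_manifold C X) by exact: cda_comp.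
  have Apc : atlas (prod_chart (line_chart R) c : chart _ (prod_manifold C X)).
    by exists (line_chart R), c.
  have /cda_scalarP/(_ _ Apc (conj I cx)) D := dPhi.
  pose e (q : K * K) : (K * E)%type := (q.2, line q.1).
  have de : differentiable e (t, v).
    apply: differentiable_pair; first exact: differentiable_snd.
    apply: (@differentiable_comp _ _ _ _ fst line); first exact: differentiable_fst.
    have [|dl _] := @line_diff _ _ _ (id : E -> E) a (b - a) t; last exact: dl.
    exact: ex_diff.
  have E0 : chart_map (prod_chart (line_chart R) c) (v, xt t) = e (t, v).
    by rewrite /e /= /prod_chart_map /= xl.
  rewrite E0 in D.
  exact: (differentiable_comp de D).
have fc1 : fiber_chart W f1 G1 by [].
have fc2 : fiber_chart W f2 G2 by [].
have T12 := trans _ _ _ _ fc1 fc2; have T21 := trans _ _ _ _ fc2 fc1.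
have const v : nm v < 1 -> f2 (G1 (v, xt 1)) = f2 (G1 (v, xt 0)).
  apply: (@automorphism_family_constant R
    (fun q : K * K => f2 (G1 (q.2, xt q.1))) (fun q : K * K => f1 (G2 (q.2, xt q.1))) O).
  - move=> t Ot; have d0 : 0 < rho - nm (line t - w0) by rewrite subr_gt0.
    have n0 : 0 < nm (b - a) + 1 by rewrite ltr_wpDl ?nm_ge0.
    apply/nbhs_nm; exists ((rho - nm (line t - w0)) / (nm (b - a) + 1)).
      by rewrite divr_gt0.
    move=> t'; rewrite ltr_pdivlMr // => t't; rewrite /O /=.
    have -> : line t' - w0 = (t' - t) *: (b - a) + (line t - w0).
      by rewrite /line -{1}(subrK t t') scalerDl addrCA -addrA.
    apply: le_lt_trans (nmD _ _) _; rewrite nmZ.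
    by have := nm_ge0 (t' - t); nra.
  - by move=> t t01; exact: convex_ball.
  - by move=> t s Ot s1; split; [case: (T12 t s Ot s1)|case: (T21 t s Ot s1)].
  - by move=> t s Ot s1; split; [case: (T12 t s Ot s1)|case: (T21 t s Ot s1)].
  - by move=> t s Ot s1; split; [case: (T21 t s Ot s1)|case: (T12 t s Ot s1)].
have xt0 : xt 0 = y by rewrite /xt /line scale0r addr0 chart_mapK.
have xt1 : xt 1 = z by rewrite /xt /line scale1r addrC subrK chart_mapK.
move=> u Uu pu; have [u1 Gu _] := A1 u Uu ltac:(by rewrite pu).
have := const _ u1; rewrite xt0 xt1 -{1}pu Gu => ->.
have [Uy py fy _] := B1 y _ Wy u1.
by rewrite -f12 // fy.
Qed.

End FiberCharts.

Section GlobalFiberChart.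
Variables (R : realType) (E E' : normedModType R[i]).
Variables (X : complex_manifold E) (Y : complex_manifold E').
Variables (p : Y -> X) (U : set Y).
Local Notation K := (R[i]^o).
Local Notation C := (complex_line R).
Local Notation cda := complex_differentiable_at.
Hypothesis p_continuous : continuous p.
Hypothesis U_open : open U.

Lemma chart_ball_nbhs x (W : set X) : open W -> W x ->
  exists (c : chart E X) w0 rho, [/\ atlas c, ball_in_codom c w0 rho,
    open (chart_ball c w0 rho), chart_ball c w0 rho x &
    chart_ball c w0 rho `<=` W].
Proof.
move=> oW Wx; have [c Ac cx] := atlas_cover x.
have NW : \forall y \near x, W y by exact: open_nbhs_nbhs.
have /nbhs_nm [d d0 dW] := chart_near cx NW.
exists c, (chart_map c x), d; split=> //.
- by move=> w /dW [y [cy yw _ _]]; exists y.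
- rewrite openE => y [cy yd].
  have N : \forall z \near y, nm (chart_map c z - chart_map c x) < d.
    have Nw : \forall w \near chart_map c y, nm (w - chart_map c x) < d.
      apply/nbhs_nm; exists (d - nm (chart_map c y - chart_map c x)).
        by rewrite subr_gt0.
      move=> w wy; have := nmD (w - chart_map c y) (chart_map c y - chart_map c x).
      by rewrite addrA subrK; lra.
    exact: (chart_map_continuous cy Nw).
  by apply: filterS (filterI (chart_dom_near cy) N) => z [cz zd]; split.
- by split=> //; rewrite subrr nm0.
move=> y [cy yd]; have [z [cz zw zi Wz]] := dW _ yd.
by rewrite -(chart_mapK cy) zi.
Qed.

Lemma clamped_line_continuous (a u : E) :
  continuous (fun t : R => a + ((clamp t)%:C)%C *: u).
Proof.
move=> t A /nbhs_nm [d d0 dA].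
have n0 : 0 < nm u + 1 by rewrite ltr_wpDl ?nm_ge0.
have dn : 0 < d / (nm u + 1) by rewrite divr_gt0.
have N : \forall s \near t, ball (clamp t) (d / (nm u + 1)) (clamp s).
  by apply: (@clamp_continuous R t); exact: nbhsx_ballx.
apply: filterS N => s; rewrite /ball /= distrC ltr_pdivlMr // => st; apply: dA.
rewrite opprD addrACA subrr add0r -scalerBl -(rmorphB (real_complex R)) nmZ nmR.
by apply: le_lt_trans st; rewrite ler_wpM2l // lerDl.
Qed.

Lemma chart_ball_path (c : chart E X) w0 rho y z : ball_in_codom c w0 rho ->
  chart_ball c w0 rho y -> chart_ball c w0 rho z ->
  exists g : R -> X, [/\ continuous g, g 0 = y, g 1 = z &
    forall t, chart_ball c w0 rho (g t)].
Proof.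
move=> cod [cy yb] [cz zb]; set a := chart_map c y in yb; set b := chart_map c z in zb.
pose l (t : R) : E := a + ((clamp t)%:C)%C *: (b - a).
have lb t : nm (l t - w0) < rho by apply: convex_ball => //; exact: clamp01.
have c0 : clamp (0 : R) = 0 by rewrite clamp_id // lexx ler01.
have c1 : clamp (1 : R) = 1 by rewrite clamp_id // lexx ler01.
exists (chart_inv c \o l); split.
- move=> t; have [x cx xl] := cod _ (lb t).
  have ci : {for l t, continuous (chart_inv c)} by rewrite -xl; exact: chart_inv_continuous.
  exact: (@continuous_comp _ _ _ l (chart_inv c) t
    (@clamped_line_continuous a (b - a) t) ci).
- by rewrite /l /= c0 scale0r addr0 chart_mapK.
- by rewrite /l /= c1 scale1r addrC subrK chart_mapK.
move=> t; have [x cx xl] := cod _ (lb t).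
by rewrite /= -xl chart_mapK //; split=> //; rewrite xl.
Qed.

(** The germ of [f] at [x] is represented by its restriction to the fiber of [U];
    the extension by [0] gives the functions on all fibers a common type. *)
Definition restr (f : Y -> C) (x : X) : Y -> C :=
  fun u => if pselect (U u /\ p u = x) then f u else 0.

Lemma restr_eq f1 f2 x : restr f1 x = restr f2 x <->
  forall u, U u -> p u = x -> f1 u = f2 u.
Proof.
split=> [e u Uu pu|H].
  have := congr1 (fun h => h u) e; rewrite /restr.
  by case: pselect => // n; case: n.
by apply/funext => u; rewrite /restr; case: pselect => // -[Uu pu]; exact: H.
Qed.

Definition flat_chart (V : set X) (s : X -> (Y -> C)) :=
  exists f G, fiber_chart p U V f G /\ forall x, V x -> s x = restr f x.

Lemma flat_chart_elementary :
  holomorphically_locally_trivial (@unit_disc R) U p ->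
  forall x W, open W -> W x ->
  exists V, [/\ open V, V x, V `<=` W & elementary R flat_chart V].
Proof.
move=> hlt x W oW Wx.
have [V0 [f0 [G0 [oV0 V0x fc0]]]] := fiber_chart_exists p_continuous U_open x hlt.
have [c [w0 [rho [Ac cod oB Bx BW]]]] := chart_ball_nbhs (openI oW oV0) (conj Wx V0x).
exists (chart_ball c w0 rho); split=> //; first by move=> y /BW[].
have fcB : fiber_chart p U (chart_ball c w0 rho) f0 G0.
  by apply: fiber_chart_sub fc0 _ => y /BW[].
split.
- move=> s t y [f1 [G1 [fc1 s1]]] [f2 [G2 [fc2 t2]]] By.
  rewrite s1 // t2 // => /restr_eq e z Bz; rewrite s1 // t2 //.
  apply/restr_eq.
  exact: (fiber_chart_unique Ac cod fc1 fc2 By Bz e).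
- move=> y W' t By oW' W'y [f' [G' [fc' t']]].
  have [f [G [fc e]]] := fiber_chart_extend fcB fc' By W'y.
  exists (restr f); first by exists f, G.
  by rewrite t' //; apply/restr_eq.
- by move=> y z By Bz; exact: chart_ball_path.
Qed.

(** By [fiber_chart_unique] and [fiber_chart_extend] the restrictions of fiber
    charts are the local sections of a covering of [X], to which [monodromy]
    applies. *)
Lemma global_fiber_chart : simply_connected R X ->
  holomorphically_locally_trivial (@unit_disc R) U p ->
  exists F : Y -> C, forall x, exists V G,
    [/\ open V, V x & fiber_chart p U V F G].
Proof.
move=> sc hlt.
have sub V V' s : flat_chart V s -> V' `<=` V -> flat_chart V' s.
  move=> [f [G [fc sf]]] V'V; exists f, G; split; last by move=> x /V'V; exact: sf.
  exact: fiber_chart_sub fc V'V.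
have germ x : exists a, germ_value flat_chart x a.
  have [V [f [G [oV Vx fc]]]] := fiber_chart_exists p_continuous U_open x hlt.
  by exists (restr f x), V, (restr f); split=> //; exists f, G.
have [sg sgP] := monodromy sub (flat_chart_elementary hlt) sc germ.
pose F u := sg (p u) u.
exists F => x; have [V [s [oV Vx [f [G [[H1 H2] sf]]] sgs]]] := sgP x.
have FE u : U u -> V (p u) -> F u = f u.
  move=> Uu Vu; rewrite /F sgs // sf // /restr.
  by case: pselect => // n; case: n.
exists V, G; split=> //; split.
  move=> u Uu Vu; have [f1 Gf df] := H1 u Uu Vu.
  rewrite FE //; split=> //.
  apply: cda_near df; apply: filterS (over_near p_continuous U_open oV Uu Vu).
  by move=> v [Uv Vv]; rewrite FE.
move=> y z Vy z1; have [Ug pg fg dg] := H2 y z Vy z1.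
by split=> //; rewrite FE // pg.
Qed.

End GlobalFiberChart.

(** * Trivializing the line bundle *)

Section Trivialization.
Variables (R : realType) (E : normedModType R[i]).
Local Notation K := (R[i]^o).
Local Notation C := (complex_line R).
Local Notation cda := complex_differentiable_at.
Hypothesis idem : idempotent_rigid (E * K)%type.
Hypothesis swap : linear_inverse_symmetric (E * K)%type.
Variables (X : complex_manifold E) (L : line_bundle X).
Local Notation Y := (total_space L).
Local Notation p := (@bundle_proj _ _ _ L).
Local Notation vec := (@vec _ _ _ L).

Lemma proj_vec x v : p (vec x v) = x.
Proof.
have : range (vec x) (vec x v) by exists v.
by rewrite vec_range.
Qed.

Lemma vec_proj u : exists v, vec (p u) v = u.
Proof.
have : (p @^-1` [set p u]) u by [].
by rewrite -vec_range => -[v _ e]; exists v.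
Qed.

(** A trivialization [th] over [V] with inverse [Ga], with differentiability
    at points and openness of the preimage of [V] instead of
    [holomorphic_on]. *)
Definition trivialized (V : set X) (th : Y -> prod_manifold X C)
    (Ga : prod_manifold X C -> Y) :=
  [/\ forall u, V (p u) -> [/\ (th u).1 = p u, Ga (th u) = u, cda th u &
        \forall v \near u, V (p v)],
      forall x (z : K), V x ->
        [/\ p (Ga (x, z)) = x, th (Ga (x, z)) = (x, z) & cda Ga (x, z)] &
      forall x, V x -> linear (fun v => (th (vec x v)).2 : K)].

(** The preimage of [V] is only known as the image of the inverse [Ga];
    [left_inverse_near] shows that it is open. *)
Lemma trivialization_trivialized V th : open V ->
  trivialization_on p vec V th -> exists Ga, trivialized V th Ga.
Proof.
move=> oV [[Ga [hth hGa thK GaK]] th1 thl]; exists Ga.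
have oVT : open (V `*` setT : set (prod_manifold X C)).
  by apply: open_setX => //; exact: openT.
have dGa q : V q.1 -> cda Ga q.
  move=> Vq; have VTq : (V `*` setT) q by split.
  by apply: holomorphic_on_cda hGa VTq _; exact: open_nbhs_nbhs.
have near_over u : V (p u) -> \forall v \near u, V (p v).
  move=> Vu; have [h [dh hE]] := hth u Vu.
  have hu : th u = h u by apply: (nbhs_singleton hE).
  have [VTu Gu] := thK u Vu.
  have NVT : \forall q \near h u, V q.1.
    rewrite -hu.
    have N : nbhs (th u) (V `*` setT : set (prod_manifold X C)).
      by exact: open_nbhs_nbhs.
    by apply: filterS N => q [].
  have cGa : \forall q \near h u, V (p (Ga q)) -> th (Ga q) = h (Ga q).
    have [cG _] : cda Ga (h u) by apply: dGa; rewrite -hu; case: VTu.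
    have hE' : nbhs (Ga (h u)) [set v | V (p v) -> th v = h v].
      by rewrite -hu Gu; exact: hE.
    exact: (cG _ hE').
  have inv : \forall v \near u, Ga (h v) = v.
    apply: left_inverse_near => //.
    - by apply: filterS NVT => q Vq; exact: dGa.
    - by rewrite -hu.
    apply: filterS (filterI NVT cGa) => q [Vq e].
    have [VG thG] := GaK q (conj Vq I).
    by rewrite -e.
  have NV : \forall v \near u, V (h v).1 := proj1 (nbhs_singleton dh) _ NVT.
  apply: filterS (filterI inv NV) => v [Gv Vv].
  by have [VG _] := GaK (h v) (conj Vv I); rewrite /= Gv in VG.
split=> //.
- move=> u Vu; have [VTu Gu] := thK u Vu.
  split; [exact: th1|exact: Gu| |exact: (near_over u Vu)].
  by apply: (holomorphic_on_cda hth Vu); exact: (near_over u Vu).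
move=> x z Vx; have [VG thG] := GaK (x, z) (conj Vx I).
by split; [rewrite -th1 // thG|exact: thG|exact: dGa].
Qed.

Lemma locally_trivialized x : exists V th Ga,
  [/\ open V, V x & trivialized V th Ga].
Proof.
have [V [oV Vx] [th tr]] := locally_trivial L x.
by have [Ga tG] := trivialization_trivialized oV tr; exists V, th, Ga.
Qed.

Lemma proj_cda u : cda p u.
Proof.
have [V [th [Ga [oV Vu [T1 _ _]]]]] := locally_trivialized (p u).
have [_ _ dth NV] := T1 u Vu.
have D : cda (fst \o th) u.
  exact: (@cda_comp _ _ _ _ _ _ _ th (fst : prod_manifold X C -> X) u dth (cda_fst _)).
by apply: cda_near D; apply: filterS NV => v /T1[].
Qed.

Lemma proj_continuous : continuous p.
Proof. by move=> u; case: (proj_cda u). Qed.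

Lemma trivialized0 V th Ga x : trivialized V th Ga -> V x -> Ga (x, 0) = vec x 0.
Proof.
move=> [T1 _ T3] Vx.
have Vv : V (p (vec x 0)) by rewrite proj_vec.
have [e1 e2 _ _] := T1 _ Vv; rewrite -[RHS]e2; congr Ga.
rewrite [RHS]surjective_pairing e1 proj_vec; congr (_, _).
have := T3 x Vx 1 0 0; rewrite !scale1r addr0 => e.
by apply: (@addrI _ ((th (vec x 0)).2 : K)); rewrite addr0.
Qed.

Lemma trivializedZ V th Ga x v (s : K) : trivialized V th Ga -> V x ->
  vec x (s *: v) = Ga (x, s * (th (vec x v)).2 : K).
Proof.
move=> tr Vx; have [T1 T2 T3] := tr.
have Vv : V (p (vec x (s *: v))) by rewrite proj_vec.
have [e1 e2 _ _] := T1 _ Vv; rewrite -[LHS]e2; congr Ga.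
rewrite [LHS]surjective_pairing e1 proj_vec; congr (_, _).
have z0 : (th (vec x 0)).2 = 0 :> K.
  rewrite -(trivialized0 tr Vx).
  by have [_ -> _] := T2 x 0 Vx.
by have := T3 x Vx s v 0; rewrite addr0 z0 addr0.
Qed.

Variable U : set Y.
Hypothesis U_open : open U.
Hypothesis U_zero : forall x, U (vec x 0).
Variable F : Y -> C.
Hypothesis F_chart : forall x, exists V G, [/\ open V, V x & fiber_chart p U V F G].

Lemma F_cda u : U u -> nm (F u : K) < 1 /\ cda F u.
Proof.
by move=> Uu; have [V [G [_ Vu [H1 _]]]] := F_chart (p u); case: (H1 u Uu Vu).
Qed.

(** The derivative at the origin of [F] along the fiber over [x], in the
    coordinate given by the trivialization. *)
Definition multiplier (Ga : prod_manifold X C -> Y) (x : X) : C :=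
  'd (fun v : K => F (Ga (x, v)) : K) 0 (1 : K).

Section Multiplier.
Variables (V : set X) (th : Y -> prod_manifold X C) (Ga : prod_manifold X C -> Y).
Hypothesis V_open : open V.
Hypothesis tr : trivialized V th Ga.

Lemma zero_section_near x : V x ->
  \forall q \near ((x, 0) : prod_manifold X C), V q.1 /\ U (Ga q).
Proof.
move=> Vx; have [T1 T2 T3] := tr; have [_ _ dG] := T2 x 0 Vx.
have N1 : \forall q \near ((x, 0) : prod_manifold X C), V q.1.
  by apply: (proj1 (cda_fst ((x, 0) : prod_manifold X C))); exact: open_nbhs_nbhs.
have N2 : \forall q \near ((x, 0) : prod_manifold X C), U (Ga q).
  apply: (proj1 dG); apply: open_nbhs_nbhs; split=> //.
  by rewrite (trivialized0 tr Vx); exact: U_zero.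
by apply: filterS (filterI N1 N2).
Qed.

Lemma F_Ga_cda q : V q.1 -> U (Ga q) -> cda (F \o Ga) q.
Proof.
case: q => x z Vx Uq; have [_ T2 _] := tr; have [_ _ dG] := T2 x z Vx.
exact: (@cda_comp _ _ _ _ _ _ _ Ga F (x, z) dG (proj2 (F_cda Uq))).
Qed.

Lemma cda_fiber (H : prod_manifold X C -> C) x (z : C) : cda H (x, z) ->
  cda (fun z : C => H (x, z)) z.
Proof.
move=> dH; apply: (@cda_comp _ _ _ _ _ _ _
  (fun z : C => (x, z) : prod_manifold X C) H z _ dH).
by apply: cda_pair; [exact: cda_cst|exact: cda_id].
Qed.

Lemma F_Ga_differentiable x : V x ->
  differentiable (fun v : K => F (Ga (x, v)) : K) 0.
Proof.
move=> Vx; apply/cda_lineP; apply: (@cda_fiber (F \o Ga) x 0).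
by apply: F_Ga_cda; [|case: (nbhs_singleton (zero_section_near Vx))].
Qed.

(** Near the origin of a fiber the coordinate is a holomorphic function of [F],
    so the chain rule gives an inverse of the derivative. *)
Lemma multiplier_neq0 x : V x -> multiplier Ga x != 0.
Proof.
move=> Vx; have [T1 T2 T3] := tr.
have [V' [G [oV' V'x [H1 H2]]]] := F_chart x.
have U0 : U (Ga (x, 0)) by rewrite (trivialized0 tr Vx).
have dF := F_Ga_differentiable Vx.
have [F1 dF0] := F_cda U0.
pose k (z : C) : C := (th (G (z, x))).2.
have [UG pG FG dG] := H2 x _ V'x F1.
have dk : cda k (F (Ga (x, 0))).
  have VG : V (p (G (F (Ga (x, 0)), x))) by rewrite pG.
  have [_ _ dth _] := T1 _ VG.
  have D1 := cda_slice dG.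
  have D2 := @cda_comp _ _ _ _ _ _ _ (fun z : C => G (z, x)) th _ D1 dth.
  exact: (@cda_comp _ _ _ _ _ _ _ _ (snd : prod_manifold X C -> C) _ D2 (cda_snd _)).
have NU : \forall v \near (0 : K), U (Ga (x, v)).
  have [ci _] : cda (fun v : C => (x, v) : prod_manifold X C) 0.
    by apply: cda_pair; [exact: cda_cst|exact: cda_id].
  have N : \forall v \near (0 : K), V x /\ U (Ga (x, v)) :=
    ci _ (zero_section_near Vx).
  by apply: filterS N => v [].
have kF : \forall v \near (0 : K), id v = (k \o (fun v : K => F (Ga (x, v)))) v.
  apply: filterS NU => v Uv; have [pv thv _] := T2 x v Vx.
  have [_ Gv _] := H1 (Ga (x, v)) Uv ltac:(by rewrite pv).
  by rewrite /= /k -{2}pv Gv thv.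
have dk' : differentiable (k : K -> K) (F (Ga (x, 0))) by apply/cda_lineP.
have did : differentiable (id : K -> K) 0 by exact: ex_diff.
have ide : 'd (id : K -> K) 0 = id :> (K -> K) by exact: diff_val.
have [_ e1] := near_diff kF did.
have e2 := diff_comp dF dk'.
have key : 'd (k : K -> K) (F (Ga (x, 0))) (multiplier Ga x) = (1 : K).
  have app (f g : K -> K) : f = g -> f (1 : K) = g (1 : K) by move=> ->.
  exact: (etrans (esym (app _ _ e2)) (etrans (app _ _ e1) (app _ _ ide))).
apply/eqP => m0; move: key; rewrite m0 linear0 => /eqP.
by rewrite eq_sym oner_eq0.
Qed.

(** This is [fiber_derivative_differentiable] read in a chart of the base. *)
Lemma multiplier_cda x : V x -> cda (multiplier Ga) x.
Proof.
move=> Vx; apply/cda_scalarP => c Ac cx.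
pose b := prod_chart c (line_chart R).
have Ab : atlas (b : chart _ (prod_manifold X C)) by exists c, (line_chart R).
have bx : chart_dom b ((x, 0) : prod_manifold X C) by [].
have N := chart_near bx (zero_section_near Vx).
have /nbhs_nm [d d0 dH] := N.
have in_d w (v : K) : nm (w - chart_map c x) < d -> nm v < d ->
    nm ((w, v) - chart_map b (x, 0)) < d.
  move=> wd vd; have mx : Num.max (nm (w - chart_map c x)) (nm v) < d.
    by rewrite gt_max wd.
  apply: le_lt_trans mx; apply/nm_pair_le => /=.
  by rewrite subr0 !le_max !lexx orbT.
apply: (@fiber_derivative_differentiable R E
  (fun q : E * K => F (Ga (chart_inv c q.1, q.2)) : K) (chart_map c x) d 1 d0).
- move=> w v wd vd; have [q [bq bqw _ [Vq Uq]]] := dH _ (in_d w v wd vd).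
  have /cda_scalarP/(_ b Ab bq) D := F_Ga_cda Vq Uq.
  by rewrite bqw in D; exact: D.
move=> w v wd vd; have [q [bq bqw qE [Vq Uq]]] := dH _ (in_d w v wd vd).
rewrite /= -[(chart_inv c w, v)]/(chart_inv b (w, v)) qE ltW //.
by case: (F_cda Uq).
Qed.

End Multiplier.

(** The derivative of [F] at the zero section along the fibers is a linear
    isomorphism on each of them and depends holomorphically on the base point:
    it trivializes [L]. *)
Lemma fiber_derivative_trivializes : trivial_bundle L.
Proof.
have scal_ex (q : K * Y) : exists w, exists x v, vec x v = q.2 /\ w = vec x (q.1 *: v).
  have [v vu] := vec_proj q.2.
  by exists (vec (p q.2) (q.1 *: v)), (p q.2), v.
(* [scal (s, u)] is [s] times [u] in the fiber of [u]. *)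
have [scal scalP] := choice scal_ex.
pose lam (u : Y) : C := 'd (fun s : K => F (scal (s, u)) : K) 0 (1 : K).
have scalE V th Ga u (s : K) : trivialized V th Ga -> V (p u) ->
    scal (s, u) = Ga (p u, s * (th u).2 : K).
  move=> tr Vu; have [x [v [/= vu ->]]] := scalP (s, u).
  have px : p u = x by rewrite -vu proj_vec.
  by rewrite (trivializedZ v s tr) -?px // vu px.
have lamE V th Ga u : open V -> trivialized V th Ga -> V (p u) ->
    lam u = multiplier Ga (p u) * (th u).2 :> K.
  move=> oV tr Vu; pose h (v : K) : K := F (Ga (p u, v)).
  pose c : K := (th u).2.
  have z0 : (0 : K) + (0 : K) *: c = 0 by rewrite scale0r addr0.
  have dh : differentiable h (0 + (0 : K) *: c).
    by rewrite z0; exact: (F_Ga_differentiable oV tr Vu).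
  have [_ e] := line_diff dh; rewrite z0 in e.
  have E1 : (fun s : K => F (scal (s, u)) : K) = (fun s : K => h (0 + s *: c)).
    by apply/funext => s; rewrite (scalE _ _ _ _ s tr Vu) /h add0r.
  rewrite /lam E1; apply: (etrans e); apply: (etrans (diffE1 h 0 c)).
  exact: mulrC.
have lam_cda u : cda lam u.
  have [V [th [Ga [oV Vu tr]]]] := locally_trivialized (p u).
  have [T1 _ _] := tr; have [e1 _ dth NV] := T1 u Vu.
  have D1 := @cda_comp _ _ _ _ _ _ _ p (multiplier Ga) u (proj_cda u)
    (multiplier_cda oV tr Vu).
  have D2 := @cda_comp _ _ _ _ _ _ _ th (snd : prod_manifold X C -> C) u dth (cda_snd _).
  apply: cda_near (cda_mul D1 D2).
  by apply: filterS NV => v Vv; rewrite (lamE V th Ga v oV tr Vv).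
have H_ex (q : X * C) : exists u, p u = q.1 /\ lam u = q.2.
  case: q => x z; have [V [th [Ga [oV Vx tr]]]] := locally_trivialized x.
  have m0 := multiplier_neq0 oV tr Vx.
  have [_ T2 _] := tr.
  have [pG thG _] := T2 x ((multiplier Ga x : K)^-1 * z) Vx.
  exists (Ga (x, (multiplier Ga x : K)^-1 * z)); split=> //.
  rewrite (lamE V th Ga) // ?pG // thG /=.
  exact: mulVKf.
have [H HP] := choice H_ex.
have lam_inj u u' : p u = p u' -> lam u = lam u' -> u = u'.
  move=> pu; have [V [th [Ga [oV Vu tr]]]] := locally_trivialized (p u).
  have Vu' : V (p u') by rewrite -pu.
  rewrite (lamE V th Ga u oV tr Vu) (lamE V th Ga u' oV tr Vu') -pu.
  move=> /(mulfI (multiplier_neq0 oV tr Vu)) e.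
  have [T1 _ _] := tr; have [e1 Gu _ _] := T1 u Vu; have [e1' Gu' _ _] := T1 u' Vu'.
  rewrite -Gu -Gu' [th u]surjective_pairing [th u']surjective_pairing e1 e1' pu.
  by congr (Ga (_, _)).
have H_cda q : cda (H : prod_manifold X C -> Y) q.
  case: q => x z; have [V [th [Ga [oV Vx tr]]]] := locally_trivialized x.
  have [_ T2 _] := tr.
  pose h (q : prod_manifold X C) : prod_manifold X C :=
    (q.1, (multiplier Ga q.1 : K)^-1 * q.2 : K).
  have Dh : cda h (x, z).
    have D1 := @cda_comp _ _ _ _ _ _ _ (fst : prod_manifold X C -> X)
      (multiplier Ga) (x, z) (cda_fst _) (multiplier_cda oV tr Vx).
    have D2 := cda_inv D1 (multiplier_neq0 oV tr Vx).
    apply: cda_pair; first exact: cda_fst.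
    exact: (cda_mul D2 (cda_snd _)).
  have [_ _ dG] := T2 x ((multiplier Ga x : K)^-1 * z) Vx.
  have D := @cda_comp _ _ _ _ _ _ _ h Ga (x, z) Dh dG.
  apply: cda_near D.
  have NV : \forall q \near ((x, z) : prod_manifold X C), V q.1.
    by apply: (proj1 (cda_fst ((x, z) : prod_manifold X C))); exact: open_nbhs_nbhs.
  apply: filterS NV => -[x' z'] /= Vx'.
  have [pG thG _] := T2 x' ((multiplier Ga x' : K)^-1 * z') Vx'.
  have [pH lH] := HP (x', z').
  apply: lam_inj; first by rewrite /h /= pG pH.
  rewrite lH (lamE V th Ga) // /h /= ?pG // thG /=.
  exact: (mulVKf (multiplier_neq0 oV tr Vx')).
exists (fun u => (p u, lam u)); split.
- exists H; split.
  + apply: cda_holomorphic_on => u.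
    by apply: cda_pair; [exact: proj_cda|exact: lam_cda].
  + exact: cda_holomorphic_on.
  + by move=> u _; split=> //; have [pH lH] := HP (p u, lam u); exact: lam_inj.
  + move=> q _; split=> //; have [-> ->] := HP q.
    by case: q.
- by [].
move=> x _ a v w /=.
have [V [th [Ga [oV Vx tr]]]] := locally_trivialized x.
have [_ _ T3] := tr.
have lv y : lam (vec x y) = multiplier Ga x * (th (vec x y)).2 :> K.
  have Vy : V (p (vec x y)) by rewrite proj_vec.
  by have := lamE V th Ga _ oV tr Vy; rewrite proj_vec.
apply: (etrans (lv _)); rewrite (T3 x Vx a v w) mulrDr.
have E1 := lv v; have E2 := lv w.
rewrite -E2; congr (_ + _); apply: (etrans (mulrCA _ _ _)).
by rewrite -E1.
Qed.

End Trivialization.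

Theorem proposition2p3 (R : realType) (n : nat)
    (X : complex_manifold 'rV[R[i]]_n) (L : line_bundle X)
    (U : set (total_space L)) :
  simply_connected R X ->
  ~ trivial_bundle L ->
  open U ->
  (forall x : X, U (vec L x 0)) ->
  (forall x : X, biholomorphic (range (vec L x) `&` U) (@unit_disc R)) ->
  ~ holomorphically_locally_trivial (@unit_disc R) U (bundle_proj L).
Proof.
move=> sc nontrivial oU U0 _ hlt; apply: nontrivial.
have idem := @idempotent_near_id R n; have swap := @linear_inverse_swap R n.
have p_continuous := proj_continuous idem swap (L := L).
have [F F_chart] := global_fiber_chart p_continuous oU sc hlt.
exact: (fiber_derivative_trivializes idem swap oU U0 F_chart).
Qed.
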